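(* Let $\Psi$ be an invariant locally square-integrable (nonnegative) random measure on $\mathbb R^d$ with intensity $\gamma$ which is $\infty$-uniform. Then there exist invariant transport kernels $K,L$ which are probability kernels such that $\Psi=\gamma K\lambda_d$, $\lambda_d=L\lambda_d$, and $$\mathbb E\Big[\int\|x\|^q\,(K_0+L_0)(dx)\Big]<\infty,\qquad \int x^{\otimes q}\,(K_0-L_0)(dx)=0,\qquad q\in\mathbb N .$$ One can even choose $L$ to be deterministic, which implies that $\int x^{\otimes q}\,K_0(dx)$, $q\in\mathbb N$, is also deterministic. Hence $d_p(\Psi,\gamma\lambda_d)\le2\,\tilde d_p(\Psi,\gamma\lambda_d)<\infty$ for all $p\in[1,\infty)$.
   Context: $d\in\mathbb N=\{1,2,\dots\}$, $\lambda_d$ is Lebesgue measure, $B_r=\{x\in\mathbb R^d:\|x\|<r\}$. $(\Omega,\mathcal A,\mathbb P)$ is a probability space with a measurable flow $\{\theta_x:x\in\mathbb R^d\}$ ($\theta_0=\mathrm{id}$, $\theta_{x+y}=\theta_x\theta_y$, $(\omega,x)\mapsto\theta_x\omega$ measurable) preserving $\mathbb P$. A random measure $\Phi$ is a random element of the space of locally finite (nonnegative) measures on $\mathbb R^d$, invariant if $\Phi(\theta_x\omega,B)=\Phi(\omega,B+x)$, and locally square-integrable if $\mathbb E[\Phi(B_1)^2]<\infty$; its intensity $\gamma$ is given by $\mathbb E[\Phi]=\gamma\lambda_d$. With $\hat f(k)=\int e^{-i\langle k,x\rangle}f(x)\,dx$ and $\Phi(f)=\int f\,d\Phi$, the Bartlett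 spectral measure $\hat\beta_\Phi$ is the unique locally finite measure on $\mathbb R^d$ with $\mathrm{Cov}[\Phi(f),\Phi(g)]=(2\pi)^{-d}\int\hat f\,\overline{\hat g}\,d\hat\beta_\Phi$ for all bounded measurable compactly supported $f,g$. $\Phi$ is $\infty$-uniform if $\hat\beta_\Phi(B_\varepsilon)=0$ for some $\varepsilon>0$. A transport kernel $K$ assigns measurably to each $(\omega,x)\in\Omega\times\mathbb R^d$ a complex measure $K(\omega,x,\cdot)$ on $\mathbb R^d$ of finite total variation (a probability kernel if these are probability measures); $K_x=K(\cdot,x,\cdot)$ and $K\Phi(B)=\int K(x,B)\,\Phi(dx)$. $K$ is invariant if $K(\theta_z\omega,x,B)=K(\omega,x+z,B+z)$. Identities between random objects are understood almost surely; ''deterministic'' means almost surely constant. For $p\ge1$ and an invariant random measure $\Phi$ with finite intensity $\gamma$, $$d_p(\Phi,\gamma\lambda_d):=\inf\mathbb E\Big[\int\|x\|^p\,(K_0+L_0)(dx)\Big],$$ the infimum being over all invariant probability kernels $K,L$ with $\Phi=\gamma K\lambda_d$, $\lambda_d=L\lambda_d$ and $\int x^{\otimes q}(K_0-L_0)(dx)=0$ for all $q\in\mathbb N$ with $q\le\frac p2-1$; and $$\tilde d_p(\Phi,\gamma\lambda_d):=\inf\mathbb E\Big[\int\|x\|^p\,K_0(dx)\Big],$$ the infimum being over all invariant probability kernels $K$ with $\Phi=\gamma K\lambda_d$ and $\int x^{\otimes q}K_0(dx)$ deterministic for all $q\in\mathbb N$ with $q\le\frac p2-1$. *)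

(* Defs.v *)
From HB Require Import structures.
From mathcomp Require Import all_boot all_order all_algebra.
From mathcomp Require Import complex.
From mathcomp Require Import all_classical all_reals all_analysis.

Set Implicit Arguments.
Unset Strict Implicit.
Unset Printing Implicit Defensive.

Import Order.TTheory GRing.Theory Num.Theory.
Import numFieldNormedType.Exports.

Local Open Scope classical_set_scope.
Local Open Scope ring_scope.

(* R^n is ['rV[R]_n] with the product sigma-algebra of the n coordinates, as the
   library does for [n.-tuple]; it coincides with the Borel sigma-algebra. *)
Definition rV_display : measure_display. Proof. exact. Qed.

Section rV_measurable.
Context {R : realType} (n : nat).

Let coors : 'I_n -> 'rV[R]_n -> measurableTypeR R := fun i x => x ord0 i.

Let rV_set0 : g_sigma_preimage coors set0.
Proof. exact: sigma_algebra0. Qed.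

Let rV_setC A : g_sigma_preimage coors A -> g_sigma_preimage coors (~` A).
Proof. exact: sigma_algebraC. Qed.

Let rV_bigcup (F : _^nat) : (forall i, g_sigma_preimage coors (F i)) ->
  g_sigma_preimage coors (\bigcup_i (F i)).
Proof. exact: sigma_algebra_bigcup. Qed.

HB.instance Definition _ := @isMeasurable.Build rV_display
  'rV[R]_n (g_sigma_preimage coors) rV_set0 rV_setC rV_bigcup.

End rV_measurable.

Section rV_measurable_theory.
Context {R : realType}.

Lemma measurable_coord n (i : 'I_n) :
  measurable_fun [set: 'rV[R]_n] (fun x => x ord0 i : measurableTypeR R).
Proof.
move=> _ Y mY; rewrite setTI; apply: sub_sigma_algebra => /=.
rewrite -bigcup_seq/=; exists i => /=; first by rewrite mem_index_enum.
by exists Y => //; rewrite setTI.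
Qed.

Lemma measurable_fun_rVP d (T : measurableType d) n (f : T -> 'rV[R]_n) :
  measurable_fun [set: T] f <->
  forall i, measurable_fun [set: T] (fun t => f t ord0 i : measurableTypeR R).
Proof.
split=> [mf i|mf].
  exact: (measurableT_comp (measurable_coord i) mf).
pose G := image_set_system [set: T] f (measurable : set (set T)).
move=> _ Y mY; suff : G Y by [].
apply: mY; split; first exact/sigma_algebra_image/sigma_algebra_measurable.
rewrite -bigcup_seq => A [i _ [B mB <-]].
rewrite /G /image_set_system /= !setTI.
by have := mf i measurableT B mB; rewrite setTI.
Qed.

End rV_measurable_theory.

Section lebesgue_rV.
Context {R : realType}.

Definition rV_cons n (p : measurableTypeR R * 'rV[R]_n) : 'rV[R]_n.+1 :=
  \row_i oapp (fun j => p.2 ord0 j) p.1 (unlift ord0 i).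

Lemma rV_cons0 n p : @rV_cons n p ord0 ord0 = p.1.
Proof. by rewrite mxE unlift_none. Qed.

Lemma rV_consS n p i : @rV_cons n p ord0 (lift ord0 i) = p.2 ord0 i.
Proof. by rewrite mxE liftK. Qed.

Lemma measurable_rV_cons n :
  measurable_fun [set: measurableTypeR R * 'rV[R]_n] (@rV_cons n).
Proof.
apply/measurable_fun_rVP => i; case: (unliftP ord0 i) => [j|] ->.
- under eq_fun do rewrite rV_consS.
  exact: (measurableT_comp (measurable_coord j) measurable_snd).
- under eq_fun do rewrite rV_cons0.
  exact: measurable_fst.
Qed.

Section step.
Variables (n : nat) (m : {sigma_finite_measure set 'rV[R]_n -> \bar R}).
Local Open Scope ereal_scope.

Definition lebesgue_rV_step (A : set 'rV[R]_n.+1) : \bar R :=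
  (@lebesgue_measure R \x m) (@rV_cons n @^-1` A).

Let step0 : lebesgue_rV_step set0 = 0.
Proof. by rewrite /lebesgue_rV_step preimage_set0 measure0. Qed.

Let step_ge0 A : 0 <= lebesgue_rV_step A.
Proof. exact: measure_ge0. Qed.

Let step_sigma_additive : semi_sigma_additive lebesgue_rV_step.
Proof.
have mcons B : measurable B -> measurable (@rV_cons n @^-1` B).
  by move=> mB; rewrite -[X in measurable X]setTI; exact: measurable_rV_cons.
move=> F mF tF mUF; rewrite /lebesgue_rV_step preimage_bigcup.
apply: measure_semi_sigma_additive; first by move=> k; exact: mcons.
- apply/trivIsetP => /= i j _ _ ij; rewrite -preimage_setI.
  by move/trivIsetP : tF => /(_ _ _ _ _ ij) ->//; rewrite preimage_set0.
- by rewrite -preimage_bigcup; exact: mcons.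
Qed.

HB.instance Definition _ := isMeasure.Build _ _ _ lebesgue_rV_step
  step0 step_ge0 step_sigma_additive.

Let step_sigma_finite : sigma_finite [set: 'rV[R]_n.+1] lebesgue_rV_step.
Proof.
have /sigma_finiteP[F [UF ndF Foo]] := sigma_finiteT (@lebesgue_measure R).
have /sigma_finiteP[G [UG ndG Goo]] := sigma_finiteT m.
pose tl (x : 'rV[R]_n.+1) : measurableTypeR R * 'rV[R]_n :=
  (x ord0 ord0 : R, \row_j x ord0 (lift ord0 j)).
have mtl : measurable_fun [set: _] tl.
  apply: measurable_fun_pair; first exact: measurable_coord.
  apply/measurable_fun_rVP => j; under eq_fun do rewrite mxE.
  exact: measurable_coord.
have tlK p : tl (rV_cons p) = p.
  case: p => x v; rewrite /tl rV_cons0; congr pair.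
  by apply/rowP => j; rewrite mxE rV_consS.
exists (fun k => tl @^-1` (F k `*` G k)).
  rewrite -preimage_bigcup (_ : \bigcup_i _ = setT) ?preimage_setT//.
  rewrite -subTset => -[x v] _.
  have [i _ Fx] : (\bigcup_i F i) x by rewrite -UF.
  have [j _ Gv] : (\bigcup_i G i) v by rewrite -UG.
  exists (maxn i j) => //; split => /=.
    by move: Fx; exact/subsetPset/ndF/leq_maxl.
  by move: Gv; exact/subsetPset/ndG/leq_maxr.
move=> k; have [mF Fk] := Foo k; have [mG Gk] := Goo k; split.
  by rewrite -[X in measurable X]setTI; apply: mtl => //; exact: measurableX.
rewrite /lebesgue_rV_step -comp_preimage.
rewrite (_ : _ @^-1` _ = F k `*` G k).
  by rewrite product_measure1E// lte_mul_pinfty// ge0_fin_numE.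
by rewrite (_ : tl \o _ = id)//; apply/funext => p; exact: tlK.
Qed.

HB.instance Definition _ := @Measure_isSigmaFinite.Build _ _ _
  lebesgue_rV_step step_sigma_finite.

End step.

Fixpoint lebesgue_rV (n : nat) : {sigma_finite_measure set 'rV[R]_n -> \bar R} :=
  match n with
  | 0 => dirac (0 : 'rV[R]_0)
  | n.+1 => lebesgue_rV_step (lebesgue_rV n)
  end.

Lemma lebesgue_rV_box n (A : 'I_n -> set (measurableTypeR R)) :
  (forall i, measurable (A i)) ->
  lebesgue_rV n [set x | forall i, A i (x ord0 i)] =
    (\prod_(i < n) lebesgue_measure (A i))%E.
Proof.
elim: n A => [|n IHn] A mA.
  by rewrite big_ord0 /= diracE mem_set// => -[].
rewrite big_ord_recl/= /lebesgue_rV_step -IHn//.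
rewrite (_ : _ @^-1` _ =
    A ord0 `*` [set x : 'rV[R]_n | forall i, A (lift ord0 i) (x ord0 i)]).
  rewrite product_measure1E//.
  rewrite (_ : mkset _ = \bigcap_(i in [set: 'I_n])
      ((fun x : 'rV[R]_n => x ord0 i) @^-1` A (lift ord0 i))); last first.
    by apply/seteqP; split=> [x Ax i _|x Ax i]; [exact: Ax|exact: Ax].
  apply: fin_bigcap_measurable => // i _.
  by rewrite -[X in measurable X]setTI; exact: measurable_coord.
apply/seteqP; split=> [[x v] Axv|[x v] [/= Ax Av] i].
  split=> [|i] /=; first by have := Axv ord0; rewrite rV_cons0.
  by have := Axv (lift ord0 i); rewrite rV_consS.
by case: (unliftP ord0 i) => [j|] ->; rewrite ?rV_cons0 ?rV_consS.
Qed.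

End lebesgue_rV.

Section euclidean.
Context {R : realType} (d : nat).
Implicit Types (x y k : 'rV[R]_d) (B : set 'rV[R]_d).

Definition dotr x y : R := \sum_(i < d) x ord0 i * y ord0 i.

(* The library's norm on ['rV[R]_d] is the sup norm. *)
Definition enorm x : R := Num.sqrt (dotr x x).

Definition eball (r : R) : set 'rV[R]_d := [set x | enorm x < r].

Definition translate B (z : 'rV[R]_d) : set 'rV[R]_d := [set y + z | y in B].

Definition locally_finite (mu : set 'rV[R]_d -> \bar R) :=
  forall r : R, (mu (eball r) < +oo)%E.

(* The coordinates of x^{\otimes q} in the standard basis of (R^d)^{\otimes q}. *)
Definition tensor_pow (q : nat) x : {ffun q.-tuple 'I_d -> R} :=
  [ffun i => \prod_(j < q) x ord0 (tnth i j)].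

Definition has_moment (q : nat) (mu : {measure set 'rV[R]_d -> \bar R}) :=
  forall i, mu.-integrable [set: 'rV[R]_d] (fun x => (tensor_pow q x i)%:E).

Definition moment (q : nat) (mu : {measure set 'rV[R]_d -> \bar R}) :
    {ffun q.-tuple 'I_d -> R} :=
  [ffun i => Rintegral mu [set: 'rV[R]_d] (fun x => tensor_pow q x i)].

End euclidean.

Section complex_integral.
Context d {T : measurableType d} {R : realType}.
Variable mu : {measure set T -> \bar R}.

Definition cintegrable (f : T -> R[i]) :=
  mu.-integrable [set: T] (fun t => (complex.Re (f t))%:E) /\
  mu.-integrable [set: T] (fun t => (complex.Im (f t))%:E).

Definition cintegral (f : T -> R[i]) : R[i] :=
  Complex (Rintegral mu [set: T] (fun t => complex.Re (f t)))
          (Rintegral mu [set: T] (fun t => complex.Im (f t))).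

Definition ccovariance (X Y : T -> R[i]) : R[i] :=
  cintegral (fun t => (X t - cintegral X) * conjc (Y t - cintegral Y)).

End complex_integral.

Section fourier.
Context {R : realType} (d : nat).

Definition expi (t : R) : R[i] := Complex (cos t) (sin t).

Definition fourier (f : 'rV[R]_d -> R[i]) (k : 'rV[R]_d) : R[i] :=
  cintegral (lebesgue_rV d) (fun x => expi (- dotr k x) * f x).

Definition test_function (f : 'rV[R]_d -> R[i]) :=
  [/\ measurable_fun [set: 'rV[R]_d] (fun x => complex.Re (f x)),
      measurable_fun [set: 'rV[R]_d] (fun x => complex.Im (f x)),
      exists M : R, forall x, ComplexField.Normc.normc (f x) <= M &
      compact (closure [set x | f x != 0])].

End fourier.

Section stationary.
Context {dO : measure_display} {Omega : measurableType dO} {R : realType}.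
Variables (d : nat) (P : probability Omega R).
Variable theta : 'rV[R]_d -> Omega -> Omega.

Definition measurable_flow :=
  [/\ theta 0 = id,
      forall x y, theta (x + y) = theta x \o theta y &
      measurable_fun [set: Omega * 'rV[R]_d] (fun p => theta p.2 p.1)].

Definition measure_preserving_flow :=
  forall x (A : set Omega), measurable A -> P (theta x @^-1` A) = P A.

Section random_measure.
Variable Phi : R.-ker Omega ~> 'rV[R]_d.

Definition random_measure := forall w, locally_finite (Phi w).

Definition invariant_measure := forall x w (B : set 'rV[R]_d), measurable B ->
  Phi (theta x w) B = Phi w (translate B x).

Definition locally_square_integrable :=
  (\int[P]_w (Phi w (eball 1) ^+ 2) < +oo)%E.

Definition has_intensity (gamma : R) :=
  forall B : set 'rV[R]_d, measurable B ->
  (\int[P]_w Phi w B = gamma%:E * lebesgue_rV d B)%E.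

(* The integrability of h is stated explicitly because [Rintegral] is total:
   an integral that does not exist is given the value 0. *)
Definition bartlett_spectral_measure
    (beta : {measure set 'rV[R]_d -> \bar R}) :=
  locally_finite beta /\
  forall f g : 'rV[R]_d -> R[i], test_function f -> test_function g ->
    let h := fun k => fourier f k * conjc (fourier g k) in
    cintegrable beta h /\
    ccovariance P (fun w => cintegral (Phi w) f) (fun w => cintegral (Phi w) g)
      = real_complex R ((2 * pi) ^- d) * cintegral beta h.

(* For a locally square-integrable invariant Phi the spectral measure exists and
   is unique, so the existential below only names it. *)
Definition infty_uniform :=
  exists2 beta : {measure set 'rV[R]_d -> \bar R},
    bartlett_spectral_measure beta &
    exists2 eps : R, 0 < eps & beta (eball eps) = 0%E.

End random_measure.

Section kernels.
Implicit Types K L : R.-pker (Omega * 'rV[R]_d)%type ~> 'rV[R]_d.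

Definition invariant_kernel K :=
  forall z w x (B : set 'rV[R]_d), measurable B ->
  K (theta z w, x) B = K (w, x + z) (translate B z).

Definition transport K w (mu : set 'rV[R]_d -> \bar R) (B : set 'rV[R]_d) :=
  (\int[mu]_x K (w, x) B)%E.

(* mu = gamma K lambda_d, almost surely as an identity of random measures *)
Definition transports_lebesgue (gamma : R) K
    (mu : Omega -> {measure set 'rV[R]_d -> \bar R}) :=
  {ae P, forall w, forall B : set 'rV[R]_d, measurable B ->
    mu w B = (gamma%:E * transport K w (lebesgue_rV d) B)%E}.

Definition moment_cost (p : R) (mu : Omega -> {measure set 'rV[R]_d -> \bar R}) :=
  (\int[P]_w \int[mu w]_x (enorm x `^ p)%:E)%E.

Definition pair_cost (p : R) K L :=
  moment_cost p (fun w => measure_add (K (w, 0)) (L (w, 0))).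

(* The integral of x^{\otimes q} against the signed measure K_0 - L_0 is the
   difference of the two moments; both are required to exist. *)
Definition equal_moment (q : nat) K L :=
  {ae P, forall w, [/\ has_moment q (K (w, 0)), has_moment q (L (w, 0)) &
    moment q (K (w, 0)) - moment q (L (w, 0)) = 0]}.

Definition deterministic_moment (q : nat) K :=
  exists c, {ae P, forall w,
    has_moment q (K (w, 0)) /\ moment q (K (w, 0)) = c}.

Definition deterministic_kernel K :=
  exists k : 'rV[R]_d -> set 'rV[R]_d -> \bar R,
    {ae P, forall w, forall x (B : set 'rV[R]_d), measurable B ->
      K (w, x) B = k x B}.

Variables (Phi : R.-ker Omega ~> 'rV[R]_d) (gamma p : R).

Definition transport_dist : \bar R := ereal_inf
  [set c | exists K L, [/\
      invariant_kernel K /\ invariant_kernel L,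
      transports_lebesgue gamma K Phi,
      transports_lebesgue 1 L (fun=> lebesgue_rV d),
      forall q : nat, (0 < q)%N -> q%:R <= p / 2 - 1 -> equal_moment q K L &
      c = pair_cost p K L]].

Definition transport_dist_tilde : \bar R := ereal_inf
  [set c | exists K, [/\
      invariant_kernel K,
      transports_lebesgue gamma K Phi,
      forall q : nat, (0 < q)%N -> q%:R <= p / 2 - 1 ->
        deterministic_moment q K &
      c = moment_cost p (fun w => K (w, 0))]].

End kernels.
End stationary.

(* Main.v *)
(** Spread Lebesgue measure over [Psi] with a smooth weight, setting
    [K(w, x, dy) = gamma^-1 chi(x - y) Psi(w, dy)], where [chi >= 0] is an even, rapidly
    decreasing function of integral 1 such that the Fourier transforms of all the functions
    [x^{\otimes q} chi(x)] vanish outside the ball [B_eps] that the spectral measure does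
    not charge.  For such a function [u] the variance of [Psi(u)] is
    [(2 pi)^-d \int |\hat u|^2 d beta = 0], so [Psi(u)] is almost surely constant.  With
    [u = chi] and stationarity, [\int chi(x - y) Psi(dy) = gamma], so that [K] is a
    probability kernel; with [u = x^{\otimes q} chi], the moments of [K_0] are deterministic.
    The spectral identity is only given for compactly supported test functions; it reaches
    [u] through the truncations [u 1_{B_n}] and the square-integrability of [Psi(g)] for
    [g(x) = \prod_i (1 + x_i^2)^-1].

    The kernel [L(w, x, .)] is the law of [x + Y], where [Y] has the mean law [E K_0].  It is
    invariant, deterministic, transports Lebesgue measure to itself, and has the same cost and
    the same moments as [K_0].  This applies to any competitor in the definition of
    [\tilde d_p], and gives [d_p <= 2 \tilde d_p]. *)

From HB Require Import structures.
From mathcomp Require Import all_boot all_order all_algebra.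
From mathcomp Require Import complex.
From mathcomp Require Import all_classical all_reals all_analysis.
From mathcomp Require Import measurable_realfun ring lra.
Require Import Defs.

Set Implicit Arguments.
Unset Strict Implicit.
Unset Printing Implicit Defensive.

Import Order.TTheory GRing.Theory Num.Theory.
Import numFieldNormedType.Exports.

Local Open Scope classical_set_scope.
Local Open Scope ring_scope.

(** * Affine substitutions, mixtures and densities *)

(** The obstacle is that the spectral identity sees only compactly supported functions, and a
    nonzero band-limited function never has compact support. Cutting [u] at radius n spoils its
    band, so the variance of the cut-off function is not 0. It is bounded by a tail second moment
    instead, by applying the identity to differences of two truncations: off the band their
    transforms tend to minus the transform of the inner truncation.

    The function chi is a product over the coordinates of one function h, itself an infinite product
    of factors sinc(a_j t)^2. Band widths add under multiplication, so the a_j are chosen summable.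
    Finitely many factors already give any prescribed power of decay, and a factor can absorb a
    power of t without leaving the band, which handles all moments at once. A vanishing Fourier
    transform is tested on the real functions cos(k t + c), and sinc is a limit of products of
    cosines; product-to-sum formulas thus replace convolution.

    K has to be an invariant probability kernel at every sample point, while the normalisation by
    gamma holds only almost surely; this forces a fallback kernel that commutes with the flow. *)

Section affine_substitution.
Context {R : realType}.
Local Notation mu := (@lebesgue_measure R).
Local Open Scope ereal_scope.

Lemma measurable_affine (c b : R) :
  measurable_fun [set: R] (fun t : R => (c * t + b)%R).
Proof. by apply: measurable_funD => //; exact: measurable_funM. Qed.

Lemma lebesgue_measure_affine (c b : R) (A : set R) :
  c != 0%R -> measurable A ->
  `|c|%:E * pushforward mu (fun t : R => (c * t + b)%R : measurableTypeR R) A = mu A.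
Proof.
move=> c0 mA; have maf := measurable_affine c b.
pose nu : {measure set (measurableTypeR R) -> \bar R} :=
  mscale (NngNum (normr_ge0 c)) (pushforward mu (fun t : R => (c * t + b)%R : measurableTypeR R)).
apply/esym; rewrite -[RHS]/(nu maf A); apply: lebesgue_measure_unique => //.
move=> _ [[x y]] _ <-; change (mu `]x, y] = `|c|%:E * mu ((fun t : R => (c * t + b)%R) @^-1` `]x, y]))%E.
have [c_gt0|c_lt0|c_eq0] := ltgtP 0%R c; last by rewrite c_eq0 eqxx in c0.
- rewrite (_ : _ @^-1` _ = `]((x - b) / c)%R, ((y - b) / c)%R]%classic).
    rewrite !lebesgue_measure_itv/= !lte_fin ltr_pM2r ?invr_gt0// ltrD2r.
    case: ifPn => _; last by rewrite mule0.
    by rewrite gtr0_norm// -EFinB -EFinM; congr EFin; field; rewrite gt_eqF.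
  apply/seteqP; split => t /=; rewrite !in_itv/= ltr_pdivrMr// ler_pdivlMr//;
    rewrite ltrBlDr lerBrDr [(t * c)%R]mulrC//.
(* A negative slope reverses the interval, so the preimage is closed on the left and open on the
   right; the measure does not see the endpoints. *)
- rewrite (_ : _ @^-1` _ = `[((y - b) / c)%R, ((x - b) / c)%R[%classic).
    rewrite !lebesgue_measure_itv/= !lte_fin ltr_nM2r ?invr_lt0// ltrD2r.
    case: ifPn => _; last by rewrite mule0.
    by rewrite ltr0_norm// -EFinB -EFinM; congr EFin; field; rewrite lt_eqF.
  apply/seteqP; split => t /=; rewrite !in_itv/= ler_ndivrMr// ltr_ndivlMr//;
    rewrite ltrBlDr lerBrDr [(t * c)%R]mulrC andbC//.
Qed.

Lemma ge0_integral_affine (c b : R) (f : R -> \bar R) :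
  c != 0%R -> measurable_fun [set: R] f -> (forall t, 0 <= f t) ->
  `|c|%:E * \int[mu]_t f (c * t + b)%R = \int[mu]_t f t.
Proof.
move=> c0 mf f0; have maf := measurable_affine c b.
have := @ge0_integral_pushforward _ _ (measurableTypeR R) (measurableTypeR R) R _ maf mu setT f measurableT mf (in1W f0).
rewrite preimage_setT /comp => <-.
rewrite -(ge0_integral_mscale _ _ (NngNum (normr_ge0 c)))//.
by apply: eq_measure_integral => A mA _; exact: lebesgue_measure_affine.
Qed.

Lemma Rintegral_odd (f : R -> R) :
  measurable_fun [set: R] f -> (forall t, f (- t)%R = (- f t)%R) ->
  Rintegral mu setT f = 0%R.
Proof.
move=> mf fN; rewrite /Rintegral integralE.
have mEf : measurable_fun [set: R] (EFin \o f) by exact/measurable_EFinP.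
rewrite -[X in _ - X](@ge0_integral_affine (-1) 0)//; last exact: measurable_funeneg.
rewrite normrN1 mul1e.
under [X in _ - X]eq_integral do rewrite funenegE mulN1r addr0 fN EFinN oppeK -(funeposE (EFin \o f)).
(* The two parts have equal integrals by reflection. If both are infinite, their difference is an
   infinite value, which [fine] sends to 0. *)
suff E (x y : \bar R) : x = y -> fine (x - y) = 0%R by exact: E.
by move=> <-; case: x => //= r; rewrite subrr.
Qed.

Lemma integrable_oneDsqrV : mu.-integrable setT (fun t : R => ((1 + t ^+ 2)^-1)%:E).
Proof.
have mo : measurable_fun [set: R] (fun t : R => ((1 + t ^+ 2)^-1)%R).
  apply: continuous_measurable_fun; exact: continuous_oneDsqrV.
apply/integrableP; split; first exact/measurable_EFinP.
under eq_integral do rewrite gee0_abs ?lee_fin ?invr_ge0 ?addr_ge0 ?sqr_ge0//.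
have mE : measurable_fun [set: R] (fun t : R => ((1 + t ^+ 2)^-1)%:E).
  exact/measurable_EFinP.
have f0 (r : R) : 0 <= ((1 + r ^+ 2)^-1)%:E.
  by rewrite lee_fin invr_ge0 addr_ge0 ?sqr_ge0.
rewrite -(setUv `[0%R, +oo[%classic) ge0_integral_setU//=; last 3 first.
  exact: measurableC.
  by rewrite setUv.
  by apply/disj_setPS; rewrite setICr.
have I0 := @integral0y_oneDsqr R.
rewrite I0 setCitvr lte_add_pinfty ?ltry//.
have := ge0_integration_by_substitution0 mE f0; rewrite I0 => E.
apply: (@le_lt_trans _ _ (\int[mu]_(r in `]-oo, 0%R]) ((1 + (- r) ^+ 2)^-1)%:E)); last first.
  by rewrite -E ltry.
under [leRHS]eq_integral do rewrite sqrrN.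
by apply: ge0_subset_integral => //; [exact: measurable_funS mE| move=> x /=; rewrite !in_itv/=; exact: ltW].
Qed.

End affine_substitution.

Section mixture.
Local Open Scope ereal_scope.
Context d1 d2 (Y : measurableType d1) (Z : measurableType d2) (R : realType).
Variables (m : {measure set Y -> \bar R}) (k : Y -> {measure set Z -> \bar R})
  (nu : {measure set Z -> \bar R}).
Hypothesis mk : forall U, measurable U -> measurable_fun [set: Y] (k ^~ U).
Hypothesis nuE : forall U, measurable U -> nu U = \int[m]_y k y U.

Import HBNNSimple.

Let mixture_nnsfun (f : {nnsfun Z >-> R}) :
  \int[nu]_z (f z)%:E = \int[m]_y (\int[k y]_z (f z)%:E).
Proof.
have E (mu : {measure set Z -> \bar R}) :
    \int[mu]_z (f z)%:E = \sum_(r \in range f) (r%:E * mu (f @^-1` [set r])).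
  by rewrite integralT_nnsfun sintegralE.
under [RHS]eq_integral do rewrite E.
rewrite E ge0_integral_fsum//.
- apply: eq_fsbigr => r /set_mem[z _ <-].
  rewrite ge0_integralZl//; [by rewrite nuE|exact: mk|by rewrite lee_fin].
- by move=> r; apply: emeasurable_funM => //; exact: mk.
- move=> r y _; have [r0|r0] := leP 0%R r; first by rewrite mule_ge0.
  by rewrite preimage_nnfun0// measure0 mule0.
Qed.

Lemma measurable_integral_kernel f : (forall z, 0 <= f z) ->
  measurable_fun [set: Z] f -> measurable_fun [set: Y] (fun y => \int[k y]_z f z).
Proof. by move=> f0 mf; exact: measurable_fun_integral_kernel. Qed.

(** Used three times: with weighted Dirac masses it integrates against a density, with the random
    measure it is Campbell's formula, and with [K_0] it integrates against the mean law. *)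
Lemma ge0_integral_mixture f : (forall z, 0 <= f z) ->
  measurable_fun [set: Z] f -> \int[nu]_z f z = \int[m]_y \int[k y]_z f z.
Proof.
move=> f0 mf; pose f_ := nnsfun_approx measurableT mf.
have fE (mu' : {measure set Z -> \bar R}) : \int[mu']_z f z = limn (fun n => \int[mu']_z (f_ n z)%:E).
  rewrite -monotone_convergence//.
  - by apply: eq_integral => z _; apply/esym/cvg_lim => //; exact: cvg_nnsfun_approx.
  - by move=> n; exact/measurable_EFinP.
  - by move=> n z _; rewrite lee_fin.
  - by move=> z _ a b ab; rewrite lee_fin; exact/lefP/nd_nnsfun_approx.
rewrite fE; under eq_fun do rewrite mixture_nnsfun.
rewrite -monotone_convergence//; first by apply: eq_integral => y _; rewrite -fE.
- by move=> n; apply: measurable_integral_kernel => //; [move=> z; rewrite lee_fin|exact/measurable_EFinP].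
- by move=> n y _; apply: integral_ge0 => // z _; rewrite lee_fin.
- move=> y _ a b ab; apply: ge0_le_integral => //.
  + by move=> z _; rewrite lee_fin.
  + exact/measurable_EFinP.
  + exact/measurable_EFinP.
  + by move=> z _; rewrite lee_fin; exact/lefP/nd_nnsfun_approx.
Qed.

Lemma integral_mixture (f : Z -> \bar R) : nu.-integrable [set: Z] f ->
  {ae m, forall y, (k y).-integrable [set: Z] f} /\
  \int[nu]_z f z = \int[m]_y \int[k y]_z f z.
Proof.
move=> fi; have mf := measurable_int _ fi.
have [mp mn] := (measurable_funepos mf, measurable_funeneg mf).
have ip : m.-integrable setT (fun y => \int[k y]_z f^\+ z).
  apply/integrableP; split; first exact: measurable_integral_kernel.
  under eq_integral do rewrite gee0_abs ?integral_ge0//.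
  by rewrite -ge0_integral_mixture//; exact: integral_funepos_lt_pinfty.
have in_ : m.-integrable setT (fun y => \int[k y]_z f^\- z).
  apply/integrableP; split; first exact: measurable_integral_kernel.
  under eq_integral do rewrite gee0_abs ?integral_ge0//.
  by rewrite -ge0_integral_mixture//; exact: integral_funeneg_lt_pinfty.
split.
  have := integrable_ae measurableT ip; apply: filterS2 (integrable_ae measurableT in_).
  move=> y /(_ I) hn /(_ I) hp; apply/integrableP; split=> //.
  rewrite -[X in X < _]/(\int[k y]_z (abse \o f) z) fune_abse.
  rewrite ge0_integralD// lte_add_pinfty// ltey_eq.
    by rewrite hp.
  by rewrite hn.
rewrite integralE !ge0_integral_mixture// -integralB//.
by apply: eq_integral => y _; rewrite [RHS]integralE.
Qed.

End mixture.

Section density.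
Local Open Scope ereal_scope.
Context d (T : measurableType d) (R : realType).
Variables (mu : {measure set T -> \bar R}) (phi : T -> R).
Hypotheses (mphi : measurable_fun [set: T] phi) (phi0 : forall t, (0 <= phi t)%R).

(** The two proofs are arguments so that the measure structure declared below can be inferred from
    the term alone. *)
Definition mdensity of measurable_fun [set: T] phi & (forall t, (0 <= phi t)%R) :=
  fun A => \int[mu]_(t in A) (phi t)%:E.

Let density0 : mdensity mphi phi0 set0 = 0.
Proof. exact: integral_set0. Qed.

Let density_ge0 A : 0 <= mdensity mphi phi0 A.
Proof. by apply: integral_ge0 => t _; rewrite lee_fin. Qed.

Let density_sigma_additive : semi_sigma_additive (mdensity mphi phi0).
Proof.
move=> F mF tF mUF; rewrite /mdensity ge0_integral_bigcup//.
- by apply: is_cvg_nneseries => n _ _; exact: density_ge0.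
- exact/measurable_EFinP/measurable_funTS.
- by move=> t _; rewrite lee_fin.
Qed.

HB.instance Definition _ := isMeasure.Build _ _ _ (mdensity mphi phi0)
  density0 density_ge0 density_sigma_additive.

(** The measure of density phi is the mixture over mu of the masses phi(t) at t, so its integration
    formulas are instances of those for mixtures. *)
Let weighted_dirac (t : T) : {measure set T -> \bar R} :=
  mscale (NngNum (phi0 t)) (dirac t).

Let measurable_weighted_dirac U : measurable U ->
  measurable_fun [set: T] (weighted_dirac ^~ U).
Proof.
move=> mU; apply: emeasurable_funM; first exact/measurable_EFinP.
by apply/measurable_EFinP; exact: measurable_indic.
Qed.

Let densityE U : measurable U -> mdensity mphi phi0 U = \int[mu]_t weighted_dirac t U.
Proof.
move=> mU; rewrite /mdensity integral_mkcond; apply: eq_integral => t _.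
rewrite /weighted_dirac/= /mscale /= diracE patchE.
by case: (t \in U); rewrite ?mule1 ?mule0.
Qed.

Let ge0_integral_weighted_dirac f t : measurable_fun [set: T] f ->
  (forall z, 0 <= f z) -> \int[weighted_dirac t]_z f z = (phi t)%:E * f t.
Proof.
move=> mf f0; rewrite /weighted_dirac ge0_integral_mscale//=.
by rewrite integral_dirac// diracT mul1e.
Qed.

Lemma ge0_integral_mdensity (f : T -> \bar R) : measurable_fun [set: T] f ->
  (forall t, 0 <= f t) ->
  \int[mdensity mphi phi0]_t f t = \int[mu]_t ((phi t)%:E * f t).
Proof.
move=> mf f0.
rewrite (ge0_integral_mixture measurable_weighted_dirac densityE)//.
by apply: eq_integral => t _; exact: ge0_integral_weighted_dirac.
Qed.

Lemma integral_mdensity (f : T -> R) : measurable_fun [set: T] f ->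
  mu.-integrable [set: T] (EFin \o (fun t => (phi t * f t)%R)) ->
  (mdensity mphi phi0).-integrable [set: T] (EFin \o f) /\
  \int[mdensity mphi phi0]_t (f t)%:E = \int[mu]_t (phi t * f t)%:E.
Proof.
move=> mf /integrableP[_ fi].
have mEf : measurable_fun [set: T] (EFin \o f) by exact/measurable_EFinP.
have [mp mn] := (measurable_funepos mEf, measurable_funeneg mEf).
have di : (mdensity mphi phi0).-integrable [set: T] (EFin \o f).
  apply/integrableP; split=> //.
  rewrite ge0_integral_mdensity//; last exact: measurableT_comp.
  apply: le_lt_trans fi; under [leRHS]eq_integral do rewrite /= normrM (ger0_norm (phi0 _)) EFinM.
  by [].
split => //; have [_] := integral_mixture measurable_weighted_dirac densityE di.
move=> ->; apply: eq_integral => t _; rewrite integralE !ge0_integral_weighted_dirac//.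
rewrite EFinM [(f t)%:E in RHS](_ : _ = (EFin \o f)^\+ t - (EFin \o f)^\- t).
  by rewrite muleBr// fin_num_adde_defr// funeposE /= -EFin_max.
by rewrite -[(f t)%:E]/((EFin \o f) t) {1}(funeposneg (EFin \o f)).
Qed.

End density.

Section sigma_finite_pack.
Context d (T : measurableType d) (R : realType).
Variable mu : {measure set T -> \bar R}.

Definition sigma_finite_alias of sigma_finite [set: T] mu : set T -> \bar R := mu.

Hypothesis smu : sigma_finite [set: T] mu.

HB.instance Definition _ := Measure.on (sigma_finite_alias smu).
HB.instance Definition _ :=
  @Measure_isSigmaFinite.Build _ _ _ (sigma_finite_alias smu) smu.

(** Tonelli's theorem expects a bundled sigma-finite measure, while a realisation [Psi w] is
    sigma-finite only through a proof of local finiteness. An equality of measures allows rewriting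
    one into the other. *)
Lemma sigma_finite_pack : exists nu : {sigma_finite_measure set T -> \bar R},
  mu = nu :> {measure set T -> \bar R}.
Proof. by exists (sigma_finite_alias smu); apply: eq_measure. Qed.

End sigma_finite_pack.

(** * Lebesgue measure on R^n *)

Section euclidean_measurability.
Context {R : realType} (n : nat).
Implicit Types x y : 'rV[R]_n.

Lemma measurable_rV_add d (T : measurableType d) (f g : T -> 'rV[R]_n) :
  measurable_fun [set: T] f -> measurable_fun [set: T] g ->
  measurable_fun [set: T] (fun t => f t + g t).
Proof.
move=> /measurable_fun_rVP mf /measurable_fun_rVP mg; apply/measurable_fun_rVP => i.
by under eq_fun do rewrite mxE; apply: measurable_funD; [exact: mf|exact: mg].
Qed.

Lemma measurable_rV_opp d (T : measurableType d) (f : T -> 'rV[R]_n) :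
  measurable_fun [set: T] f -> measurable_fun [set: T] (fun t => - f t).
Proof.
move=> /measurable_fun_rVP mf; apply/measurable_fun_rVP => i.
by under eq_fun do rewrite mxE; apply: measurable_funN; exact: mf.
Qed.

Lemma measurable_rV_sub d (T : measurableType d) (f g : T -> 'rV[R]_n) :
  measurable_fun [set: T] f -> measurable_fun [set: T] g ->
  measurable_fun [set: T] (fun t => f t - g t).
Proof. by move=> mf mg; apply: measurable_rV_add => //; exact: measurable_rV_opp. Qed.

Lemma measurable_shift (z : 'rV[R]_n) : measurable_fun [set: 'rV[R]_n] (fun x => x + z).
Proof. by apply: measurable_rV_add => //; exact: measurable_cst. Qed.

Lemma measurable_rV_coord d (T : measurableType d) (f : T -> 'rV[R]_n) i :
  measurable_fun [set: T] f -> measurable_fun [set: T] (fun t => f t ord0 i : R).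
Proof. by move=> /measurable_fun_rVP/(_ i). Qed.

Lemma measurable_dotr (k : 'rV[R]_n) : measurable_fun [set: 'rV[R]_n] (dotr k).
Proof.
rewrite /dotr; apply: measurable_sum => i; apply: measurable_funM => //.
exact: measurable_rV_coord.
Qed.

Lemma dotr_ge0 x : 0 <= dotr x x.
Proof. by apply: sumr_ge0 => i _; rewrite -expr2 sqr_ge0. Qed.

Lemma enorm_ge0 x : 0 <= enorm x.
Proof. exact: sqrtr_ge0. Qed.

Lemma measurable_enorm : measurable_fun [set: 'rV[R]_n] (@enorm R n).
Proof.
apply: (@measurableT_comp _ _ _ _ _ _ (@Num.sqrt R)).
  exact: (continuous_measurable_fun (@sqrt_continuous R)).
rewrite /dotr; apply: measurable_sum => i.
by apply: measurable_funM; exact: measurable_rV_coord.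
Qed.

Lemma measurable_eball r : measurable (@eball R n r).
Proof.
have := measurable_enorm measurableT (measurable_itv `]-oo, r[).
by rewrite setTI; congr measurable; apply/seteqP; split => x; rewrite /eball/= in_itv.
Qed.

Lemma coord_le_enorm x i : `|x ord0 i| <= enorm x.
Proof.
rewrite -sqrtr_sqr ler_wsqrtr// /dotr (bigD1 i)//= -expr2 lerDl.
by apply: sumr_ge0 => j _; rewrite -expr2 sqr_ge0.
Qed.

Lemma enormN x : enorm (- x) = enorm x.
Proof.
by congr (Num.sqrt _); apply: eq_bigr => i _; rewrite !mxE mulrNN.
Qed.

Lemma translateE (B : set 'rV[R]_n) z : translate B z = (fun x => x - z) @^-1` B.
Proof.
apply/seteqP; split => [x [y By <-]|x Bx] /=; first by rewrite addrK.
by exists (x - z) => //; rewrite subrK.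
Qed.

Lemma measurable_translate (B : set 'rV[R]_n) z :
  measurable B -> measurable (translate B z).
Proof.
move=> mB; rewrite translateE -[X in measurable X]setTI.
exact: (measurable_shift (- z)).
Qed.

End euclidean_measurability.

Section lebesgue_rV_theory.
Context {R : realType}.
Local Open Scope ereal_scope.
Local Notation mu := (@lebesgue_measure R).

Lemma measurable_rV_consr n d (T : measurableType d) (f : T -> R) (g : T -> 'rV[R]_n) :
  measurable_fun [set: T] f -> measurable_fun [set: T] g ->
  measurable_fun [set: T] (fun t => rV_cons (f t, g t)).
Proof.
move=> mf mg.
exact: (measurableT_comp (@measurable_rV_cons R n) (measurable_fun_pair mf mg)).
Qed.

Lemma ge0_integral_lebesgue_rVS n (f : 'rV[R]_n.+1 -> \bar R) :
  measurable_fun setT f -> (forall x, 0 <= f x) ->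
  \int[lebesgue_rV n.+1]_x f x =
  \int[mu]_t \int[lebesgue_rV n]_v f (rV_cons (t, v)).
Proof.
move=> mf f0; have mc := @measurable_rV_cons R n.
transitivity (\int[pushforward (mu \x lebesgue_rV n) (@rV_cons R n)]_x f x).
  by apply: eq_measure_integral.
rewrite ge0_integral_pushforward// preimage_setT fubini_tonelli1//.
  exact: measurableT_comp.
by move=> x; exact: f0.
Qed.

Lemma ge0_integral_lebesgue_rV0 (f : 'rV[R]_0 -> \bar R) :
  measurable_fun setT f -> \int[lebesgue_rV 0]_x f x = f 0%R.
Proof. by move=> mf; rewrite integral_dirac// diracT mul1e. Qed.

Lemma ge0_integral_translation n (f : 'rV[R]_n -> \bar R) z :
  measurable_fun setT f -> (forall x, 0 <= f x) ->
  \int[lebesgue_rV n]_x f (x + z)%R = \int[lebesgue_rV n]_x f x.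
Proof.
elim: n f z => [|n IHn] f z mf f0.
  rewrite !ge0_integral_lebesgue_rV0//; first by congr f; apply/rowP => -[].
  exact: (measurableT_comp mf (measurable_shift z)).
have mfz : measurable_fun setT (fun x : 'rV[R]_n.+1 => f (x + z)%R).
  exact: (measurableT_comp mf (measurable_shift z)).
rewrite (ge0_integral_lebesgue_rVS mfz (fun x => f0 _)) (ge0_integral_lebesgue_rVS mf f0).
pose z' : 'rV[R]_n := (\row_j z ord0 (lift ord0 j))%R.
have zE t v : (rV_cons (t, v) + z = rV_cons ((t + z ord0 ord0)%R, v + z'))%R.
  apply/rowP => i; rewrite !mxE /=; case: unliftP => [j|] -> /=; by rewrite ?mxE.
under eq_integral do under eq_integral do rewrite zE.
under eq_integral => t _.
  rewrite (IHn (fun v => f (rV_cons (t + z ord0 ord0, v)%R)))//; first over.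
  exact: (measurableT_comp mf (measurable_rV_consr (measurable_cst _) _)).
have := @ge0_integral_affine R 1 (z ord0 ord0)
  (fun t => \int[lebesgue_rV n]_v f (rV_cons (t, v))) (oner_neq0 _).
rewrite normr1 mul1e => <-.
- by apply: eq_integral => t _; rewrite mul1r.
- apply: (measurable_fun_fubini_tonelli_F (m2 := lebesgue_rV n) (f \o @rV_cons R n)) => //.
    exact: (measurableT_comp mf (@measurable_rV_cons R n)).
  by move=> x; exact: f0.
- by move=> t; exact: integral_ge0.
Qed.

Lemma ge0_integral_prod n (g : 'I_n -> R -> R) :
  (forall i, measurable_fun setT (g i)) -> (forall i t, (0 <= g i t)%R) ->
  \int[lebesgue_rV n]_x (\prod_(i < n) g i (x ord0 i))%:E =
  \prod_(i < n) \int[mu]_t (g i t)%:E.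
Proof.
elim: n g => [|n IHn] g mg g0.
  rewrite ge0_integral_lebesgue_rV0; first by rewrite !big_ord0.
  by under eq_fun do rewrite big_ord0; exact: measurable_cst.
have mp m (h : 'I_m -> R -> R) : (forall i, measurable_fun setT (h i)) ->
    measurable_fun setT (fun x : 'rV[R]_m => (\prod_(i < m) h i (x ord0 i))%R).
  move=> mh; apply: measurable_prod => i _.
  exact: (measurableT_comp (mh i) (measurable_coord i)).
rewrite ge0_integral_lebesgue_rVS; last 2 first.
- by apply/measurable_EFinP; exact: (mp _ g).
- by move=> x; rewrite lee_fin prodr_ge0.
rewrite big_ord_recl.
have mS : measurable_fun setT (fun v : 'rV[R]_n => (\prod_(i < n) g (lift ord0 i) (v ord0 i))%:E).
  by apply/measurable_EFinP; exact: (mp _ (fun i => g (lift ord0 i))).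
have inner t : \int[lebesgue_rV n]_v (\prod_(i < n.+1) g i (rV_cons (t, v) ord0 i))%:E =
    (g ord0 t)%:E * \prod_(i < n) \int[mu]_t (g (lift ord0 i) t)%:E.
  rewrite -(IHn (fun i => g (lift ord0 i)))// -ge0_integralZl//.
  - apply: eq_integral => v _; rewrite big_ord_recl rV_cons0 EFinM.
    by under eq_bigr do rewrite rV_consS.
  - by move=> v _; rewrite lee_fin prodr_ge0.
  - by rewrite lee_fin.
under eq_integral do rewrite inner.
rewrite ge0_integralZr//.
- by apply/measurable_EFinP; exact: (mg ord0).
- by move=> t _; rewrite lee_fin.
- by apply: prode_ge0 => i _; apply: integral_ge0 => t _; rewrite lee_fin.
Qed.

End lebesgue_rV_theory.

(** * Band-limited functions on the line *)

Section sinc.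
Context {R : realType}.
Implicit Types t x y a : R.

Definition sinc x : R := if x == 0 then 1 else sin x / x.

Lemma mul_sinc x : x * sinc x = sin x.
Proof.
rewrite /sinc; case: eqVneq => [->|x0]; first by rewrite mul0r sin0.
by rewrite mulrCA divff ?mulr1.
Qed.

Lemma sincN x : sinc (- x) = sinc x.
Proof. by rewrite /sinc oppr_eq0 sinN invrN mulrNN. Qed.

Lemma sinc_norm x : sinc `|x| = sinc x.
Proof. by have [x0|x0] := ger0P x; rewrite ?sincN. Qed.

Lemma sin_MVT x : 0 < x -> exists2 c, 0 < c < x & sin x = cos c * x.
Proof.
move=> x0; have [|c] := @MVT R sin cos 0 x x0 (fun t _ => is_derive_sin t).
  by apply: continuous_subspaceT => t; exact: continuous_sin.
by rewrite in_itv/= sin0 !subr0 => cx ->; exists c.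
Qed.

(** The mean value theorem gives sin z / z = cos c with 0 < c < z, and cos c = 1 - 2 sin(c/2)^2 >= 1
    - c^2 / 2. *)
Lemma sinc_ge x : 1 - x ^+ 2 / 2 <= sinc x.
Proof.
have le_sin y : 0 <= y -> sin y ^+ 2 <= y ^+ 2.
  rewrite le_eqVlt => /predU1P[<-|y0]; first by rewrite sin0.
  have [c _ ->] := sin_MVT y0.
  by rewrite exprMn ler_piMl ?sqr_ge0// -[leLHS]ger0_norm ?sqr_ge0// normrX expr_le1// cos_max.
rewrite -sinc_norm -(real_normK (num_real x)) /sinc.
case: eqVneq => [->|]; first by rewrite expr0n mul0r subr0.
rewrite -normr_gt0 normr_id; set z := `|x| => z0.
have [c /andP[c0 cz] ->] := sin_MVT z0; rewrite mulfK ?gt_eqF//.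
have -> : cos c = 1 - 2 * sin (c / 2) ^+ 2.
  rewrite -[in LHS](divfK (_ : 2 != 0 :> R) c) ?pnatr_eq0// mulr_natr cos_mulr2n.
  rewrite cos2sin2; ring.
have := le_sin (c / 2) (divr_ge0 (ltW c0) (ler0n _ 2)).
have : c ^+ 2 <= z ^+ 2 by rewrite ler_pXn2r// ?nnegrE ltW.
by rewrite exprMn; nra.
Qed.

Lemma sinc_max x : `|sinc x| <= 1.
Proof.
rewrite -sinc_norm /sinc.
case: eqVneq => [_|]; first by rewrite normr1.
rewrite -normr_gt0 normr_id => z0.
by have [c _ ->] := sin_MVT z0; rewrite mulfK ?gt_eqF// cos_max.
Qed.

Lemma sinc2_le1 x : sinc x ^+ 2 <= 1.
Proof. by rewrite -[leLHS]ger0_norm ?sqr_ge0// normrX expr_le1// sinc_max. Qed.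

Lemma sinc2_ge x : 1 - x ^+ 2 <= sinc x ^+ 2.
Proof.
have := sinc_ge x; have := sqr_ge0 (sinc x); have := sqr_ge0 x.
set s := sinc x; set u := x ^+ 2.
have [u1|u1] := leP u 1; by nra.
Qed.

(** Iterated duplication formula sin(2y) = 2 sin y cos y. In the limit it presents sinc as a product
    of cosines, through which its measurability and its effect on the band are obtained. *)
Lemma viete x n :
  (\prod_(j < n) cos (x / 2 ^+ j.+1)) * sinc (x / 2 ^+ n) = sinc x.
Proof.
elim: n => [|n IHn]; first by rewrite big_ord0 mul1r expr0 divr1.
rewrite big_ord_recr/= -mulrA -[RHS]IHn; congr (_ * _).
set y := x / 2 ^+ n.+1; have -> : x / 2 ^+ n = y *+ 2.
  by rewrite /y exprS -mulr_natr; field; rewrite expf_neq0 ?pnatr_eq0.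
have [->|y0] := eqVneq y 0; first by rewrite mul0rn cos0 mul1r.
rewrite /sinc mulrn_eq0/= (negbTE y0) sin_mulr2n.
by rewrite -[(cos y * sin y) *+ 2]mulr_natr -[y *+ 2 in RHS]mulr_natr; field.
Qed.

Lemma cvg_viete x : \prod_(j < n) cos (x / 2 ^+ j.+1) @[n --> \oo] --> sinc x.
Proof.
apply/cvgrPdist_le => e e0.
have : (x ^+ 2 / 2) * (1 / 2 ^+ n) @[n --> \oo] --> (x ^+ 2 / 2) * 0.
  apply: cvgMr; rewrite (_ : (fun n => _) = geometric 1 (1 / 2)); last first.
    by apply/funext => n; rewrite /geometric/= expr_div_n expr1n !mul1r.
  by apply: cvg_geometric; rewrite ger0_norm ?divr_ge0//; lra.
rewrite mulr0 => /cvgrPdist_le/(_ _ e0); apply: filterS => n.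
rewrite sub0r normrN mul1r => h; apply: le_trans h.
rewrite -(viete x n) -[X in _ - X]mulr1 -mulrBr normrM.
set y := x / 2 ^+ n.
have P1 : `|\prod_(j < n) cos (x / 2 ^+ j.+1)| <= 1.
  by rewrite normr_prod prodr_ile1// => j _; rewrite normr_ge0 cos_max.
apply: (@le_trans _ _ (`|sinc y - 1|)); first by rewrite ler_piMl.
rewrite distrC ger0_norm; last by have := sinc_max y; rewrite ler_norml; lra.
have := sinc_ge y; rewrite /y exprMn exprVn.
set p := 2 ^+ n : R; set q := x ^+ 2; have q0 : 0 <= q by exact: sqr_ge0.
have p1 : 1 <= p by rewrite exprn_ege1// ler1n.
have p0 : 0 < p by exact: lt_le_trans p1.
move=> hy; rewrite ger0_norm; last by rewrite divr_ge0 ?(ltW p0)// divr_ge0.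
have : q / p ^+ 2 / 2 <= q / 2 / p; last by move: hy; lra.
rewrite ler_pdivrMr// ler_pdivrMr ?exprn_gt0//.
have -> : q / 2 / p * 2 * p ^+ 2 = q * p by field; rewrite gt_eqF.
by rewrite ler_peMr.
Qed.

Lemma measurable_cos_affine (a b : R) : measurable_fun [set: R] (fun t : R => cos (a * t + b)).
Proof.
apply: (@measurableT_comp _ _ _ _ _ _ (@cos R)); last exact: measurable_affine.
exact: (continuous_measurable_fun (@continuous_cos R)).
Qed.

Lemma measurable_sinc (a : R) : measurable_fun [set: R] (fun t : R => sinc (a * t)).
Proof.
apply: (@measurable_fun_cvg _ _ _ _
    (fun n t => \prod_(j < n) cos (a * t / 2 ^+ j.+1))); last first.
  by move=> t _; exact: cvg_viete.
move=> n; apply: measurable_prod => j _.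
under eq_fun do rewrite mulrAC -[X in cos X]addr0.
exact: measurable_cos_affine.
Qed.

End sinc.

(** * Domination and limits of real-valued integrals *)

Section domination.
Context d (T : measurableType d) (R : realType).
Variable mu : {measure set T -> \bar R}.
Implicit Types f g : T -> R.

Lemma integrable_dominated f g : measurable_fun [set: T] f ->
  (forall t, `|f t| <= g t) -> mu.-integrable [set: T] (EFin \o g) ->
  mu.-integrable [set: T] (EFin \o f).
Proof.
move=> mf fg; apply: le_integrable => //; first exact/measurable_EFinP.
by move=> t _; rewrite /= lee_fin (le_trans (fg t))// ler_norm.
Qed.

Lemma integrableM_le1 f g : mu.-integrable [set: T] (EFin \o f) ->
  measurable_fun [set: T] g -> (forall t, `|g t| <= 1) ->
  mu.-integrable [set: T] (EFin \o (fun t => f t * g t)).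
Proof.
move=> fi mg g1; have mf := measurable_int _ fi.
apply: (@integrable_dominated _ (fun t => `|f t|)).
- by apply: measurable_funM => //; exact/measurable_EFinP.
- by move=> t; rewrite normrM ler_piMr.
- exact: integrable_norm.
Qed.

Lemma cvg_Rintegral_ae (f_ : nat -> T -> R) f g :
  (forall n, measurable_fun [set: T] (f_ n)) -> measurable_fun [set: T] f ->
  {ae mu, forall t, f_ n t @[n --> \oo] --> f t} ->
  {ae mu, forall t, forall n, `|f_ n t| <= g t} ->
  mu.-integrable [set: T] (EFin \o g) ->
  Rintegral mu [set: T] (f_ n) @[n --> \oo] --> Rintegral mu [set: T] f.
Proof.
move=> mf mf' f_f fg gi.
have [||||fi _ h] := @dominated_convergence _ T R mu setT measurableT
   (fun n => EFin \o f_ n) (EFin \o f) (EFin \o g) _ _ _ gi.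
- by move=> n; exact/measurable_EFinP.
- exact/measurable_EFinP.
- apply: filterS f_f => t ft _; apply: cvg_EFin => //; exact: nearW.
- by apply: filterS fg => t + n _; rewrite /= lee_fin; exact.
apply: fine_cvg; rewrite fineK; first exact: h.
exact: integrable_fin_num.
Qed.

Lemma cvg_Rintegral (f_ : nat -> T -> R) f g :
  (forall n, measurable_fun [set: T] (f_ n)) ->
  (forall t, f_ n t @[n --> \oo] --> f t) ->
  (forall n t, `|f_ n t| <= g t) -> mu.-integrable [set: T] (EFin \o g) ->
  Rintegral mu [set: T] (f_ n) @[n --> \oo] --> Rintegral mu [set: T] f.
Proof.
move=> mf f_f fg gi; apply: cvg_Rintegral_ae gi => //.
- by apply: (@measurable_fun_cvg _ _ _ _ f_) => // t _; exact: f_f.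
- exact: aeW.
- exact: aeW.
Qed.

End domination.

Section bandlimited.
Context {R : realType}.
Local Notation mu := (@lebesgue_measure R).
Implicit Types (r a b c : R) (F G : R -> R).

(** The Fourier transform vanishes outside ]-r, r[. The free phase [c] covers real and imaginary
    parts together, makes the class easy to multiply by cosines, and later absorbs the contribution
    of the other coordinates. *)
Definition bandlimited r F := mu.-integrable [set: R] (EFin \o F) /\
  forall k c, r <= `|k| -> Rintegral mu setT (fun t => F t * cos (k * t + c)) = 0.

Lemma bandlimited_measurable r F : bandlimited r F -> measurable_fun [set: R] F.
Proof. by move=> [/measurable_int/measurable_EFinP]. Qed.

Lemma bandlimited_widen r r' F : r <= r' -> bandlimited r F -> bandlimited r' F.
Proof. by move=> rr' [Fi F0]; split => // k c rk; apply: F0; exact: le_trans rk. Qed.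

Lemma bandlimitedZ r a F : bandlimited r F -> bandlimited r (fun t => a * F t).
Proof.
move=> bF; have mF := bandlimited_measurable bF; case: bF => Fi F0.
split; first exact: (integrableZl measurableT a Fi).
move=> k c rk; under eq_Rintegral do rewrite -mulrA.
rewrite RintegralZl ?F0 ?mulr0//.
apply: integrableM_le1 => // [|t]; [exact: measurable_cos_affine|exact: cos_max].
Qed.

(** Product-to-sum: multiplication by a cosine moves the frequency k to k + a and k - a, both still
    of modulus at least r. *)
Lemma bandlimitedM_cos r a b F :
  bandlimited r F -> bandlimited (r + `|a|) (fun t => F t * cos (a * t + b)).
Proof.
move=> bF; have mF := bandlimited_measurable bF; case: bF => Fi F0.
have ic k c : mu.-integrable setT (EFin \o (fun t => F t * cos (k * t + c))).
  apply: integrableM_le1 => // [|t]; [exact: measurable_cos_affine|exact: cos_max].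
split=> // k c rk.
transitivity (Rintegral mu setT (fun t => 2^-1 * (F t * cos ((k + a) * t + (c + b))) +
   2^-1 * (F t * cos ((k - a) * t + (c - b))))).
  apply: eq_Rintegral => t _.
  have -> : (k + a) * t + (c + b) = (k * t + c) + (a * t + b) by ring.
  have -> : (k - a) * t + (c - b) = (k * t + c) - (a * t + b) by ring.
  by move: (k * t + c) (a * t + b) => u v; rewrite cosD cosB; field.
rewrite RintegralD//; [|exact: (integrableZl _ _ (ic _ _))..].
rewrite !RintegralZl//; [|exact: ic..].
rewrite !F0 ?mulr0 ?addr0//.
- by have := ler_normD (k - a) a; rewrite subrK; lra.
- by have := ler_normB (k + a) a; rewrite addrK; lra.
Qed.

Lemma bandlimitedM_sin r a F :
  bandlimited r F -> bandlimited (r + `|a|) (fun t => F t * sin (a * t)).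
Proof.
move=> /(bandlimitedM_cos a (- (pi / 2))); congr bandlimited.
by apply/funext => t; rewrite cosBpihalf.
Qed.

Lemma bandlimited_cvg r (F_ : nat -> R -> R) F G :
  (\forall n \near \oo, bandlimited r (F_ n)) ->
  (forall t, F_ n t @[n --> \oo] --> F t) ->
  (\forall n \near \oo, forall t, `|F_ n t| <= G t) ->
  mu.-integrable [set: R] (EFin \o G) -> bandlimited r F.
Proof.
move=> [N1 _ bF] F_F [N2 _ FG] Gi; pose N := maxn N1 N2.
have {}bF n : bandlimited r (F_ (n + N)%N).
  by apply: bF => /=; rewrite (leq_trans _ (leq_addl _ _))// leq_maxl.
have {}FG n t : `|F_ (n + N)%N t| <= G t.
  by apply: FG => /=; rewrite (leq_trans _ (leq_addl _ _))// leq_maxr.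
have {}F_F t : F_ (n + N)%N t @[n --> \oo] --> F t.
  by have := F_F t; rewrite -(cvg_shiftn N).
have mF n := bandlimited_measurable (bF n).
have mF' : measurable_fun [set: R] F.
  by apply: (@measurable_fun_cvg _ _ _ _ (fun n => F_ (n + N)%N)) => // t _; exact: F_F.
split.
  apply: integrable_dominated Gi => // t.
  have h : `|F_ (n + N)%N t| @[n --> \oo] --> `|F t| by apply: cvg_norm; exact: F_F.
  rewrite -(cvg_lim _ h)//.
  apply: limr_le; first by apply/cvg_ex; eexists; exact: h.
  exact: nearW.
move=> k c rk.
have mc := measurable_cos_affine k c.
have h : Rintegral mu setT (fun t => F_ (n + N)%N t * cos (k * t + c)) @[n --> \oo]
    --> Rintegral mu setT (fun t => F t * cos (k * t + c)).
  apply: cvg_Rintegral Gi => // [n|t|n t].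
  - exact: (measurable_funM (mF n) mc).
  - exact: cvgMl.
  - rewrite normrM; apply: le_trans (FG n t); rewrite ler_piMr//; exact: cos_max.
rewrite -(cvg_lim _ h)//; under eq_fun do rewrite (bF _).2//.
exact: lim_cst.
Qed.

(** The first n cosine factors of the product for sinc widen the band by |a| (1 - 2^-n) < |a| or,
    when a = 0, not at all; the bound |a| therefore survives the limit. *)
Lemma bandlimitedM_sinc r a F :
  bandlimited r F -> bandlimited (r + `|a|) (fun t => F t * sinc (a * t)).
Proof.
move=> bF; pose F_ n t := F t * \prod_(j < n) cos (a * t / 2 ^+ j.+1).
have half n : 1 / 2 ^+ n.+1 + 1 / 2 ^+ n.+1 = 1 / 2 ^+ n :> R.
  by rewrite exprS; field; rewrite expf_neq0.
have bF_ n : bandlimited (r + (1 - 1 / 2 ^+ n) * `|a|) (F_ n).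
  elim: n => [|n IHn].
    rewrite /F_ expr0 divr1 subrr mul0r addr0.
    by under eq_fun do rewrite big_ord0 mulr1.
  have := bandlimitedM_cos (a / 2 ^+ n.+1) 0 IHn; rewrite -addrA.
  rewrite normrM [ `|(_ ^+ _)^-1| ]ger0_norm ?invr_ge0 ?exprn_ge0//.
  rewrite (_ : (1 - 1 / 2 ^+ n) * `|a| + `|a| / 2 ^+ n.+1 = (1 - 1 / 2 ^+ n.+1) * `|a|).
    congr bandlimited; apply/funext => t.
    by rewrite /F_ big_ord_recr/= mulrA addr0 [_ / _ * t]mulrAC.
  by rewrite -(half n); ring.
apply: (@bandlimited_cvg _ F_ _ (fun t => `|F t|)).
- apply: nearW => n; apply: bandlimited_widen (bF_ n).
  by rewrite lerD2l ler_piMl// gerBl divr_ge0.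
- by move=> t; apply: cvgMr; exact: cvg_viete.
- apply: nearW => n t; rewrite /F_ normrM ler_piMr//.
  by rewrite normr_prod prodr_ile1// => j _; rewrite normr_ge0 cos_max.
- by apply: integrable_norm; exact: bF.1.
Qed.

Lemma integrable_sinc2 a : 0 < a ->
  mu.-integrable [set: R] (EFin \o (fun t => sinc (a * t) ^+ 2)).
Proof.
move=> a0; have msq : measurable_fun [set: R] (fun t => sinc (a * t) ^+ 2).
  by apply: measurable_funX; exact: measurable_sinc.
(* The constant adds the bounds sinc^2 <= 1 and t^2 sinc(a t)^2 = sin(a t)^2 / a^2 <= a^-2. *)
have io := integrableZl measurableT (1 + a ^- 2) (@integrable_oneDsqrV R).
apply: (@integrable_dominated _ (measurableTypeR R) R mu _ (fun t : R => (1 + a ^- 2) * (1 + t ^+ 2)^-1)) => // t.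
 rewrite ger0_norm ?sqr_ge0//= ler_pdivlMr; last by rewrite ltr_pwDl ?sqr_ge0.
have h1 := sinc2_le1 (a * t).
have : (a * t * sinc (a * t)) ^+ 2 <= 1.
  by rewrite mul_sinc -[leLHS]ger0_norm ?sqr_ge0// normrX expr_le1// sin_max.
rewrite !exprMn => h2.
have a2 : 0 < a ^+ 2 by rewrite exprn_gt0.
have h3 : t ^+ 2 * sinc (a * t) ^+ 2 <= a ^- 2.
  by rewrite -[leRHS]mulr1 ler_pdivlMl// mulrA.
lra.
Qed.

(** Its value is never computed: it comes out as a common factor of terms that cancel. *)
Let bumpI := Rintegral mu setT (fun t => sinc (t / 2) ^+ 2).

Let scaled_sinc2 (u : R) : 
  Rintegral mu setT (fun t => u ^+ 2 * sinc (u * t / 2) ^+ 2) = `|u| * bumpI.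
Proof.
have [->|u0] := eqVneq u 0.
  rewrite normr0 mul0r; under eq_Rintegral do rewrite expr0n mul0r.
  by rewrite Rintegral_cst// mul0r.
have ms : measurable_fun [set: R] (fun t => (sinc (t / 2) ^+ 2)%:E).
  apply/measurable_EFinP; apply: measurable_funX.
  by under eq_fun do rewrite mulrC; exact: measurable_sinc.
have h := @ge0_integral_affine R u 0 (fun t => (sinc (t / 2) ^+ 2)%:E) u0 ms.
rewrite /bumpI /Rintegral -h; last by move=> t; rewrite lee_fin sqr_ge0.
have -> : (\int[mu]_x (u ^+ 2 * sinc (u * x / 2) ^+ 2)%:E =
    (u ^+ 2)%:E * \int[mu]_x (sinc ((u * x + 0) / 2) ^+ 2)%:E)%E.
  under [in RHS]eq_integral do rewrite addr0.
  rewrite -ge0_integralZl//.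
  - apply/measurable_EFinP; apply: measurable_funX.
    by under eq_fun do rewrite mulrAC; exact: measurable_sinc.
  - by move=> t _; rewrite lee_fin sqr_ge0.
  - by rewrite lee_fin sqr_ge0.
have fi : (\int[mu]_x (sinc ((u * x + 0) / 2) ^+ 2)%:E \is a fin_num)%E.
  have := integrable_sinc2 (a := `|u| / 2); rewrite divr_gt0 ?normr_gt0// => /(_ isT).
  move/(integrable_fin_num measurableT); congr (_ \is a _); apply: eq_integral => t _.
  rewrite /= addr0 mulrAC; have [u1|u1] := ger0P u => //.
  by rewrite mulNr mulNr sincN.
by rewrite !fineM//= -real_normK ?num_real// expr2 -mulrA.
Qed.

(** The transform of sinc^2 is a triangle. Here it appears as a multiple of the second difference |k
    + 2a| + |k - 2a| - 2|k|, which vanishes once |k| >= 2a. *)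
Lemma bandlimited_sinc2 a : 0 < a -> bandlimited (2 * a) (fun t => sinc (a * t) ^+ 2).
Proof.
move=> a0; have si := integrable_sinc2 a0; split=> // k c ak.
have ic (u : R) : mu.-integrable setT (EFin \o (fun t => u ^+ 2 * sinc (u * t / 2) ^+ 2)).
  have [->|u0] := eqVneq u 0.
    by under [EFin \o _]eq_fun do rewrite expr0n mul0r; exact: integrable0.
  have := integrable_sinc2 (a := `|u| / 2); rewrite divr_gt0 ?normr_gt0// => /(_ isT).
  move/(integrableZl measurableT (u ^+ 2)); congr (_.-integrable _ _).
  apply/funext => t; rewrite /= -EFinM; congr (_ * _)%:E; congr (_ ^+ _).
  rewrite mulrAC; have [u1|u1] := ger0P u => //.
  by rewrite mulNr mulNr sincN.
have mc b : measurable_fun [set: R] (fun t => cos (k * t + b)).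
  exact: measurable_cos_affine.
have Ik b : mu.-integrable setT (EFin \o (fun t => sinc (a * t) ^+ 2 * cos (k * t + b))).
  apply: integrableM_le1 => // [|t]; [exact: mc|exact: cos_max].
have Icos : Rintegral mu setT (fun t => sinc (a * t) ^+ 2 * cos (k * t + 0)) = 0.
  (* As u^2 t^2 sinc(u t / 2)^2 = 2 (1 - cos(u t)), the combination in brackets, multiplied by t^2,
     equals 8 cos(k t) sin(a t)^2. *)
  transitivity (Rintegral mu setT (fun t => (8 * a ^+ 2)^-1 * 
     ((k + 2 * a) ^+ 2 * sinc ((k + 2 * a) * t / 2) ^+ 2 +
      (k - 2 * a) ^+ 2 * sinc ((k - 2 * a) * t / 2) ^+ 2 -
      2 * (k ^+ 2 * sinc (k * t / 2) ^+ 2)))).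
    apply: eq_Rintegral => t _; rewrite addr0.
    have [->|t0] := eqVneq t 0.
      rewrite !mulr0 !mul0r cos0 /sinc eqxx; field; exact: lt0r_neq0.
    have dbl u : t ^+ 2 * (u ^+ 2 * sinc (u * t / 2) ^+ 2) = 2 * (1 - cos (u * t)).
      have -> : cos (u * t) = 1 - 2 * sin (u * t / 2) ^+ 2.
        rewrite -[in LHS](divfK (_ : 2 != 0 :> R) (u * t)) ?pnatr_eq0// mulr_natr cos_mulr2n.
        by rewrite cos2sin2; ring.
      by rewrite -mul_sinc; field.
    apply: (mulfI (expf_neq0 2 t0)).
    have E (x y z w : R) : t ^+ 2 * (x * (y + z - 2 * w)) =
        x * (t ^+ 2 * y + t ^+ 2 * z - 2 * (t ^+ 2 * w)) by ring.
    rewrite E !dbl.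
    have -> : t ^+ 2 * (sinc (a * t) ^+ 2 * cos (k * t)) = sin (a * t) ^+ 2 * cos (k * t) / a ^+ 2.
      by rewrite -mul_sinc; field; exact: lt0r_neq0.
    have -> : (k + 2 * a) * t = k * t + (a * t) *+ 2 by rewrite -mulr_natr; ring.
    have -> : (k - 2 * a) * t = k * t - (a * t) *+ 2 by rewrite -mulr_natr; ring.
    rewrite cosD cosB cos_mulr2n cos2sin2.
    by field; exact: lt0r_neq0.
  rewrite RintegralZl//; last first.
    apply: (integrableB _ (integrableD _ (ic _) (ic _)) (integrableZl _ _ (ic _))) => //.
  rewrite RintegralB//; last 2 first.
  - exact: (integrableD _ (ic _) (ic _)).
  - exact: (integrableZl _ _ (ic _)).
  rewrite RintegralD// (RintegralZl 2 measurableT (ic k))// !scaled_sinc2.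
  rewrite (_ : _ + _ - _ = (`|k + 2 * a| + `|k - 2 * a| - 2 * `|k|) * bumpI); last by ring.
  suff -> : `|k + 2 * a| + `|k - 2 * a| - 2 * `|k| = 0 by rewrite mul0r mulr0.
  have [k0|k0] := ger0P k; move: ak; rewrite ?(ger0_norm k0) ?(ltr0_norm k0) => ak.
  + by rewrite !ger0_norm; lra.
  + by rewrite !ler0_norm; lra.
have Isin : Rintegral mu setT (fun t => sinc (a * t) ^+ 2 * cos (k * t - pi / 2)) = 0.
  apply: Rintegral_odd.
    by apply: measurable_funM => //; apply: measurable_funX; exact: measurable_sinc.
  by move=> t; rewrite !mulrN sincN !cosBpihalf sinN mulrN.
transitivity (Rintegral mu setT (fun t => cos c * (sinc (a * t) ^+ 2 * cos (k * t + 0)) -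
    sin c * (sinc (a * t) ^+ 2 * cos (k * t - pi / 2)))).
  by apply: eq_Rintegral => t _; rewrite cosBpihalf addr0 cosD; ring.
rewrite RintegralB//; [|exact: (integrableZl _ _ (Ik _))..].
by rewrite !RintegralZl//; [rewrite Icos Isin !mulr0 subr0|exact: Ik..].
Qed.

End bandlimited.

(** * A rapidly decreasing band-limited window on the line *)

Section window.
Context {R : realType}.
Local Notation mu := (@lebesgue_measure R).
Variable delta : R.
Hypothesis delta_gt0 : 0 < delta.
Implicit Types t : R.

(* The frequencies [2 a_j] sum to [delta], so the product of the [sinc (a_j t)^2] stays in
   the band. *)
Let a j : R := delta / 2 ^+ j.+2.

Let a_gt0 j : 0 < a j.
Proof. by rewrite divr_gt0// exprn_gt0. Qed.

Let sum_a N : \sum_(j < N) (2 * a j) = delta * (1 - 1 / 2 ^+ N).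
Proof.
elim: N => [|N IHN]; first by rewrite big_ord0 expr0 divr1 subrr mulr0.
by rewrite big_ord_recr/= IHN /a !exprS; field; rewrite expf_neq0.
Qed.

Let hN N t := \prod_(j < N) sinc (a j * t) ^+ 2.

Let hN_ge0 N t : 0 <= hN N t.
Proof. by apply: prodr_ge0 => j _; rewrite sqr_ge0. Qed.

Let hNS N t : hN N.+1 t = hN N t * sinc (a N * t) ^+ 2.
Proof. by rewrite /hN big_ord_recr. Qed.

Let hN_mono t : nonincreasing_seq (hN ^~ t).
Proof.
apply/nonincreasing_seqP => N; rewrite hNS.
by rewrite ler_piMr ?sinc2_le1//; exact: hN_ge0.
Qed.

Let window t := limn (hN ^~ t).

Let cvg_window t : hN ^~ t @ \oo --> window t.
Proof.
apply: nonincreasing_is_cvgn; first exact: hN_mono.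
by exists 0 => _ [N _ <-]; exact: hN_ge0.
Qed.

Let window_ge0 t : 0 <= window t.
Proof.
apply: limr_ge; first by apply/cvg_ex; eexists; exact: cvg_window.
by apply: nearW => N; exact: hN_ge0.
Qed.

Let window_le N t : window t <= hN N t.
Proof.
apply: limr_le; first by apply/cvg_ex; eexists; exact: cvg_window.
by near=> M; apply: hN_mono; near: M; exists N.
Unshelve. all: by end_near. Qed.

Let windowN t : window (- t) = window t.
Proof.
by congr (limn _); apply/funext => N; apply: eq_bigr => j _; rewrite mulrN sincN.
Qed.

Let bandlimitedM_sinc2 r j F : bandlimited r F ->
  bandlimited (r + 2 * a j) (fun t => F t * sinc (a j * t) ^+ 2).
Proof.
move=> /(bandlimitedM_sinc (a j))/(bandlimitedM_sinc (a j)).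
rewrite gtr0_norm// -addrA -mulr2n mulr_natl; congr bandlimited.
by apply/funext => t; rewrite -mulrA.
Qed.

(* Each power of t is absorbed by one factor: t sinc(a t)^2 = sin(a t) sinc(a t) / a. *)
Let bandlimitedM_Xsinc2 r j F : bandlimited r F ->
  bandlimited (r + 2 * a j) (fun t => F t * (t * sinc (a j * t) ^+ 2)).
Proof.
move=> /(bandlimitedM_sin (a j))/(bandlimitedM_sinc (a j))/(bandlimitedZ (a j)^-1).
rewrite gtr0_norm// -addrA -mulr2n mulr_natl; congr bandlimited.
apply/funext => t; rewrite -mul_sinc; field; exact: lt0r_neq0.
Qed.

(** One factor provides integrability, [m] more absorb the powers of t, and the last [n] only widen
    the band. All widenings together stay below [delta]. *)
Let bandlimited_XhN m n : bandlimited delta (fun t => t ^+ m * hN (m + n).+1 t).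
Proof.
have base : bandlimited (\sum_(j < m.+1) (2 * a j)) (fun t => t ^+ m * hN m.+1 t).
  elim: m => [|m IHm].
    rewrite big_ord_recl big_ord0 addr0.
    have := bandlimited_sinc2 (a_gt0 0); congr bandlimited; apply/funext => t.
    by rewrite expr0 mul1r /hN big_ord_recl big_ord0 mulr1.
  rewrite big_ord_recr/=.
  have := bandlimitedM_Xsinc2 m.+1 IHm; congr bandlimited; apply/funext => t.
  by rewrite [in RHS]hNS [t ^+ m.+1]exprS; ring.
have : bandlimited (\sum_(j < (m + n).+1) (2 * a j)) (fun t => t ^+ m * hN (m + n).+1 t).
  elim: n => [|n IHn]; first by rewrite addn0.
  rewrite addnS big_ord_recr/=.
  have := bandlimitedM_sinc2 (m + n).+1 IHn; congr bandlimited; apply/funext => t.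
  by rewrite [in RHS]hNS mulrA.
apply: bandlimited_widen; rewrite sum_a ler_piMr// ?ltW// gerBl divr_ge0 ?exprn_ge0//.
Qed.

Let bandlimited_Xwindow m : bandlimited delta (fun t => t ^+ m * window t).
Proof.
apply: (@bandlimited_cvg _ _ (fun n t => t ^+ m * hN (n + m).+1 t) _
    (fun t => `|t ^+ m * hN m.+1 t|)).
- by apply: nearW => n; rewrite addnC; exact: bandlimited_XhN.
- move=> t; apply: cvgMr.
  rewrite (_ : (fun n => _) = (fun n => hN (n + m.+1)%N t)); last first.
    by apply/funext => n; rewrite addnS.
  by rewrite (cvg_shiftn m.+1 (hN ^~ t)); exact: cvg_window.
- apply: nearW => n t; rewrite !normrM ler_wpM2l// !ger0_norm//.
  by apply: hN_mono; rewrite ltnS leq_addl.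
- by apply: integrable_norm => //; have [] := bandlimited_XhN m 0; rewrite addn0.
Qed.

(** Each of the first [n] factors pays for one power of 1 + |t|: sinc(a t)^2 <= 1 and |t| sinc(a
    t)^2 = |sin(a t) sinc(a t)| / a <= 1 / a. *)
Let window_decay n : exists D, forall t, (1 + `|t|) ^+ n * window t <= D.
Proof.
exists (\prod_(j < n) (1 + (a j)^-1)) => t.
apply: (@le_trans _ _ ((1 + `|t|) ^+ n * hN n t)).
  by rewrite ler_wpM2l// exprn_ge0// addr_ge0.
rewrite -[X in _ ^+ X]card_ord -prodr_const /hN -big_split/=.
apply: ler_prod => j _; apply/andP; split.
  by rewrite mulr_ge0 ?addr_ge0 ?sqr_ge0.
rewrite mulrDl mul1r lerD ?sinc2_le1//.
rewrite -[leRHS]mulr1 ler_pdivlMl//.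
rewrite -[sinc _ ^+ 2]ger0_norm ?sqr_ge0// -[X in X * (_ * _)](gtr0_norm (a_gt0 j)) -!normrM.
have -> : a j * (t * sinc (a j * t) ^+ 2) = sin (a j * t) * sinc (a j * t).
  by rewrite -mul_sinc; ring.
rewrite normrM; apply: le_trans (ler_piMr _ (sinc_max _)) _ => //; exact: sin_max.
Qed.

(** An infinite product might be identically zero; this bound near 0 rules that out, so that the
    window can be normalised. *)
Let window_ge t : 1 - delta ^+ 2 * t ^+ 2 <= window t.
Proof.
apply: limr_ge; first by apply/cvg_ex; eexists; exact: cvg_window.
apply: nearW => N; rewrite /hN.
(* The Weierstrass inequality: a product of numbers in [0, 1] is at least 1 minus the sum of their
   defects. *)
have wst M : 1 - \sum_(j < M) (a j * t) ^+ 2 <= hN M t.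
  elim: M => [|M IHM]; first by rewrite /hN !big_ord0 subr0.
  rewrite hNS big_ord_recr/=.
  have := sinc2_ge (a M * t); have := sinc2_le1 (a M * t); have := hN_ge0 M t.
  have : hN M t <= 1 by have := @hN_mono t 0 M isT; rewrite /hN big_ord0.
  move: IHM; move: (hN M t) (sinc _ ^+ 2) (\sum_(i < M) _) ((a M * t) ^+ 2) => x y s z.
  move=> h1 h2 h3 h4 h5; have : (1 - x) * (1 - y) >= 0 by rewrite mulr_ge0 ?subr_ge0.
  lra.
apply: le_trans (wst N); rewrite lerD2l lerN2.
under eq_bigr do rewrite exprMn.
rewrite -mulr_suml ler_wpM2r ?sqr_ge0//.
apply: (@le_trans _ _ (\sum_(j < N) (2 * a j) * delta)).
  apply: ler_sum => j _; rewrite expr2 -mulrA [leRHS]mulrCA ler_wpM2l ?(ltW (a_gt0 j))//.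
  apply: (@le_trans _ _ delta); last by rewrite ler_peMl ?(ltW delta_gt0) ?ler1n.
  rewrite /a ler_pdivrMr ?exprn_gt0// ler_peMr ?(ltW delta_gt0)//.
  by rewrite exprn_ege1// ler1n.
rewrite -mulr_suml sum_a expr2 mulrAC.
by rewrite ler_piMr ?mulr_ge0 ?(ltW delta_gt0)// gerBl divr_ge0 ?exprn_ge0.
Qed.

Let bandlimited_window : bandlimited delta window.
Proof.
have := bandlimited_Xwindow 0; congr bandlimited; apply/funext => t.
by rewrite expr0 mul1r.
Qed.

Let Rintegral_window_gt0 : 0 < Rintegral mu setT window.
Proof.
(* On [0, u] one has (delta t)^2 <= 1/4, so the window is at least 1/2 there. *)
pose u : R := (2 * delta)^-1; have u0 : 0 < u by rewrite invr_gt0 mulr_gt0.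
have [wi _] := bandlimited_window.
have mw := bandlimited_measurable bandlimited_window.
have i1 : mu.-integrable setT (EFin \o (\1_(`[0, u]%classic) : R -> R)).
  exact: integrable_indic_itv.
have ii : mu.-integrable setT (EFin \o (fun t : R => 1 / 2 * \1_(`[0, u]%classic) t)).
  exact: (integrableZl measurableT (1 / 2) i1).
apply: (@lt_le_trans _ _ (Rintegral mu setT (fun t : R => 1 / 2 * \1_(`[0, u]%classic) t))).
  rewrite RintegralZl// mulr_gt0//.
  rewrite /Rintegral (_ : (\int[mu]_x (\1_(`[0, u]%classic) x)%:E = u%:E)%E)//.
  rewrite integral_indic// setIT; have := lebesgue_measure_itv `[0%R, u].
  by rewrite /= lte_fin u0 -EFinB subr0 => <-.
apply: le_Rintegral => // t _; rewrite indicE.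
have [|_] := boolP (t \in _); last by rewrite mulr0; exact: window_ge0.
rewrite inE/= in_itv/= => /andP[t0 tu]; rewrite mulr1; apply: le_trans (window_ge t).
have : (delta * t) ^+ 2 <= 2^-1 ^+ 2.
  rewrite ler_pXn2r ?nnegrE ?mulr_ge0 ?(ltW delta_gt0)//.
  apply: (@le_trans _ _ (delta * u)); first by rewrite ler_wpM2l// ltW.
  by rewrite /u invfM mulrCA mulfV ?mulr1// gt_eqF.
rewrite exprMn; lra.
Qed.

Lemma bandlimited_window_exists : exists h : R -> R,
  [/\ forall t, 0 <= h t, forall t, h (- t) = h t,
      Rintegral mu setT h = 1,
      forall m, bandlimited delta (fun t => t ^+ m * h t) &
      forall n, exists D, forall t, (1 + `|t|) ^+ n * h t <= D].
Proof.
have I0 := Rintegral_window_gt0; set I := Rintegral _ _ _ in I0.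
exists (fun t => I^-1 * window t); split => [t|t||m|n].
- by rewrite mulr_ge0// invr_ge0 ltW.
- by rewrite windowN.
- rewrite RintegralZl// ?mulVf ?gt_eqF//; exact: bandlimited_window.1.
- have := bandlimitedZ I^-1 (bandlimited_Xwindow m); congr bandlimited.
  by apply/funext => t; rewrite mulrCA.
- have [D hD] := window_decay n; exists (I^-1 * D) => t.
  by rewrite mulrCA ler_wpM2l// invr_ge0 ltW.
Qed.

End window.

(** * Band-limited products *)

Section fourier_product.
Context {R : realType}.
Local Notation mu := (@lebesgue_measure R).
Local Open Scope ereal_scope.

Lemma integral_lebesgue_rVS n (f : 'rV[R]_n.+1 -> \bar R) :
  (lebesgue_rV n.+1).-integrable setT f ->
  \int[lebesgue_rV n.+1]_x f x =
    \int[mu]_t \int[lebesgue_rV n]_v f (rV_cons (t, v)) /\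
  \int[lebesgue_rV n.+1]_x f x =
    \int[lebesgue_rV n]_v \int[mu]_t f (rV_cons (t, v)).
Proof.
move=> fi; have mc := @measurable_rV_cons R n; have mf := measurable_int _ fi.
have pi : (mu \x lebesgue_rV n).-integrable setT (f \o @rV_cons R n).
  apply/integrableP; split; first exact: (measurableT_comp mf mc).
  have /integrableP[_] := fi; apply: le_lt_trans.
  rewrite ge0_integral_lebesgue_rVS//; last exact: measurableT_comp.
  rewrite fubini_tonelli1//.
  by apply: measurableT_comp => //; exact: (measurableT_comp mf mc).
have E : \int[lebesgue_rV n.+1]_x f x = \int[mu \x lebesgue_rV n]_p f (rV_cons p).
  transitivity (\int[pushforward (mu \x lebesgue_rV n) (@rV_cons R n)]_x f x).
    by apply: eq_measure_integral.
  by rewrite (integral_pushforward mc mf)//.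
split; rewrite E.
- by rewrite -(integral12_prod_meas1 pi).
- by rewrite -(integral21_prod_meas1 pi).
Qed.

Lemma measurable_coord_prod n (g : 'I_n -> R -> R) :
  (forall i, measurable_fun setT (g i)) ->
  measurable_fun setT (fun x : 'rV[R]_n => (\prod_(i < n) g i (x ord0 i))%R).
Proof.
move=> mg; apply: measurable_prod => i _.
exact: (measurableT_comp (mg i) (measurable_coord i)).
Qed.

Lemma integrable_coord_prod n (g : 'I_n -> R -> R) :
  (forall i, mu.-integrable setT (EFin \o g i)) ->
  (lebesgue_rV n).-integrable setT
    (EFin \o (fun x : 'rV[R]_n => (\prod_(i < n) g i (x ord0 i))%R)).
Proof.
move=> gi; have mg i : measurable_fun setT (g i).
  by have /measurable_int/measurable_EFinP := gi i.
apply/integrableP; split; first by apply/measurable_EFinP; exact: measurable_coord_prod.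
under eq_integral do rewrite /= normr_prod.
rewrite (@ge0_integral_prod _ _ (fun i t => `|g i t|%R))//; last first.
  by move=> i; apply: measurableT_comp => //; exact: mg.
rewrite -ge0_fin_numE; last by apply: prode_ge0 => i _; apply: integral_ge0.
apply: prode_fin_num => i _.
have := integrable_abse (gi i); exact: (integrable_fin_num measurableT).
Qed.

(** One coordinate out of band is enough: for fixed values of the others, k.x + c is an affine
    function of that coordinate whose phase is arbitrary, and the inner integral vanishes. *)
Lemma integral_cos_prod0 n (g : 'I_n -> R -> R) (k : 'rV[R]_n) (i0 : 'I_n) :
  (forall i, mu.-integrable setT (EFin \o g i)) ->
  (forall c, Rintegral mu setT (fun t => g i0 t * cos (k ord0 i0 * t + c))%R = 0%R) ->
  forall c, \int[lebesgue_rV n]_x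
    (\prod_(i < n) g i (x ord0 i) * cos (dotr k x + c))%:E = 0.
Proof.
elim: n g k i0 => [|n IHn] g k i0 gi g0 c; first by case: i0 g0 => -[].
have mg i : measurable_fun setT (g i).
  by have /measurable_int/measurable_EFinP := gi i.
have mcos m (l : 'rV[R]_m) b : measurable_fun setT (fun x : 'rV[R]_m => cos (dotr l x + b)).
  apply: (@measurableT_comp _ _ _ _ _ _ (@cos R)).
    exact: (continuous_measurable_fun (@continuous_cos R)).
  by apply: measurable_funD => //; exact: measurable_dotr.
have pci m (h : 'I_m -> R -> R) l b : (forall i, mu.-integrable setT (EFin \o h i)) ->
    (lebesgue_rV m).-integrable setT
      (EFin \o (fun x : 'rV[R]_m => (\prod_(i < m) h i (x ord0 i) * cos (dotr l x + b))%R)).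
  move=> hi; apply: integrableM_le1 => // [| |x]; [exact: integrable_coord_prod|exact: mcos|exact: cos_max].
pose k' : 'rV[R]_n := (\row_j k ord0 (lift ord0 j))%R.
have dotrS t (v : 'rV[R]_n) : dotr k (rV_cons (t, v)) = (k ord0 ord0 * t + dotr k' v)%R.
  rewrite /dotr big_ord_recl rV_cons0; congr (_ + _)%R; apply: eq_bigr => j _.
  by rewrite rV_consS mxE.
have prodS t (v : 'rV[R]_n) : (\prod_(i < n.+1) g i (rV_cons (t, v) ord0 i) =
    g ord0 t * \prod_(i < n) g (lift ord0 i) (v ord0 i))%R.
  rewrite big_ord_recl rV_cons0; congr (_ * _)%R; apply: eq_bigr => j _.
  by rewrite rV_consS.
have [E1 E2] := integral_lebesgue_rVS (pci _ g k c gi).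
have [j i0E|i0E] := unliftP ord0 i0.
(* The bad coordinate is among the remaining ones: integrate these first, with the first coordinate
   moved into the phase. In the other case the order is reversed. *)
- rewrite [LHS]E1; apply: integral0_eq => t _ /=.
  under eq_integral do rewrite prodS dotrS.
  transitivity (\int[lebesgue_rV n]_v ((g ord0 t)%:E *
      (\prod_(i < n) g (lift ord0 i) (v ord0 i) *
        cos (dotr k' v + (k ord0 ord0 * t + c)))%:E)).
    apply: eq_integral => v _; rewrite -EFinM mulrA; congr (_ * cos _)%:E; ring.
  rewrite integralZl//; last first.
    by apply: (pci n (fun i => g (lift ord0 i))) => i; exact: gi.
  have gi' i : mu.-integrable setT (EFin \o g (lift ord0 i)) by exact: gi.
  have g0' b : Rintegral mu setT (fun t => g (lift ord0 j) t * cos (k' ord0 j * t + b))%R = 0%R.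
    by rewrite mxE -i0E; exact: g0.
  by rewrite (IHn _ k' j gi' g0') mule0.
- rewrite [LHS]E2; apply: integral0_eq => v _ /=.
  under eq_integral do rewrite prodS dotrS.
  transitivity (\int[mu]_t ((\prod_(i < n) g (lift ord0 i) (v ord0 i))%:E *
      (g ord0 t * cos (k ord0 ord0 * t + (dotr k' v + c)))%:E)).
    apply: eq_integral => t _; rewrite -EFinM addrA; congr EFin; ring.
  have gci : mu.-integrable setT (EFin \o (fun t => (g ord0 t * cos (k ord0 ord0 * t + (dotr k' v + c)))%R)).
    apply: integrableM_le1 => // [|t]; [exact: measurable_cos_affine|exact: cos_max].
  rewrite integralZl//; rewrite -[X in _ * X]fineK; last exact: integrable_fin_num gci.
  by rewrite -i0E; move: (g0 (dotr k' v + c)%R); rewrite /Rintegral => ->; rewrite mule0.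
Qed.

End fourier_product.

(** * Integration against a locally finite random measure *)

Section locally_finite_kernel.
Local Open Scope ereal_scope.
Context {R : realType} (n : nat).

Lemma sigma_finite_locally_finite (nu : {measure set 'rV[R]_n -> \bar R}) :
  locally_finite nu -> sigma_finite [set: 'rV[R]_n] nu.
Proof.
move=> lf; exists (fun m => eball m%:R).
  apply/seteqP; split => // x _; exists (Num.truncn (enorm x)).+1 => //.
  by rewrite /eball /= truncnS_gt.
by move=> m; split; [exact: measurable_eball|exact: lf].
Qed.

Context dX (X : measurableType dX) (k : X -> {measure set 'rV[R]_n -> \bar R}).
Hypothesis mk : forall U, measurable U -> measurable_fun [set: X] (k ^~ U).
Hypothesis lfk : forall x, locally_finite (k x).

Section truncation.
Variable m : nat.

Let ball_mass x := fine (k x (eball m%:R)).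

Let ball_massE x : (ball_mass x)%:E = k x (eball m%:R).
Proof. by rewrite fineK// ge0_fin_numE//; exact: lfk. Qed.

Let ball_mass_ge0 x : (0 <= ball_mass x)%R.
Proof. by rewrite fine_ge0. Qed.

Let weight x y : R := ((1 + ball_mass x)^-1 * \1_(eball m%:R : set 'rV[R]_n) y)%R.

Let measurable_weight x : measurable_fun [set: 'rV[R]_n] (weight x).
Proof.
by apply: measurable_funM => //; apply: measurable_indic; exact: measurable_eball.
Qed.

Let weight_ge0 x y : (0 <= weight x y)%R.
Proof. by rewrite mulr_ge0// invr_ge0 addr_ge0. Qed.

(* Dividing by the mass of the ball makes the truncated kernel uniformly finite. *)
Definition truncated_kernel x : {measure set 'rV[R]_n -> \bar R} :=
  mdensity (k x) (measurable_weight x) (weight_ge0 x).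

Let truncated_kernelE x U : measurable U ->
  truncated_kernel x U = ((1 + ball_mass x)^-1)%:E * k x (U `&` eball m%:R).
Proof.
move=> mU; rewrite /truncated_kernel /= /mdensity.
have me := @measurable_eball R n m%:R.
under eq_integral do rewrite EFinM.
rewrite ge0_integralZl//.
- by rewrite integral_indic// setIC.
- by apply/measurable_EFinP/measurable_funTS; exact: measurable_indic.
- by rewrite lee_fin invr_ge0 addr_ge0.
Qed.

Let measurable_truncated_kernel U : measurable U ->
  measurable_fun [set: X] (truncated_kernel ^~ U).
Proof.
move=> mU; have me := @measurable_eball R n m%:R.
under eq_fun do rewrite truncated_kernelE//.
apply: emeasurable_funM; last by apply: mk; exact: measurableI.
apply/measurable_EFinP.
under eq_fun do rewrite -powR_inv1 ?addr_ge0//.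
apply: (@measurableT_comp _ _ _ _ _ _ (@powR R ^~ (-1)%R)); first exact: measurable_powR.
apply: measurable_funD => //.
by apply: measurableT_comp => //; exact: mk.
Qed.

HB.instance Definition _ := isKernel.Build _ _ _ _ _ truncated_kernel
  measurable_truncated_kernel.

Let truncated_kernel_uub : measure_fam_uub truncated_kernel.
Proof.
exists 2%R => x; rewrite truncated_kernelE// setTI -ball_massE -EFinM lte_fin.
rewrite mulrC ltr_pdivrMr ?ltr_pwDl//.
by have := ball_mass_ge0 x; lra.
Qed.

HB.instance Definition _ :=
  Kernel_isFinite.Build _ _ _ _ _ truncated_kernel truncated_kernel_uub.

Let integral_ballE (f : 'rV[R]_n -> \bar R) x : measurable_fun setT f ->
  (forall y, 0 <= f y) ->
  \int[k x]_(y in eball m%:R) f y =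
    (1 + ball_mass x)%:E * \int[truncated_kernel x]_y f y.
Proof.
move=> mf f0; have me := @measurable_eball R n m%:R.
rewrite ge0_integral_mdensity// [LHS]integral_mkcond -ge0_integralZl//.
- apply: eq_integral => y _; rewrite patchE muleA -EFinM /weight indicE.
  rewrite mulrA divff ?gt_eqF ?ltr_pwDl// mul1r.
  by case: (y \in _); rewrite ?mul1e ?mul0e.
- by apply: emeasurable_funM => //; exact/measurable_EFinP.
- by move=> y _; rewrite mule_ge0// lee_fin.
- by rewrite lee_fin addr_ge0.
Qed.

Lemma measurable_integral_ball (F : X * 'rV[R]_n -> \bar R) :
  measurable_fun setT F -> (forall p, 0 <= F p) ->
  measurable_fun setT (fun x => \int[k x]_(y in eball m%:R) F (x, y)).
Proof.
move=> mF F0.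
have mFx x : measurable_fun setT (fun y => F (x, y)) by exact: measurableT_comp.
under eq_fun do rewrite integral_ballE//.
apply: emeasurable_funM.
  apply/measurable_EFinP; apply: measurable_funD => //.
  by apply: measurableT_comp => //; apply: mk; exact: measurable_eball.
exact: (@measurable_fun_integral_finite_kernel _ _ _ _ _ F truncated_kernel).
Qed.

End truncation.

(** The integrand depends on the parameter too, as in \int chi(x - y) Psi(w, dy). A monotone limit
    over balls reduces the claim to uniformly finite kernels. *)
Lemma measurable_integral_lfkernel (F : X * 'rV[R]_n -> \bar R) :
  measurable_fun setT F -> (forall p, 0 <= F p) ->
  measurable_fun setT (fun x => \int[k x]_y F (x, y)).
Proof.
move=> mF F0.
have mFx x : measurable_fun setT (fun y => F (x, y)) by exact: measurableT_comp.
apply: (emeasurable_fun_cvg (fun m x => \int[k x]_(y in eball m%:R) F (x, y))).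
  by move=> m; exact: measurable_integral_ball.
move=> x _.
have UE : \bigcup_m (eball m%:R : set 'rV[R]_n) = setT.
  apply/seteqP; split => // y _; exists (Num.truncn (enorm y)).+1 => //.
  by rewrite /eball /= truncnS_gt.
rewrite -[X in _ --> \int[k x]_(_ in X) _]UE.
apply: ge0_nondecreasing_set_cvg_integral => //.
- by apply/nondecreasing_seqP => m; apply/subsetPset => y; rewrite /eball/= => /lt_le_trans; apply; rewrite ler_nat.
- by move=> m; exact: measurable_eball.
- by move=> m; exact: measurable_funTS.
Qed.

End locally_finite_kernel.

(** * The product Cauchy weight and the unit ball *)

Section cauchy_weight.
Context {R : realType} (n : nat).
Local Open Scope ereal_scope.

(** The dominating function of the whole argument: integrable coordinate by coordinate, and
    comparable at points less than 1 apart, so that its integral against [Psi] is controlled by the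
    masses of unit balls. *)
Definition cauchy_weight (x : 'rV[R]_n) : R := \prod_(i < n) (1 + x ord0 i ^+ 2)^-1.

Lemma cauchy_weight_ge0 x : (0 <= cauchy_weight x)%R.
Proof. by apply: prodr_ge0 => i _; rewrite invr_ge0 addr_ge0 ?sqr_ge0. Qed.

Lemma measurable_cauchy_weight : measurable_fun [set: 'rV[R]_n] cauchy_weight.
Proof.
apply: (measurable_coord_prod (g := fun (_ : 'I_n) (t : R) => ((1 + t ^+ 2)^-1)%R)) => _.
by have /measurable_int/measurable_EFinP := @integrable_oneDsqrV R.
Qed.

Lemma integrable_cauchy_weight :
  (lebesgue_rV n).-integrable [set: 'rV[R]_n] (EFin \o cauchy_weight).
Proof.
apply: (integrable_coord_prod (g := fun (_ : 'I_n) (t : R) => ((1 + t ^+ 2)^-1)%R)) => _.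
exact: integrable_oneDsqrV.
Qed.

Lemma cauchy_weight_near (x y : 'rV[R]_n) : (enorm (x - y) < 1)%R ->
  (cauchy_weight x <= 3 ^+ n * cauchy_weight y)%R.
Proof.
move=> xy; rewrite -[X in (3 ^+ X)%R](card_ord n) -prodr_const -big_split/=.
apply: ler_prod => i _; rewrite invr_ge0 addr_ge0 ?sqr_ge0//=.
have h : (`|x ord0 i - y ord0 i| < 1)%R.
  by apply: le_lt_trans xy; have := coord_le_enorm (x - y) i; rewrite !mxE.
have /ltr_normlP[h1 h2] := h.
rewrite ler_pdivlMr; last by rewrite ltr_pwDl ?sqr_ge0.
rewrite mulrC ler_pdivrMr; last by rewrite ltr_pwDl ?sqr_ge0.
have h3 : ((x ord0 i - y ord0 i) ^+ 2 <= 1)%R by rewrite -real_normK ?num_real// expr_le1// ltW.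
(* Writing a, b for the coordinates, (2a - b)^2 >= 0 says b^2 <= 2 a^2 + 2 (a - b)^2, hence 1 + b^2
   <= 3 (1 + a^2): the origin of the constant 3. *)
have h4 := sqr_ge0 (2 * x ord0 i - y ord0 i)%R.
by nra.
Qed.

Lemma lebesgue_rV_eball1 : exists2 c : R, (0 < c)%R &
  c%:E <= lebesgue_rV n (eball 1).
Proof.
(* The open cube of half side 1 / (n + 1) lies in the unit ball, since n r^2 = r - r^2 < 1. *)
pose r : R := (n.+1%:R^-1)%R; have r0 : (0 < r)%R by rewrite invr_gt0.
exists ((2 * r) ^+ n)%R; first by rewrite exprn_gt0// mulr_gt0.
pose A (i : 'I_n) : set (measurableTypeR R) := `](- r)%R, r[%classic.
have mA i : measurable (A i) by exact: measurable_itv.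
have muA i : lebesgue_measure (A i) = (2 * r)%:E.
  rewrite lebesgue_measure_itv/= lte_fin gtrN// -EFinB; congr EFin; ring.
have -> : ((2 * r) ^+ n)%:E = lebesgue_rV n [set x | forall i, A i (x ord0 i)].
  rewrite lebesgue_rV_box//; under eq_bigr do rewrite muA.
  by rewrite prodEFin prodr_const card_ord.
have mbox : measurable [set x : 'rV[R]_n | forall i, A i (x ord0 i)].
  have -> : [set x : 'rV[R]_n | forall i, A i (x ord0 i)] =
      \bigcap_(i in [set: 'I_n]) ((fun x : 'rV[R]_n => x ord0 i) @^-1` A i).
    by apply/seteqP; split=> [x Ax i _|x Ax i]; [exact: Ax|exact: Ax].
  apply: fin_bigcap_measurable => // i _.
  by rewrite -[X in measurable X]setTI; exact: measurable_coord.
apply: le_measure; rewrite ?inE.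
- exact: mbox.
- exact: measurable_eball.
move=> x Ax; rewrite /eball/= -(ltr_pXn2r (n := 2)) ?nnegrE ?enorm_ge0//.
rewrite sqr_sqrtr ?dotr_ge0// expr1n.
apply: (@le_lt_trans _ _ (\sum_(i < n) r ^+ 2)%R).
  apply: ler_sum => i _; have := Ax i; rewrite /A/= in_itv/= => /andP[h1 h2].
  by nra.
rewrite sumr_const card_ord -mulr_natr.
have e : (r * (n%:R + 1) = 1)%R by rewrite natr1 mulVf.
have -> : (r ^+ 2 * n%:R = r - r ^+ 2)%R.
  by rewrite -[in RHS](mulr1 r) -[in X in (X - _)%R]e; ring.
nra.
Qed.

Lemma integral_eball1_translate (y : 'rV[R]_n) :
  \int[lebesgue_rV n]_z (\1_(eball 1 : set 'rV[R]_n) (y - z)%R)%:E = lebesgue_rV n (eball 1).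
Proof.
have me := @measurable_eball R n 1.
transitivity (\int[lebesgue_rV n]_z (\1_(eball 1 : set 'rV[R]_n) (z + (- y))%R)%:E).
  apply: eq_integral => z _; congr (_%:E); rewrite !indicE; congr (nat_of_bool _)%:R%R.
  by apply/idP/idP; rewrite !inE /eball /= -enormN opprB.
rewrite (ge0_integral_translation (f := fun z => (\1_(eball 1 : set 'rV[R]_n) z)%:E)).
- by rewrite integral_indic// setIT.
- by apply/measurable_EFinP; exact: measurable_indic.
- by move=> z; rewrite lee_fin.
Qed.

End cauchy_weight.

(** * Square-integrability of the weighted total mass *)

Section stationary_second_moment.
Local Open Scope ereal_scope.
Context {dO : measure_display} {Omega : measurableType dO} {R : realType} (d : nat).
Variables (P : probability Omega R) (theta : 'rV[R]_d -> Omega -> Omega).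
Hypotheses (htheta : measurable_flow theta) (hP : measure_preserving_flow P theta).

Lemma measurable_theta z : measurable_fun [set: Omega] (theta z).
Proof.
have [_ _ m] := htheta.
exact: (measurable_fun_pair1 z m).
Qed.

Lemma ge0_integral_theta z (f : Omega -> \bar R) :
  measurable_fun [set: Omega] f -> (forall w, 0 <= f w) ->
  \int[P]_w f (theta z w) = \int[P]_w f w.
Proof.
move=> mf f0; have mt := measurable_theta z.
have := ge0_integral_pushforward mt P measurableT mf (in1W f0).
rewrite preimage_setT /comp => <-.
by apply: eq_measure_integral => A mA _; exact: hP.
Qed.

Variable Psi : R.-ker Omega ~> 'rV[R]_d.
Hypotheses (hPsi : random_measure Psi) (Psi_inv : invariant_measure theta Psi)
  (Psi_L2 : locally_square_integrable P Psi).

Lemma measurable_integral_Psi (F : (Omega * 'rV[R]_d) * 'rV[R]_d -> \bar R) :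
  measurable_fun setT F -> (forall p, 0 <= F p) ->
  measurable_fun setT (fun p : Omega * 'rV[R]_d => \int[Psi p.1]_y F (p, y)).
Proof.
move=> mF F0; apply: (measurable_integral_lfkernel (k := fun p => Psi p.1)) => // U mU.
exact: (measurableT_comp (measurable_kernel Psi U mU) measurable_fst).
Qed.

Lemma ge0_integral_Psi_theta z w (f : 'rV[R]_d -> \bar R) :
  measurable_fun setT f -> (forall x, 0 <= f x) ->
  \int[Psi (theta z w)]_y f y = \int[Psi w]_y f (y - z)%R.
Proof.
move=> mf f0; have mz := measurable_shift (- z).
have := ge0_integral_pushforward mz (Psi w) measurableT mf (in1W f0).
rewrite preimage_setT /comp => <-.
by apply: eq_measure_integral => A mA _; rewrite Psi_inv// translateE.
Qed.

Lemma tonelli_Psi w (F : 'rV[R]_d * 'rV[R]_d -> \bar R) :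
  measurable_fun setT F -> (forall p, 0 <= F p) ->
  \int[lebesgue_rV d]_x \int[Psi w]_y F (x, y) =
  \int[Psi w]_y \int[lebesgue_rV d]_x F (x, y).
Proof.
move=> mF F0.
have [nu ->] := sigma_finite_pack (sigma_finite_locally_finite (@hPsi w)).
exact: fubini_tonelli.
Qed.

Let B : set 'rV[R]_d := eball 1.
Let X w z := Psi w (translate B z).
Let g : 'rV[R]_d -> R := @cauchy_weight R d.

Let mB : measurable B. Proof. exact: measurable_eball. Qed.

Let m1B : measurable_fun setT (fun p : 'rV[R]_d * 'rV[R]_d => (\1_B (p.2 - p.1)%R)%:E : \bar R).
Proof.
apply/measurable_EFinP; apply: (@measurableT_comp _ _ _ _ _ _ (\1_B : 'rV[R]_d -> R)); first exact: measurable_indic.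
by apply: measurable_rV_sub.
Qed.

Let XE w z : X w z = \int[Psi w]_y (\1_B (y - z)%R)%:E.
Proof.
have mz := measurable_translate z mB.
transitivity (\int[Psi w]_y (\1_(translate B z) y)%:E).
  by rewrite integral_indic// setIT.
by apply: eq_integral => y _; rewrite translateE.
Qed.

Let mX : measurable_fun setT (fun p : Omega * 'rV[R]_d => X p.1 p.2).
Proof.
under eq_fun do rewrite XE.
apply: (measurable_integral_Psi (F := fun q => (\1_B (q.2 - q.1.2)%R)%:E)) => //.
apply/measurable_EFinP; apply: (@measurableT_comp _ _ _ _ _ _ (\1_B : 'rV[R]_d -> R)); first exact: measurable_indic.
apply: measurable_rV_sub => //.
exact: (measurableT_comp measurable_snd measurable_fst).
Qed.

Let mXw w : measurable_fun setT (X w).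
Proof. exact: (measurable_fun_pair2 w mX). Qed.

Let mXz z : measurable_fun setT (X ^~ z).
Proof. exact: (measurable_fun_pair1 z mX). Qed.

Let mg : measurable_fun setT (EFin \o g).
Proof. by apply/measurable_EFinP; exact: measurable_cauchy_weight. Qed.

Let g0 z : 0 <= (g z)%:E.
Proof. by rewrite lee_fin cauchy_weight_ge0. Qed.

Let J w := \int[lebesgue_rV d]_z ((g z)%:E * X w z).
Let S w := \int[lebesgue_rV d]_z ((g z)%:E * (X w z * X w z)).
Let G := \int[lebesgue_rV d]_z (g z)%:E.

Let G_fin : G \is a fin_num.
Proof. exact: (integrable_fin_num measurableT (integrable_cauchy_weight d)). Qed.

Let mgX w : measurable_fun setT (fun z => (g z)%:E * X w z).
Proof. exact: emeasurable_funM. Qed.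

Let mgXX w : measurable_fun setT (fun z => (g z)%:E * (X w z * X w z)).
Proof. by apply: emeasurable_funM => //; exact: emeasurable_funM. Qed.

Let gX0 w z : 0 <= (g z)%:E * X w z. Proof. by rewrite mule_ge0. Qed.
Let gXX0 w z : 0 <= (g z)%:E * (X w z * X w z). Proof. by rewrite !mule_ge0. Qed.
Let G_ge0 : 0 <= G. Proof. exact: integral_ge0. Qed.
Let S_ge0 w : 0 <= S w. Proof. exact: integral_ge0. Qed.
Let J_ge0 w : 0 <= J w. Proof. exact: integral_ge0. Qed.

(* A continuous version of summing over a lattice of balls. *)
Let integral_cauchy_weight_le : exists2 C : R, (0 <= C)%R &
  forall w, \int[Psi w]_y (g y)%:E <= C%:E * J w.
Proof.
have [c c0 cB] := lebesgue_rV_eball1 (R := R) d.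
exists (c^-1 * 3 ^+ d)%R; first by rewrite mulr_ge0 ?invr_ge0 ?exprn_ge0// ltW.
move=> w.
have -> : J w = \int[Psi w]_y \int[lebesgue_rV d]_z ((g z)%:E * (\1_B (y - z)%R)%:E).
  rewrite -(tonelli_Psi w (F := fun p => (g p.1)%:E * (\1_B (p.2 - p.1)%R)%:E)).
  - apply: eq_integral => z _; rewrite XE -ge0_integralZl//.
    exact: (measurable_fun_pair2 z m1B).
  - apply: emeasurable_funM => //; exact: (measurableT_comp mg measurable_fst).
  - by move=> p; rewrite mule_ge0// lee_fin.
have mI : measurable_fun setT (fun y : 'rV[R]_d => \int[lebesgue_rV d]_z ((g z)%:E * (\1_B (y - z)%R)%:E)).
  pose F (p : 'rV[R]_d * 'rV[R]_d) : \bar R := (g p.1)%:E * (\1_B (p.2 - p.1)%R)%:E.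
  have mF : measurable_fun setT F.
    by apply: emeasurable_funM => //; exact: (measurableT_comp mg measurable_fst).
  have F0 p : 0 <= F p by rewrite mule_ge0// lee_fin.
  exact: (measurable_fun_fubini_tonelli_G (m1 := lebesgue_rV d) F).
rewrite -ge0_integralZl//; last 2 first.
- by move=> y _; apply: integral_ge0 => z _; rewrite mule_ge0// lee_fin.
- by rewrite lee_fin mulr_ge0 ?invr_ge0 ?exprn_ge0// ltW.
apply: ge0_le_integral => //.
- by apply: emeasurable_funM.
move=> y _.
have m1y : measurable_fun setT (fun z : 'rV[R]_d => (\1_B (y - z)%R)%:E : \bar R).
  exact: (measurable_fun_pair1 y m1B).
(* On the ball |y - z| < 1 the weight g(z) is at least 3^-d g(y), and that ball has volume at least
   c. *)
apply: (@le_trans _ _ ((c^-1 * 3 ^+ d)%:E * \int[lebesgue_rV d]_z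
     ((3 ^- d * g y)%:E * (\1_B (y - z)%R)%:E))).
  rewrite ge0_integralZl//; last by rewrite lee_fin mulr_ge0 ?invr_ge0 ?exprn_ge0// cauchy_weight_ge0.
  rewrite integral_eball1_translate muleA -EFinM.
  rewrite (_ : (c^-1 * 3 ^+ d * (3 ^- d * g y) = g y * c^-1)%R); last first.
    by field; rewrite gt_eqF//= expf_neq0// pnatr_eq0.
  rewrite EFinM -muleA -[leLHS]mule1 lee_wpmul2l//.
  by rewrite -(lee_pmul2l _ (_ : 0 < c%:E)) ?lte_fin// mule1 muleA -EFinM divff ?gt_eqF// mul1e.
rewrite lee_wpmul2l//; first by rewrite lee_fin mulr_ge0 ?invr_ge0 ?exprn_ge0// ltW.
apply: ge0_le_integral => //.
- by move=> z _; rewrite mule_ge0// lee_fin mulr_ge0 ?invr_ge0 ?exprn_ge0// cauchy_weight_ge0.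
- by apply: emeasurable_funM.
- by apply: emeasurable_funM.
move=> z _; rewrite indicE; have [|_] := boolP (_ \in _); last by rewrite !mule0.
rewrite inE /B /eball /= => yz; rewrite !mule1 lee_fin ler_pdivrMl ?exprn_gt0//.
exact: cauchy_weight_near.
Qed.

Let mule_le_sqr (a b : \bar R) : 0 <= a -> 0 <= b -> a * b <= a * a + b * b.
Proof.
move=> a0 b0; have [ab|/ltW ba] := leP a b.
- by apply: (@le_trans _ _ (b * b)); [rewrite lee_wpmul2r|rewrite leeDr// mule_ge0].
- by apply: (@le_trans _ _ (a * a)); [rewrite lee_wpmul2l|rewrite leeDl// mule_ge0].
Qed.

(** A substitute for Cauchy-Schwarz: write J^2 as a double integral and use a b <= a^2 + b^2, which
    is valid also for infinite values. The lost factor 2 is harmless. *)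
Let J2_le w : J w * J w <= G * S w + G * S w.
Proof.
have bnd z : (g z)%:E * X w z * J w <= (g z)%:E * (X w z * X w z) * G + (g z)%:E * S w.
  rewrite -!ge0_integralZl// -ge0_integralD//; last 4 first.
  - by move=> t _; rewrite mule_ge0.
  - exact: emeasurable_funM.
  - by move=> t _; rewrite mule_ge0.
  - exact: emeasurable_funM.
  apply: ge0_le_integral => //.
  - by move=> t _; rewrite mule_ge0.
  - exact: emeasurable_funM.
  - by apply: emeasurable_funD; exact: emeasurable_funM.
  move=> t _; rewrite muleACA.
  rewrite [(g z)%:E * (X w z * X w z) * _]muleAC [(g z)%:E * ((g t)%:E * _)]muleA.
  by rewrite -ge0_muleDr ?mule_ge0// lee_wpmul2l ?mule_ge0// mule_le_sqr.
rewrite {1}/J -ge0_integralZr//.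
apply: (@le_trans _ _ (\int[lebesgue_rV d]_z
    ((g z)%:E * (X w z * X w z) * G + (g z)%:E * S w))).
  apply: ge0_le_integral => //.
  - by move=> z _; rewrite mule_ge0.
  - exact: emeasurable_funM.
  - by apply: emeasurable_funD; exact: emeasurable_funM.
rewrite ge0_integralD//; last 4 first.
- by move=> t _; rewrite mule_ge0.
- exact: emeasurable_funM.
- by move=> t _; rewrite mule_ge0.
- exact: emeasurable_funM.
by rewrite !ge0_integralZr// [_ * G]muleC.
Qed.

(** By stationarity E[X(z)^2] does not depend on z, so the expectation factors as G times the second
    moment of the mass of the unit ball. *)
Let int_S : \int[P]_w S w < +oo.
Proof.
rewrite (_ : \int[P]_w S w = \int[lebesgue_rV d]_z \int[P]_w ((g z)%:E * (X w z * X w z))); last first.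
  apply: (fubini_tonelli (m1 := P) (m2 := lebesgue_rV d) (fun p => (g p.2)%:E * (X p.1 p.2 * X p.1 p.2))).
  - apply: emeasurable_funM; last exact: emeasurable_funM.
    exact: (measurableT_comp mg measurable_snd).
  - by move=> p; exact: gXX0.
have stat z : \int[P]_w ((g z)%:E * (X w z * X w z)) =
    (g z)%:E * \int[P]_w (Psi w B * Psi w B).
  rewrite ge0_integralZl//; last 2 first.
  - exact: emeasurable_funM.
  - by move=> w _; rewrite mule_ge0.
  congr (_ * _); rewrite -(ge0_integral_theta z (f := fun w => Psi w B * Psi w B)).
  - by apply: eq_integral => w _; rewrite Psi_inv.
  - by apply: emeasurable_funM; exact: measurable_kernel.
  - by move=> w; rewrite mule_ge0.
under eq_integral do rewrite stat.
rewrite ge0_integralZr//; last by apply: integral_ge0 => w _; rewrite mule_ge0.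
rewrite -/G lte_mul_pinfty//.
Qed.

Lemma integral_cauchy_weight_L2 :
  \int[P]_w ((\int[Psi w]_y (cauchy_weight y)%:E) ^+ 2) < +oo.
Proof.
have [C C0 hC] := integral_cauchy_weight_le.
have mS : measurable_fun setT S.
  apply: (measurable_fun_fubini_tonelli_F (m2 := lebesgue_rV d) (fun p => (g p.2)%:E * (X p.1 p.2 * X p.1 p.2))).
  - apply: emeasurable_funM; last exact: emeasurable_funM.
    exact: (measurableT_comp mg measurable_snd).
  - by move=> p; exact: gXX0.
have mI : measurable_fun setT (fun w => \int[Psi w]_y (g y)%:E).
  apply: measurable_integral_kernel => //; exact: measurable_kernel.
apply: (@le_lt_trans _ _ (\int[P]_w ((C ^+ 2)%:E * (G * S w + G * S w)))).
  apply: ge0_le_integral => //.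
  - by move=> w _; rewrite expe2 mule_ge0// integral_ge0.
  - by under eq_fun do rewrite expe2; exact: emeasurable_funM.
  - by apply: emeasurable_funM => //; apply: emeasurable_funD; exact: emeasurable_funM.
  move=> w _.
  apply: (@le_trans _ _ ((C%:E * J w) * (C%:E * J w))).
    by rewrite expe2 lee_pmul// integral_ge0.
  by rewrite muleACA -EFinM -expr2 lee_wpmul2l// lee_fin sqr_ge0.
rewrite ge0_integralZl//; last 3 first.
- by apply: emeasurable_funD; exact: emeasurable_funM.
- by move=> w _; rewrite adde_ge0// mule_ge0.
- by rewrite lee_fin sqr_ge0.
rewrite ge0_integralD//; [|by move=> w _; rewrite mule_ge0|exact: emeasurable_funM|by move=> w _; rewrite mule_ge0|exact: emeasurable_funM].
rewrite ge0_integralZl//.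
by rewrite lte_mul_pinfty ?lee_fin ?sqr_ge0// lte_add_pinfty// lte_mul_pinfty.
Qed.

End stationary_second_moment.

(** * Vanishing variance in the spectral gap *)

Lemma fatou_ae d (T : measurableType d) (R : realType)
    (mu : {measure set T -> \bar R}) (f_ : nat -> T -> R) (f : T -> R)
    (b : nat -> \bar R) (c : \bar R) :
  (forall n, measurable_fun [set: T] (f_ n)) -> measurable_fun [set: T] f ->
  (forall n t, 0 <= f_ n t) -> (forall t, 0 <= f t) ->
  {ae mu, forall t, f_ n t @[n --> \oo] --> f t} ->
  (forall n, (\int[mu]_t (f_ n t)%:E <= b n)%E) -> b @ \oo --> c ->
  (\int[mu]_t (f t)%:E <= c)%E.
Proof.
move=> mf_ mf f_0 f0 f_f fb bc.
have mE n : measurable_fun setT (EFin \o f_ n) by exact/measurable_EFinP.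
rewrite (@ge0_ae_eq_integral _ _ _ mu setT _ (fun t => limn_einf (fun n => (f_ n t)%:E)))//.
- apply: (le_trans (fatou mu measurableT mE _)).
    by move=> n t _; rewrite lee_fin.
  rewrite limn_einf_lim -(cvg_lim _ bc)//; apply: lee_lim.
  + exact: is_cvg_einfs.
  + by apply/cvg_ex; exists c.
  + apply: nearW => n; apply: le_trans (fb n).
    by apply: ereal_inf_lbound; exists n => /=.
- exact/measurable_EFinP.
- rewrite /limn_einf; apply: (measurableT_comp (f := -%E)) => //.
  apply: (measurable_fun_limn_esup (f := fun n t => (- (f_ n t)%:E)%E)) => n.
  by under eq_fun do rewrite -EFinN; apply/measurable_EFinP; exact: measurable_funN.
- by move=> t _; rewrite lee_fin.
- move=> t _; rewrite limn_einf_lim; apply: lime_ge; first exact: is_cvg_einfs.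
  by apply: nearW => n; apply: le_ereal_inf_tmp => _ [m _ <-]; rewrite lee_fin.
apply: filterS f_f => t ft _.
have /cvg_limn_einf_sup[-> //] : (f_ n t)%:E @[n --> \oo] --> (f t)%:E.
by apply: cvg_EFin => //; exact: nearW.
Qed.

Lemma centered_second_moment d (T : measurableType d) (R : realType)
    (P : probability T R) (X : T -> R) (c : R) : measurable_fun setT X ->
  P.-integrable setT (EFin \o (fun t => X t ^+ 2)) ->
  [/\ P.-integrable setT (EFin \o X),
      P.-integrable setT (EFin \o (fun t => (X t - c) ^+ 2)) &
      (\int[P]_t ((X t - Rintegral P setT X) ^+ 2)%:E <= \int[P]_t (X t ^+ 2)%:E)%E].
Proof.
move=> mX X2.
have i1 : P.-integrable setT (EFin \o (fun=> 1%R : R)).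
  by apply: finite_measure_integrable_cst.
have iX : P.-integrable setT (EFin \o X).
  apply: (integrable_dominated (g := fun t => 1 + X t ^+ 2)) => //; last exact: (integrableD _ i1 X2).
  move=> t; rewrite -real_normK ?num_real//; have := sqr_ge0 (`|X t| - 1); have := normr_ge0 (X t).
  by move: (`|X t|) => x; nra.
have iXm m : P.-integrable setT (EFin \o (fun t => (X t - m) ^+ 2)).
  apply: (integrable_dominated (g := fun t => 2 * X t ^+ 2 + 2 * m ^+ 2)).
  - by apply: measurable_funX; exact: measurable_funB.
  - move=> t; rewrite ger0_norm ?sqr_ge0//; have := sqr_ge0 (X t + m).
    by nra.
  - have im : P.-integrable setT (EFin \o (fun=> 2 * m ^+ 2 : R)).
      exact: finite_measure_integrable_cst.
    exact: (integrableD _ (integrableZl measurableT 2 X2) im).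
split => //; set m := Rintegral P setT X.
rewrite -[leLHS]fineK ?(integrable_fin_num measurableT (iXm m))//.
rewrite -[leRHS]fineK ?(integrable_fin_num measurableT X2)// lee_fin.
rewrite -[leLHS]/(Rintegral P setT (fun t => (X t - m) ^+ 2)).
rewrite -[leRHS]/(Rintegral P setT (fun t => X t ^+ 2)).
have iXX := integrableZl measurableT (2 * m) iX.
have im : P.-integrable setT (EFin \o (fun=> m ^+ 2 : R)).
  exact: finite_measure_integrable_cst.
have -> : Rintegral P setT (fun t => (X t - m) ^+ 2) =
    Rintegral P setT (fun t => X t ^+ 2 - (2 * m * X t - m ^+ 2)).
  by apply: eq_Rintegral => t _; ring.
have iB : P.-integrable setT (EFin \o (fun t => 2 * m * X t - m ^+ 2)).
  exact: (integrableB _ iXX im).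
have Ec : Rintegral P setT (fun=> m ^+ 2) = m ^+ 2.
  rewrite Rintegral_cst//.
  have -> : fine (P setT) = 1 by rewrite probability_setT.
  by rewrite mulr1.
rewrite (RintegralB measurableT X2 iB) (RintegralB measurableT iXX im) Ec.
rewrite (RintegralZl _ measurableT iX) -/m.
by have := sqr_ge0 m; rewrite expr2; nra.
Qed.

Section spectral_variance.
Context {dO : measure_display} {Omega : measurableType dO} {R : realType} (d : nat).
Variables (P : probability Omega R) (theta : 'rV[R]_d -> Omega -> Omega).
Hypotheses (htheta : measurable_flow theta) (hP : measure_preserving_flow P theta).
Variable Psi : R.-ker Omega ~> 'rV[R]_d.
Hypotheses (hPsi : random_measure Psi) (Psi_inv : invariant_measure theta Psi)
  (Psi_L2 : locally_square_integrable P Psi).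

Local Notation gw := (@cauchy_weight R d).
Local Notation lam := (lebesgue_rV d).
Implicit Types v : 'rV[R]_d -> R.

Let total w := (\int[Psi w]_y (gw y)%:E)%E.
Let linear v w := Rintegral (Psi w) setT v.
(** The phases 0 and pi/2 are the real and imaginary parts of the Fourier transform of [v]. *)
Let fcos v c (k : 'rV[R]_d) := Rintegral lam setT (fun x => v x * cos (dotr k x + c)).

Let mtotal : measurable_fun setT total.
Proof.
apply: measurable_integral_kernel => [U mU|y|].
- exact: measurable_kernel.
- by rewrite lee_fin cauchy_weight_ge0.
- by apply/measurable_EFinP; exact: measurable_cauchy_weight.
Qed.

Lemma measurable_linear v : measurable_fun setT v -> measurable_fun setT (linear v).
Proof.
move=> mv; apply: (measurableT_comp (@fine_measurable R setT measurableT)).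
under eq_fun do rewrite integralE.
have mEv : measurable_fun setT (EFin \o v) by exact/measurable_EFinP.
apply: emeasurable_funB; apply: measurable_integral_kernel => //.
- by move=> U mU; exact: measurable_kernel.
- exact: measurable_funepos.
- by move=> U mU; exact: measurable_kernel.
- exact: measurable_funeneg.
Qed.

Lemma total_ae : {ae P, forall w, total w \is a fin_num}.
Proof.
have t0 w : (0 <= total w)%E by apply: integral_ge0 => y _; rewrite lee_fin cauchy_weight_ge0.
have it : P.-integrable setT (fun w => total w ^+ 2)%E.
  apply/integrableP; split; first by under eq_fun do rewrite expe2; exact: emeasurable_funM.
  under eq_integral do rewrite gee0_abs ?expe2 ?mule_ge0//.
  apply: le_lt_trans (integral_cauchy_weight_L2 htheta hP hPsi Psi_inv Psi_L2).
  by under [leRHS]eq_integral do rewrite expe2.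
apply: filterS (integrable_ae measurableT it) => w /(_ I).
by case: (total w) (t0 w) => // _; rewrite expe2 mulyy.
Qed.

Section test_functions.
Variables (v : 'rV[R]_d -> R) (D r : R).
Hypotheses (mv : measurable_fun setT v) (vD : forall x, `|v x| <= D * gw x)
  (vr : forall x, r <= enorm x -> v x = 0).

Let f x : R[i] := Complex (v x) 0.

Lemma cauchy_weight_le1 (x : 'rV[R]_d) : gw x <= 1.
Proof.
apply: prodr_ile1 => i _; rewrite invr_ge0 addr_ge0 ?sqr_ge0//=.
by rewrite invf_le1 ?ltr_pwDl ?sqr_ge0// lerDl sqr_ge0.
Qed.

Lemma test_function_real : test_function f.
Proof.
split => //=.
- by exists D => x; rewrite /= expr0n addr0 sqrtr_sqr (le_trans (vD x))//
    ler_piMr ?cauchy_weight_le1//; have := le_trans (normr_ge0 _) (vD 0);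
    rewrite pmulr_lge0//; apply: prodr_gt0 => i _; rewrite invr_gt0 ltr_pwDl ?sqr_ge0.
(* The support is enclosed in a cube, which is compact as a product of segments. *)
- pose A := [set x : 'rV[R]_d | forall i, `[(- r), r]%classic (x ord0 i)].
  have cA : compact A by apply: (@rV_compact _ d (fun=> `[(- r), r]%classic)) => i; exact: segment_compact.
  apply: (subclosed_compact (@closed_closure _ _) cA).
  have Acl : closed A by apply: compact_closed => //; exact: norm_hausdorff.
  rewrite closureEbigcap => x /(_ A); apply; split => // y /eqP fy i.
  have [ry|yr] := leP r (enorm y); first by exfalso; apply: fy; rewrite /f vr.
  rewrite /= in_itv/= -ler_norml; apply: ltW; apply: le_lt_trans yr.
  exact: coord_le_enorm.
Qed.

Lemma fourier_real k : fourier f k = Complex (fcos v 0 k) (fcos v (pi / 2) k).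
Proof.
rewrite /fourier /cintegral /fcos; congr Complex; apply: eq_Rintegral => x _ /=.
- by rewrite mulr0 subr0 addr0 cosN mulrC.
- by rewrite mulr0 add0r sinN cosDpihalf mulrC.
Qed.

Lemma cintegral_real w : cintegral (Psi w) f = Complex (linear v w) 0.
Proof.
by rewrite /cintegral; congr Complex; rewrite /= Rintegral_cst// mul0r.
Qed.

(** The real part of the spectral identity for f = g = v: the covariance becomes a variance, and the
    spectral integrand the squared modulus of the transform. *)
Lemma bartlett_real (beta : {measure set 'rV[R]_d -> \bar R}) :
  bartlett_spectral_measure P Psi beta ->
  beta.-integrable setT
    (EFin \o (fun k => fcos v 0 k ^+ 2 + fcos v (pi / 2) k ^+ 2)) /\
  Rintegral P setT (fun w => (linear v w - Rintegral P setT (linear v)) ^+ 2) =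
    (2 * pi) ^- d *
    Rintegral beta setT (fun k => fcos v 0 k ^+ 2 + fcos v (pi / 2) k ^+ 2).
Proof.
move=> [_ /(_ f f test_function_real test_function_real) [[hi _]]].
have hE k : complex.Re (fourier f k * conjc (fourier f k)) =
    fcos v 0 k ^+ 2 + fcos v (pi / 2) k ^+ 2.
  by rewrite fourier_real /= mulrN opprK -!expr2.
have XE : (fun w => cintegral (Psi w) f) = (fun w => Complex (linear v w) 0).
  by apply/funext => w; exact: cintegral_real.
have EX : cintegral P (fun w => Complex (linear v w) 0) = Complex (Rintegral P setT (linear v)) 0.
  by rewrite /cintegral; congr Complex; rewrite /= Rintegral_cst// mul0r.
rewrite /ccovariance XE EX => /(congr1 (@complex.Re R)).
have reZ (c : R) (z : R[i]) : complex.Re (real_complex R c * z) = c * complex.Re z.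
  by case: z => a b /=; rewrite mul0r subr0.
rewrite reZ => e; split.
  rewrite (_ : (fun k => _) = (fun k => complex.Re (fourier f k * conjc (fourier f k)))).
    exact: hi.
  by apply/funext => k; rewrite hE.
rewrite -[RHS]/(_ * _) (_ : Rintegral beta setT _ =
  complex.Re (cintegral beta (fun k => fourier f k * conjc (fourier f k)))).
  rewrite -[RHS]e; apply: eq_Rintegral => w _.
  by rewrite cintegral_real /= subr0 mul0r subr0 expr2.
by apply: eq_Rintegral => k _; rewrite -hE.
Qed.

Lemma norm_linear_le w : (`|linear v w|%:E <= \int[Psi w]_y `|v y|%:E)%E.
Proof.
have [->|fin] := eqVneq (\int[Psi w]_y `|v y|%:E)%E +oo%E; first exact: leey.
have vi : (Psi w).-integrable setT (EFin \o v).
  apply/integrableP; split; first exact/measurable_EFinP.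
  by rewrite ltey.
by rewrite EFin_normr_Rintegral// le_abse_integral//; exact/measurable_EFinP.
Qed.

End test_functions.

(** * Integrals of band-limited functions against [Psi] are constant *)

Section band_complement.
Variables (beta : {measure set 'rV[R]_d -> \bar R}) (eps : R).
Hypotheses (hbeta : bartlett_spectral_measure P Psi beta)
  (beta_eps : beta (eball eps) = 0%E).
Variables (u : 'rV[R]_d -> R) (D : R).
Hypotheses (mu_ : measurable_fun setT u) (uD : forall x, `|u x| <= D * gw x)
  (u_band : forall k c, eps <= enorm k -> fcos u c k = 0).

Let ball n : set 'rV[R]_d := eball n%:R.
Let un n x : R := u x * \1_(ball n) x.
Let tailw n x : R := gw x * \1_(~` ball n) x.
Let tail n w := (\int[Psi w]_y (tailw n y)%:E)%E.
Let power v k := fcos v 0 k ^+ 2 + fcos v (pi / 2) k ^+ 2.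

Let mball n : measurable (ball n). Proof. exact: measurable_eball. Qed.

Let gw_gt0 (x : 'rV[R]_d) : 0 < gw x.
Proof. by apply: prodr_gt0 => i _; rewrite invr_gt0 ltr_pwDl ?sqr_ge0. Qed.

Let D_ge0 : 0 <= D.
Proof. by have := le_trans (normr_ge0 _) (uD 0); rewrite pmulr_lge0. Qed.

Let mgw : measurable_fun setT gw. Proof. exact: measurable_cauchy_weight. Qed.

Let mtailw n : measurable_fun setT (tailw n).
Proof. by apply: measurable_funM => //; apply: measurable_indic; exact: measurableC. Qed.

Let tailw_ge0 n x : 0 <= tailw n x.
Proof. by rewrite mulr_ge0// cauchy_weight_ge0. Qed.

Let tailw_le n x : tailw n x <= gw x.
Proof. by rewrite ler_piMr ?cauchy_weight_ge0// indicE lern1 leq_b1. Qed.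

Let mun n : measurable_fun setT (un n).
Proof. by apply: measurable_funM => //; exact: measurable_indic. Qed.

Let un_le n x : `|un n x| <= D * gw x.
Proof.
apply: le_trans (uD x); rewrite normrM ler_piMr//.
by rewrite ger0_norm ?indicE// lern1 leq_b1.
Qed.

Let un_out n x : n%:R <= enorm x -> un n x = 0.
Proof.
move=> nx; rewrite /un indicE memNset ?mulr0// /ball /eball /= => xn.
by have := le_lt_trans nx xn; rewrite ltxx.
Qed.

Let mtail n : measurable_fun setT (tail n).
Proof.
apply: measurable_integral_kernel => [U mU|y|].
- exact: measurable_kernel.
- by rewrite lee_fin.
- exact/measurable_EFinP.
Qed.

Let tail_ge0 n w : (0 <= tail n w)%E.
Proof. by apply: integral_ge0 => y _; rewrite lee_fin. Qed.

Let total_ge0 w : (0 <= total w)%E.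
Proof. by apply: integral_ge0 => y _; rewrite lee_fin cauchy_weight_ge0. Qed.

Let tail_le n w : (tail n w <= total w)%E.
Proof.
apply: ge0_le_integral => //.
- by move=> y _; rewrite lee_fin.
- exact/measurable_EFinP.
- exact/measurable_EFinP.
- by move=> y _; rewrite lee_fin.
Qed.

Let near_ball x : \forall n \near \oo, ball n x.
Proof.
exists (Num.truncn (enorm x)).+1 => // n /= xn.
by rewrite /ball/eball/= (lt_le_trans (truncnS_gt _))// ler_nat.
Qed.

Let total_sq : (\int[P]_w (total w * total w) < +oo)%E.
Proof.
apply: le_lt_trans (integral_cauchy_weight_L2 htheta hP hPsi Psi_inv Psi_L2).
by under [leRHS]eq_integral do rewrite expe2.
Qed.

Let integrable_total_sq : P.-integrable setT (fun w => total w * total w)%E.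
Proof.
apply/integrableP; split; first exact: emeasurable_funM.
by under eq_integral do rewrite gee0_abs ?mule_ge0//.
Qed.

Let tail_cvg : {ae P, forall w, tail n w @[n --> \oo] --> 0%E}.
Proof.
apply: filterS total_ae => w tw.
have gi : (Psi w).-integrable setT (EFin \o gw).
  apply/integrableP; split; first exact/measurable_EFinP.
  under eq_integral do rewrite gee0_abs ?lee_fin ?cauchy_weight_ge0//.
  by rewrite ltey_eq tw.
have [||||_ _] := @dominated_convergence _ _ R (Psi w) setT measurableT
    (fun n => EFin \o tailw n) (cst 0%E) (EFin \o gw) _ _ _ gi.
- by move=> n; exact/measurable_EFinP.
- exact: measurable_cst.
- apply: aeW => x _; apply: (cvg_near_cst (U := \bar R)).
  apply: filterS (near_ball x) => n xn.
  by rewrite /= /tailw indicE memNset ?mulr0//; apply.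
- by apply: aeW => x n _; rewrite /= lee_fin ger0_norm.
by rewrite integral0.
Qed.

Let tail_sq_cvg : (\int[P]_w (tail n w * tail n w))%E @[n --> \oo] --> 0%E.
Proof.
have [||||_ _] := @dominated_convergence _ _ R P setT measurableT
    (fun n w => tail n w * tail n w)%E (cst 0%E) _ _ _ _ integrable_total_sq.
- by move=> n; exact: emeasurable_funM.
- exact: measurable_cst.
- apply: filterS tail_cvg => w tw _; rewrite -(mule0 0%E); exact: cvgeM.
- apply: aeW => w n _; rewrite gee0_abs ?mule_ge0//.
  by apply: lee_pmul.
by rewrite integral0.
Qed.

Let tail_sq_lty n : (\int[P]_w (tail n w * tail n w) < +oo)%E.
Proof.
apply: le_lt_trans total_sq; apply: ge0_le_integral => //.
- by move=> w _; rewrite mule_ge0.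
- exact: emeasurable_funM.
- exact: emeasurable_funM.
- by move=> w _; exact: lee_pmul.
Qed.

Section tail_test_function.
Variables (v : 'rV[R]_d -> R) (n : nat) (r : R).
Hypotheses (mv : measurable_fun setT v) (vD : forall x, `|v x| <= D * tailw n x)
  (vr : forall x, r <= enorm x -> v x = 0).

Let vgw x : `|v x| <= D * gw x.
Proof. by rewrite (le_trans (vD x))// ler_wpM2l. Qed.

Lemma linear_sq_le w : ((linear v w ^+ 2)%:E <= (D ^+ 2)%:E * (tail n w * tail n w))%E.
Proof.
have h : (`|linear v w|%:E <= D%:E * tail n w)%E.
  apply: le_trans (norm_linear_le mv w) _.
  have -> : (D%:E * tail n w = \int[Psi w]_y (D%:E * (tailw n y)%:E))%E.
    rewrite ge0_integralZl//; [exact/measurable_EFinP|by move=> y _; rewrite lee_fin].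
  apply: ge0_le_integral => //.
  - by apply/measurable_EFinP; exact: measurableT_comp.
  - by apply: emeasurable_funM => //; exact/measurable_EFinP.
  - by move=> y _; rewrite -EFinM lee_fin.
rewrite -real_normK ?num_real// expr2 EFinM expr2 EFinM muleACA.
by apply: lee_pmul.
Qed.

Lemma linear_variance :
  P.-integrable setT (EFin \o (fun w => (linear v w - Rintegral P setT (linear v)) ^+ 2)) /\
  (\int[P]_w ((linear v w - Rintegral P setT (linear v)) ^+ 2)%:E <=
    (D ^+ 2)%:E * \int[P]_w (tail n w * tail n w))%E.
Proof.
have D2 : (0 <= (D ^+ 2)%:E)%E by rewrite lee_fin sqr_ge0.
have ml := measurable_linear mv.
have bnd : (\int[P]_w (linear v w ^+ 2)%:E <= (D ^+ 2)%:E * \int[P]_w (tail n w * tail n w))%E.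
  rewrite -ge0_integralZl//.
  - apply: ge0_le_integral => //.
    + by move=> w _; rewrite lee_fin sqr_ge0.
    + by apply/measurable_EFinP; exact: measurable_funX.
    + by apply: emeasurable_funM => //; exact: emeasurable_funM.
    + by move=> w _; exact: linear_sq_le.
  - exact: emeasurable_funM.
  - by move=> w _; rewrite mule_ge0.
have sqi : P.-integrable setT (EFin \o (fun w => linear v w ^+ 2)).
  apply/integrableP; split; first by apply/measurable_EFinP; exact: measurable_funX.
  under eq_integral do rewrite /= ger0_norm ?sqr_ge0//.
  apply: (le_lt_trans bnd).
  exact: (lte_mul_pinfty D2 (erefl true) (tail_sq_lty n)).
have [_ ci cle] := centered_second_moment (Rintegral P setT (linear v)) ml sqi.
by split => //; exact: le_trans cle bnd.
Qed.

(** [bartlett_real] compares two [Rintegral]s, where an infinite integral would read as 0.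
    Integrability on both sides turns it into an equality of extended reals, fit for monotone
    estimates and Fatou's lemma. *)
Lemma spectral_identity : beta.-integrable setT (EFin \o power v) /\
  (\int[P]_w ((linear v w - Rintegral P setT (linear v)) ^+ 2)%:E =
    ((2 * pi) ^- d)%:E * \int[beta]_k (power v k)%:E)%E.
Proof.
have [pi_ e] := bartlett_real mv vgw vr hbeta; split => //.
have [ci _] := linear_variance.
rewrite -[LHS]fineK ?(integrable_fin_num measurableT ci)//.
rewrite -[X in (_ * X)%E]fineK ?(integrable_fin_num measurableT pi_)//.
by rewrite -EFinM; congr EFin; exact: e.
Qed.

End tail_test_function.
Let C : R := (2 * pi) ^+ d.

Let C_gt0 : 0 < C.
Proof. by rewrite exprn_gt0// mulr_gt0// pi_gt0. Qed.

Let spectral_mass_le v n r : measurable_fun setT v ->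
  (forall x, `|v x| <= D * tailw n x) -> (forall x, r <= enorm x -> v x = 0) ->
  (\int[beta]_k (power v k)%:E <=
    C%:E * ((D ^+ 2)%:E * \int[P]_w (tail n w * tail n w)))%E.
Proof.
move=> mv vD vr; have [_ e] := spectral_identity mv vD vr.
have [_ h] := linear_variance mv vD.
rewrite -[leLHS]mul1e -(divff (lt0r_neq0 C_gt0)) EFinM -muleA -e.
by rewrite lee_wpmul2l// lee_fin ltW.
Qed.

Let fcosB v1 v2 c k : measurable_fun setT v1 -> measurable_fun setT v2 ->
  (forall x, `|v1 x| <= D * gw x) -> (forall x, `|v2 x| <= D * gw x) ->
  fcos (fun x => v1 x - v2 x) c k = fcos v1 c k - fcos v2 c k.
Proof.
have ig := integrableZl measurableT D (integrable_cauchy_weight d).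
have mc : measurable_fun setT (fun x : 'rV[R]_d => cos (dotr k x + c)).
  apply: (@measurableT_comp _ _ _ _ _ _ (@cos R)).
    exact: (continuous_measurable_fun (@continuous_cos R)).
  by apply: measurable_funD => //; exact: measurable_dotr.
have iv v : measurable_fun setT v -> (forall x, `|v x| <= D * gw x) ->
    lam.-integrable setT (EFin \o (fun x => v x * cos (dotr k x + c))).
  move=> mv vD; apply: integrableM_le1 => // [|x]; last exact: cos_max.
  exact: (integrable_dominated (g := fun x => D * gw x)).
move=> m1 m2 h1 h2; rewrite /fcos -RintegralB//; [|exact: iv|exact: iv].
by apply: eq_Rintegral => x _; rewrite mulrBl.
Qed.

Let fcos_cvg c k : fcos (un n) c k @[n --> \oo] --> fcos u c k.
Proof.
have mc : measurable_fun setT (fun x : 'rV[R]_d => cos (dotr k x + c)).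
  apply: (@measurableT_comp _ _ _ _ _ _ (@cos R)).
    exact: (continuous_measurable_fun (@continuous_cos R)).
  by apply: measurable_funD => //; exact: measurable_dotr.
apply: (cvg_Rintegral (g := fun x => D * gw x)).
- by move=> n; exact: measurable_funM.
- move=> x; apply: cvg_near_cst; apply: filterS (near_ball x) => n xn.
  by rewrite /un indicE mem_set// mulr1.
- move=> n x; rewrite normrM; apply: le_trans (un_le n x).
  by rewrite ler_piMr// cos_max.
- exact: (integrableZl measurableT D (integrable_cauchy_weight d)).
Qed.

(* The spectral mass of u 1_(ball n) lives off the band, where it is the limit of the
   masses of the increments u 1_(ball m) - u 1_(ball n), which are controlled by tails. *)
Let truncated_variance n :
  (\int[P]_w ((linear (un n) w - Rintegral P setT (linear (un n))) ^+ 2)%:E <=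
    (D ^+ 2)%:E * \int[P]_w (tail n w * tail n w))%E.
Proof.
(* The ball of radius 0 is empty, so the tail of index 0 is the full weight and the general bounds
   apply to the truncation itself. *)
have un0 x : `|un n x| <= D * tailw 0 x.
  rewrite /tailw indicE mem_set ?mulr1; first exact: un_le.
  by move=> /=; rewrite /ball/eball/= => /(le_lt_trans (enorm_ge0 _)); rewrite ltxx.
have [pi_ e] := spectral_identity (mun n) un0 (@un_out n).
rewrite e.
pose v j x := un (j + n)%N x - un n x.
have mv j : measurable_fun setT (v j) by exact: measurable_funB.
have vD j x : `|v j x| <= D * tailw n x.
  rewrite /v /un /tailw -mulrBr normrM mulrA.
  have [xn|xn] := pselect (ball n x).
    have xnj : ball (j + n)%N x by rewrite /ball/eball/= (lt_le_trans xn)// ler_nat leq_addl.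
    by rewrite !indicE (mem_set xn) (mem_set xnj) subrr normr0 mulr0 (memNset (A := ~` ball n)) ?mulr0//; apply.
  rewrite !indicE (memNset xn) subr0 (mem_set (A := ~` ball n))// mulr1.
  apply: le_trans (uD x); rewrite ler_piMr// ger0_norm//.
  by rewrite lern1 leq_b1.
have vr j x : (j + n)%:R <= enorm x -> v j x = 0.
  by move=> xn; rewrite /v !un_out ?subrr// (le_trans _ xn)// ler_nat leq_addl.
have h : (\int[beta]_k (power (un n) k)%:E <=
    C%:E * ((D ^+ 2)%:E * \int[P]_w (tail n w * tail n w)))%E.
  apply: (@fatou_ae _ _ _ beta (fun j => power (v j)) (power (un n)) (fun=> C%:E *
      ((D ^+ 2)%:E * \int[P]_w (tail n w * tail n w)))%E).
  - move=> j; have [/measurable_int/measurable_EFinP ? _] := spectral_identity (mv j) (vD j) (@vr j).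
    by [].
  - by have /measurable_int/measurable_EFinP := pi_.
  - by move=> j k; rewrite addr_ge0 ?sqr_ge0.
  - by move=> k; rewrite addr_ge0 ?sqr_ge0.
  (* The exceptional set is the spectral gap, null for [beta]. Off it the transform of [u] vanishes,
     so that of [v j] tends to minus that of [un n]; the sign disappears in the square. *)
  - exists (eball eps); split => //; first exact: measurable_eball.
    move=> k /= nk; apply: contrapT => /negP; rewrite -leNgt => epsk; apply: nk.
    have vk c : fcos (v j) c k @[j --> \oo] --> - fcos (un n) c k.
      rewrite (_ : (fun j => _) = (fun j => fcos (un (j + n)%N) c k - fcos (un n) c k)); last first.
        by apply/funext => j; exact: fcosB.
      rewrite -[X in _ --> X]add0r -(u_band c epsk); apply: cvgB; last exact: cvg_cst.
      by rewrite (cvg_shiftn n (fun m => fcos (un m) c k)); exact: fcos_cvg.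
    rewrite /power -[X in _ --> X + _]sqrrN -[X in _ --> _ + X]sqrrN.
    by apply: cvgD; rewrite !expr2; under eq_fun do rewrite expr2; apply: cvgM; exact: vk.
  - by move=> j; exact: spectral_mass_le (mv j) (vD j) (@vr j).
  - exact: cvg_cst.
apply: (@le_trans _ _ ((C^-1)%:E * (C%:E * ((D ^+ 2)%:E * \int[P]_w (tail n w * tail n w))))%E).
  by rewrite lee_wpmul2l// lee_fin invr_ge0 ltW.
by rewrite muleA -EFinM mulVf ?mul1e// gt_eqF.
Qed.

(** The variances of the truncations are bounded by D^2 times the second moment of the tail, which
    tends to 0. Means converge by domination, and Fatou's lemma then gives variance 0 to the
    untruncated integral. *)
Lemma linear_deterministic : exists c : R, {ae P, forall w,
  (Psi w).-integrable setT (EFin \o u) /\ Rintegral (Psi w) setT u = c}.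
Proof.
pose A w := fine (total w).
have mA : measurable_fun setT A.
  by apply: (measurableT_comp (@fine_measurable R setT measurableT)); exact: mtotal.
have A2i : P.-integrable setT (EFin \o (fun w => A w ^+ 2)).
  apply/integrableP; split; first by apply/measurable_EFinP; exact: measurable_funX.
  apply: le_lt_trans total_sq; apply: ge0_le_integral => //.
  - by apply/measurable_EFinP; apply: measurableT_comp => //; exact: measurable_funX.
  - exact: emeasurable_funM.
  - move=> w _; rewrite /= ger0_norm ?sqr_ge0// /A expr2 EFinM.
    have [t|] := boolP (total w \is a fin_num); first by rewrite fineK.
    rewrite ge0_fin_numE// -leNgt leye_eq => /eqP ->.
    by rewrite /= mulyy leey.
have [Ai _ _] := centered_second_moment 0 mA A2i.
have mlu := measurable_linear mu_.
have ml n := measurable_linear (mun n).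
have gi w : total w \is a fin_num -> (Psi w).-integrable setT (EFin \o gw).
  move=> tw; apply/integrableP; split; first exact/measurable_EFinP.
  under eq_integral do rewrite gee0_abs ?lee_fin ?cauchy_weight_ge0//.
  by rewrite ltey_eq tw.
have gDi w : total w \is a fin_num -> (Psi w).-integrable setT (EFin \o (fun x => D * gw x)).
  by move=> /gi /(integrableZl measurableT D).
have Yle n w : total w \is a fin_num -> `|linear (un n) w| <= D * A w.
  move=> tw; rewrite -lee_fin; apply: le_trans (norm_linear_le (mun n) w) _.
  rewrite /A EFinM fineK// /total -ge0_integralZl//; last 2 first.
  - exact/measurable_EFinP.
  - by move=> y _; rewrite lee_fin cauchy_weight_ge0.
  apply: ge0_le_integral => //.
  - by apply/measurable_EFinP; exact: measurableT_comp.
  - by apply/measurable_EFinP; exact: measurable_funM.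
  - by move=> y _; rewrite -EFinM lee_fin.
have Ycvg w : total w \is a fin_num -> linear (un n) w @[n --> \oo] --> linear u w.
  move=> tw; apply: (cvg_Rintegral (g := fun x => D * gw x)) => //; last exact: gDi.
  move=> x; apply: cvg_near_cst; apply: filterS (near_ball x) => n xn.
  by rewrite /un indicE mem_set// mulr1.
have mcvg : Rintegral P setT (linear (un n)) @[n --> \oo] --> Rintegral P setT (linear u).
  apply: (cvg_Rintegral_ae (g := fun w => D * A w)) => //.
  - by apply: filterS total_ae => w; exact: Ycvg.
  - by apply: filterS total_ae => w tw n; exact: Yle.
  - exact: (integrableZl measurableT D Ai).
set c := Rintegral P setT (linear u) in mcvg.
have f_0 : (\int[P]_w ((linear u w - c) ^+ 2)%:E <= 0)%E.
  apply: (fatou_ae (f_ := fun n w => (linear (un n) w - Rintegral P setT (linear (un n))) ^+ 2)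
    _ _ _ _ _ truncated_variance).
  - by move=> n; apply: measurable_funX; exact: measurable_funB.
  - by apply: measurable_funX; exact: measurable_funB.
  - by move=> n w; rewrite sqr_ge0.
  - by move=> w; rewrite sqr_ge0.
  - apply: filterS total_ae => w tw.
    rewrite expr2; under eq_fun do rewrite expr2.
    by apply: cvgM; apply: cvgB => //; exact: Ycvg.
  - rewrite -[X in _ --> X](mule0 (D ^+ 2)%:E).
    by apply: cvgeMl => //; exact: tail_sq_cvg.
exists c.
have mf : measurable_fun setT (fun w => ((linear u w - c) ^+ 2)%:E).
  by apply/measurable_EFinP; apply: measurable_funX; exact: measurable_funB.
have /(ae_eq_integral_abs P measurableT mf) : (\int[P]_w `|((linear u w - c) ^+ 2)%:E| = 0)%E.
  apply/eqP; rewrite eq_le integral_ge0// andbT; apply: le_trans f_0.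
  by under eq_integral do rewrite gee0_abs ?lee_fin ?sqr_ge0//.
apply: filterS2 total_ae => w tw /(_ I) /= [] /eqP; rewrite sqrf_eq0 subr_eq0 => /eqP uc.
split => //; apply: integrable_dominated (gDi _ tw) => //.
Qed.

End band_complement.
End spectral_variance.

(** * The smoothing kernel *)

Section window_rV.
Context {R : realType} (d : nat).
Local Notation lam := (lebesgue_rV d).
Local Notation gw := (@cauchy_weight R d).

Lemma tensor_pow_le q (i : q.-tuple 'I_d) (x : 'rV[R]_d) :
  `|tensor_pow q x i| <= enorm x ^+ q.
Proof.
rewrite ffunE normr_prod -[X in _ ^+ X]card_ord -prodr_const.
by apply: ler_prod => j _; rewrite normr_ge0 coord_le_enorm.
Qed.

(** Collecting equal indices makes the entry a monomial, so that its product with chi is again a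
    product of functions t^m h(t) of single coordinates. *)
Lemma tensor_powE q (i : q.-tuple 'I_d) (x : 'rV[R]_d) :
  tensor_pow q x i = \prod_(a < d) x ord0 a ^+ #|[pred j | tnth i j == a]|.
Proof.
rewrite ffunE (partition_big (tnth i) predT)//=; apply: eq_bigr => a _.
by rewrite -prodr_const; apply: eq_bigr => j /eqP ->.
Qed.

Lemma measurable_tensor_pow q (i : q.-tuple 'I_d) :
  measurable_fun setT (fun x : 'rV[R]_d => tensor_pow q x i).
Proof.
under eq_fun do rewrite ffunE.
by apply: measurable_prod => j _; exact: measurable_rV_coord.
Qed.

Let sum_le_prod n (a : 'I_n -> R) : (forall i, 0 <= a i) ->
  1 + \sum_(i < n) a i <= \prod_(i < n) (1 + a i).
Proof.
elim: n a => [|n IHn] a a0; first by rewrite !big_ord0 addr0.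
rewrite !big_ord_recr/=; have := IHn (fun i => a (widen_ord (leqnSn n) i)) (fun=> a0 _).
set s := \sum_(i < n) _; set p := \prod_(i < n) _ => sp.
have s0 : 0 <= s by exact: sumr_ge0.
have := a0 ord_max; set t := a ord_max => t0.
by nra.
Qed.

Lemma enorm_le_prod (x : 'rV[R]_d) : enorm x <= \prod_(i < d) (1 + `|x ord0 i|).
Proof.
have sum_le : enorm x <= \sum_(i < d) `|x ord0 i|.
  rewrite -(ler_pXn2r (n := 2)) ?nnegrE ?enorm_ge0 ?sumr_ge0//.
  rewrite sqr_sqrtr ?dotr_ge0// expr2 mulr_suml /dotr.
  apply: ler_sum => i _; rewrite -expr2 -real_normK ?num_real// expr2 ler_wpM2l//.
  by rewrite (bigD1 i)//= lerDl sumr_ge0.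
apply: (le_trans sum_le); apply: le_trans (sum_le_prod _) => //.
by rewrite lerDr.
Qed.

Lemma window_rV_exists (eps : R) : 0 < eps ->
  exists chi : 'rV[R]_d -> R,
  [/\ measurable_fun setT chi, forall x, 0 <= chi x, forall x, chi (- x) = chi x,
      (\int[lam]_x (chi x)%:E = 1)%E &
      (forall n, exists2 D : R, 0 <= D & forall x, enorm x ^+ n * chi x <= D * gw x) /\
      (forall q (i : q.-tuple 'I_d) k c, eps <= enorm k ->
        Rintegral lam setT (fun x => tensor_pow q x i * chi x * cos (dotr k x + c)) = 0)].
Proof.
(* If every |k_i| were below delta, then |k|^2 <= d delta^2 < (d + 1)^2 delta^2 = eps^2. Hence |k|
   >= eps leaves a coordinate outside the one-dimensional band. *)
move=> eps0; pose delta := eps / d.+1%:R.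
have delta0 : 0 < delta by rewrite divr_gt0// ltr0n.
have [h [h0 hN h1 hband hdecay]] := bandlimited_window_exists delta0.
have hi : lebesgue_measure.-integrable setT (EFin \o h).
  have [+ _] := hband 0%N; congr (_.-integrable _ _); apply/funext => t /=.
  by rewrite expr0 mul1r.
have mh : measurable_fun setT h by have /measurable_int/measurable_EFinP := hi.
pose chi (x : 'rV[R]_d) := \prod_(i < d) h (x ord0 i).
have chi0 x : 0 <= chi x by exact: prodr_ge0.
exists chi; split => //.
- exact: (measurable_coord_prod (g := fun=> h)).
- by move=> x; apply: eq_bigr => i _; rewrite mxE hN.
- rewrite (ge0_integral_prod (g := fun=> h))// big1// => i _.
  rewrite -[LHS]fineK ?(integrable_fin_num measurableT hi)//.
  by congr EFin; exact: h1.
split.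
(* Per coordinate, [n] powers bound the norm through [enorm_le_prod], and two more pay for the
   Cauchy weight, as 1 + t^2 <= (1 + |t|)^2. *)
- move=> n; have [D hD] := hdecay n.+2.
  have D0 : 0 <= D by have := hD 0; apply: le_trans; rewrite mulr_ge0// exprn_ge0// addr_ge0.
  exists (D ^+ d); first exact: exprn_ge0.
  move=> x; apply: (@le_trans _ _ (\prod_(i < d) ((1 + `|x ord0 i|) ^+ n * h (x ord0 i)))).
    rewrite big_split/= prodrXl ler_wpM2r// lerXn2r ?nnegrE ?enorm_ge0//.
      by apply: prodr_ge0 => i _; rewrite addr_ge0.
    exact: enorm_le_prod.
  rewrite -[X in _ ^+ X](card_ord d) -prodr_const /cauchy_weight -big_split/=.
  apply: ler_prod => i _; rewrite mulr_ge0 ?exprn_ge0 ?addr_ge0//=.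
  rewrite ler_pdivlMr; last by rewrite ltr_pwDl ?sqr_ge0.
  apply: le_trans (hD (x ord0 i)); set t := x ord0 i.
  have -> : (1 + `|t|) ^+ n.+2 * h t = ((1 + `|t|) ^+ n * h t) * (1 + `|t|) ^+ 2.
    by rewrite -addn2 exprD mulrAC.
  apply: ler_wpM2l; first by rewrite mulr_ge0 ?exprn_ge0 ?addr_ge0.
  have t0 : 0 <= `|t| by [].
  by rewrite -(real_normK (num_real t)); nra.
move=> q i k c ek.
have [i0 ki0] : exists i0 : 'I_d, delta <= `|k ord0 i0|.
  apply: contrapT => /forallNP kN; move: ek; apply/negP; rewrite -ltNge.
  have kd (a : 'I_d) : k ord0 a ^+ 2 <= delta ^+ 2.
    rewrite -(real_normK (num_real (k ord0 a))) lerXn2r ?nnegrE ?(ltW delta0)//.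
    by rewrite leNgt; apply/negP => /ltW; exact: kN.
  rewrite -(ltr_pXn2r (n := 2)) ?nnegrE ?enorm_ge0 ?(ltW eps0)//.
  rewrite sqr_sqrtr ?dotr_ge0//.
  apply: (@le_lt_trans _ _ (\sum_(a < d) delta ^+ 2)).
    by apply: ler_sum => a _; rewrite -expr2; exact: kd.
  rewrite sumr_const card_ord -mulr_natr.
  have -> : eps = delta * (d%:R + 1) by rewrite natr1 divfK.
  have dn : 0 <= d%:R :> R by [].
  rewrite -subr_gt0 (_ : _ - _ = delta ^+ 2 * ((d%:R + 1) ^+ 2 - d%:R)); last by ring.
  by rewrite mulr_gt0 ?exprn_gt0//; nra.
have -> : (fun x => tensor_pow q x i * chi x * cos (dotr k x + c)) =
    (fun x : 'rV[R]_d => \prod_(a < d) (x ord0 a ^+ #|[pred j | tnth i j == a]| * h (x ord0 a)) * cos (dotr k x + c)).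
  by apply/funext => x; rewrite tensor_powE /chi -big_split.
rewrite /Rintegral (integral_cos_prod0 (i0 := i0)
  (g := fun a (t : R) => t ^+ #|[pred j | tnth i j == a]| * h t))//.
- by move=> a; have [] := hband #|[pred j | tnth i j == a]|.
- by move=> c'; have [_] := hband #|[pred j | tnth i j == i0]|; exact.
Qed.

End window_rV.

(** * The kernel obtained by smoothing [Psi] *)

Section window_kernel.
Local Open Scope ereal_scope.
Context {dO : measure_display} {Omega : measurableType dO} {R : realType} (d : nat).
Variables (P : probability Omega R) (theta : 'rV[R]_d -> Omega -> Omega).
Hypotheses (htheta : measurable_flow theta) (hP : measure_preserving_flow P theta).
Variables (Psi : R.-ker Omega ~> 'rV[R]_d) (gamma : R).
Hypotheses (hPsi : random_measure Psi) (Psi_inv : invariant_measure theta Psi)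
  (Psi_gamma : has_intensity P Psi gamma).

Local Notation lam := (lebesgue_rV d).

Lemma intensity_ge0 : (0 <= gamma)%R.
Proof.
have [c c0 cB] := lebesgue_rV_eball1 (R := R) d.
rewrite -lee_fin -(@pmule_lge0 _ (lebesgue_rV d (eball 1))); last first.
  by apply: lt_le_trans cB; rewrite lte_fin.
rewrite -Psi_gamma; last exact: measurable_eball.
by apply: integral_ge0.
Qed.

Lemma ge0_integral_intensity (f : 'rV[R]_d -> \bar R) : (forall x, 0 <= f x) ->
  measurable_fun setT f ->
  \int[P]_w \int[Psi w]_y f y = gamma%:E * \int[lam]_y f y.
Proof.
move=> f0 mf.
rewrite -(ge0_integral_mixture (m := P) (k := Psi)
  (nu := mscale (NngNum intensity_ge0) lam))//.
- by rewrite ge0_integral_mscale.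
- by move=> U mU; exact: measurable_kernel.
- by move=> U mU; rewrite Psi_gamma.
Qed.

Lemma ae_theta z (Q : set Omega) :
  {ae P, forall w, Q w} -> {ae P, forall w, Q (theta z w)}.
Proof.
move=> [A [mA A0 QA]]; exists (theta z @^-1` A); split.
- by rewrite -[X in measurable X]setTI; exact: (measurable_theta htheta).
- by rewrite hP.
- by move=> w; exact: QA.
Qed.

(** The null set depends on x, and there are uncountably many x. Tonelli's theorem for the indicator
    of the complement moves the quantifier inside, at the price of a null set of points. *)
Lemma ae_fubini (Q : set (Omega * 'rV[R]_d)) : measurable Q ->
  (forall x, {ae P, forall w, Q (w, x)}) ->
  {ae P, forall w, {ae lam, forall x, Q (w, x)}}.
Proof.
move=> mQ Qae; pose f p : \bar R := (\1_(~` Q) p)%:E.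
have mf : measurable_fun setT f.
  by apply/measurable_EFinP; apply: measurable_indic; exact: measurableC.
have f0 p : 0 <= f p by rewrite lee_fin.
have h : \int[P]_w \int[lam]_x f (w, x) = 0.
  rewrite (fubini_tonelli (m1 := P) (m2 := lam) f)//.
  apply: integral0_eq => x _.
  rewrite (ae_eq_integral (cst 0))//.
  - by rewrite integral0.
  - exact: (measurable_fun_pair1 x mf).
  - by apply: filterS (Qae x) => w Qw _; rewrite /f indicE memNset//=; apply.
have mF : measurable_fun setT (fun w => \int[lam]_x f (w, x)).
  exact: (measurable_fun_fubini_tonelli_F (m2 := lam) f).
have /(ae_eq_integral_abs P measurableT mF) : \int[P]_w `|\int[lam]_x f (w, x)| = 0.
  by rewrite -[RHS]h; apply: eq_integral => w _; rewrite gee0_abs// integral_ge0.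
apply: filterS => w /(_ I) fw.
have mfw : measurable_fun setT (fun x => f (w, x)) by exact: (measurable_fun_pair2 w mf).
have /(ae_eq_integral_abs lam measurableT mfw) : \int[lam]_x `|f (w, x)| = 0.
  by rewrite -[RHS]fw; apply: eq_integral => x _; rewrite gee0_abs.
apply: filterS => x /(_ I); rewrite /f indicE; case: (boolP (_ \in _)) => /=.
  by move=> _ [] /eqP; rewrite oner_eq0.
by rewrite notin_setE/= => + _ => /contrapT.
Qed.

Variable chi : 'rV[R]_d -> R.
Hypotheses (mchi : measurable_fun setT chi) (chi0 : forall x, (0 <= chi x)%R)
  (chi_even : forall x, chi (- x) = chi x) (chi1 : \int[lam]_x (chi x)%:E = 1).

Let smoothed (p : Omega * 'rV[R]_d) := \int[Psi p.1]_y (chi (p.2 - y)%R)%:E.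

Let mchiB (x : 'rV[R]_d) : measurable_fun setT (fun y : 'rV[R]_d => chi (x - y)%R).
Proof.
apply: (measurableT_comp mchi); apply: measurable_rV_sub => //; exact: measurable_cst.
Qed.

Let mchi3 : measurable_fun setT
  (fun p : (Omega * 'rV[R]_d) * 'rV[R]_d => (chi (p.1.2 - p.2)%R)).
Proof.
apply: (measurableT_comp mchi); apply: measurable_rV_sub => //.
exact: (measurableT_comp measurable_snd measurable_fst).
Qed.

Let msmoothed : measurable_fun setT smoothed.
Proof.
apply: (measurable_integral_Psi hPsi (F := fun q => (chi (q.1.2 - q.2)%R)%:E)).
- exact/measurable_EFinP.
- by move=> p; rewrite lee_fin.
Qed.

Let smoothed_theta z w x : smoothed (theta z w, x) = smoothed (w, x + z)%R.
Proof.
rewrite /smoothed/= (ge0_integral_Psi_theta Psi_inv z w (f := fun y => (chi (x - y)%R)%:E)).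
- by apply: eq_integral => y _; rewrite opprB addrA addrAC.
- exact/measurable_EFinP.
- by move=> y; rewrite lee_fin.
Qed.

Let density (x y : 'rV[R]_d) : R := (gamma^-1 * chi (x - y))%R.

Let mdensity_x x : measurable_fun setT (density x).
Proof. exact: measurable_funM. Qed.

Let density_ge0 x y : (0 <= density x y)%R.
Proof. by rewrite mulr_ge0// invr_ge0 intensity_ge0. Qed.

(* The exceptional event, on which the density does not integrate to 1, is handled by a
   Dirac mass; so is the case [gamma = 0]. *)
Let balanced (p : Omega * 'rV[R]_d) : bool :=
  (0 < gamma)%R && (smoothed p == gamma%:E).

Let measurable_balanced : measurable_fun setT balanced.
Proof.
apply: measurable_and => //.
apply: (measurable_fun_bool true).
rewrite setTI (_ : _ @^-1` _ = smoothed @^-1` [set gamma%:E]).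
  by rewrite -[X in measurable X]setTI; apply: msmoothed => //; exact: emeasurable_set1.
by apply/seteqP; split => p /eqP.
Qed.

Definition window_kernel (p : Omega * 'rV[R]_d) : {measure set 'rV[R]_d -> \bar R} :=
  if balanced p then
    (mdensity (Psi p.1) (mdensity_x p.2) (density_ge0 p.2) : {measure set _ -> \bar R})
  else (dirac p.2 : {measure set _ -> \bar R}).

Let window_kernelE p U : measurable U -> window_kernel p U =
  if balanced p then \int[Psi p.1]_y (density p.2 y * \1_U y)%:E else (\1_U p.2)%:E.
Proof.
move=> mU; rewrite /window_kernel; case: ifP => // _.
rewrite /= /mdensity integral_mkcond; apply: eq_integral => y _.
by rewrite patchE indicE; case: (y \in U); rewrite ?mulr1 ?mulr0.
Qed.

Let measurable_window_kernel U : measurable U ->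
  measurable_fun setT (window_kernel ^~ U).
Proof.
move=> mU; under eq_fun do rewrite window_kernelE//.
apply: measurable_fun_ifT => //.
- apply: (measurable_integral_Psi hPsi (F := fun q => (density q.1.2 q.2 * \1_U q.2)%:E)).
  + apply/measurable_EFinP; apply: measurable_funM; first exact: measurable_funM.
    exact: (measurableT_comp (measurable_indic mU) measurable_snd).
  + by move=> p; rewrite lee_fin mulr_ge0.
- by apply/measurable_EFinP; exact: (measurableT_comp (measurable_indic mU) measurable_snd).
Qed.

HB.instance Definition _ := isKernel.Build _ _ _ _ _ window_kernel measurable_window_kernel.

Let window_kernel_prob p : window_kernel p setT = 1.
Proof.
rewrite /window_kernel; case: ifPn => [/andP[g0 /eqP Sp]|_]; last by rewrite /= diracT.
rewrite /= /mdensity; under eq_integral do rewrite EFinM.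
rewrite ge0_integralZl//.
- by rewrite -[X in _ * X]/(smoothed p) Sp -EFinM mulVf// gt_eqF.
- exact/measurable_EFinP.
- by move=> y _; rewrite lee_fin.
- by rewrite lee_fin invr_ge0 ltW.
Qed.

HB.instance Definition _ := Kernel_isProbability.Build _ _ _ _ _ window_kernel window_kernel_prob.


(** The test [balanced] is itself carried along by the flow, so both points use the same branch and
    invariance holds for every sample point. *)
Lemma window_kernel_invariant : invariant_kernel theta window_kernel.
Proof.
move=> z w x B mB; have mzB := measurable_translate z mB.
rewrite !window_kernelE// /balanced smoothed_theta/=; case: ifP => _.
  rewrite (ge0_integral_Psi_theta Psi_inv z w (f := fun y => (density x y * \1_B y)%:E)).
  - apply: eq_integral => y _; rewrite translateE /density opprB addrA addrAC.
    by [].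
  - by apply/measurable_EFinP; apply: measurable_funM.
  - by move=> y; rewrite lee_fin mulr_ge0.
rewrite translateE; congr EFin; rewrite !indicE; congr (nat_of_bool _)%:R%R.
by apply/idP/idP; rewrite !inE /= addrK.
Qed.

Hypothesis chi_det : exists c, {ae P, forall w,
  (Psi w).-integrable setT (EFin \o chi) /\ Rintegral (Psi w) setT chi = c}.

(** The almost sure constant is identified by its expectation, which Campbell's formula and \int chi
    = 1 evaluate to gamma. *)
Let smoothed0 : {ae P, forall w, smoothed (w, 0%R) = gamma%:E}.
Proof.
have E w : smoothed (w, 0%R) = \int[Psi w]_y (chi y)%:E.
  by apply: eq_integral => y _ /=; rewrite sub0r chi_even.
have [c hc] := chi_det.
have Sc : {ae P, forall w, smoothed (w, 0%R) = c%:E}.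
  apply: filterS hc => w [ci <-]; rewrite E fineK//.
  exact: (integrable_fin_num measurableT ci).
have : \int[P]_w smoothed (w, 0%R) = gamma%:E.
  under eq_integral do rewrite E.
  rewrite ge0_integral_intensity ?chi1 ?mule1//.
  exact/measurable_EFinP.
rewrite (ae_eq_integral (cst c%:E))//.
- have -> : \int[P]_w cst c%:E w = c%:E by rewrite integral_cst//= probability_setT mule1.
  move=> -[<-].
  exact: Sc.
- exact: (measurable_fun_pair1 (0%R : 'rV[R]_d) msmoothed).
- by apply: filterS Sc => w ->.
Qed.

Let balanced_ae x : (0 < gamma)%R -> {ae P, forall w, balanced (w, x)}.
Proof.
move=> g0; apply: filterS (ae_theta x smoothed0) => w.
by rewrite smoothed_theta add0r /balanced g0 => ->/=.
Qed.

Let Psi0_ae : gamma = 0%R -> {ae P, forall w, Psi w setT = 0}.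
Proof.
move=> g0; have mPsi : measurable_fun setT (fun w => Psi w setT) by exact: measurable_kernel.
have /(ae_eq_integral_abs P measurableT mPsi) : \int[P]_w `|Psi w setT| = 0.
  under eq_integral do rewrite gee0_abs//.
  by rewrite Psi_gamma// g0 mul0e.
by apply: filterS => w /(_ I).
Qed.

(** The fallback branch is met only on a Lebesgue-null set of x. Elsewhere integrate over x first:
    for fixed y the density integrates to gamma^-1. If gamma = 0, then [Psi] is almost surely
    null. *)
Lemma window_kernel_transports : transports_lebesgue P gamma window_kernel Psi.
Proof.
have [g0|g0] := eqVneq gamma 0%R.
  apply: filterS (Psi0_ae g0) => w w0 B mB; rewrite g0 mul0e.
  by apply/eqP; rewrite eq_le measure_ge0 andbT -w0 le_measure ?inE.
have {}g0 : (0 < gamma)%R by rewrite lt_neqAle eq_sym g0 intensity_ge0.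
have mQ : measurable [set p | balanced p].
  by rewrite -[X in measurable X]setTI; exact: (measurable_balanced measurableT (Y := [set true])).
apply: filterS (ae_fubini mQ (balanced_ae ^~ g0)) => w bw B mB.
rewrite /transport (ae_eq_integral (fun x => \int[Psi w]_y (density x y * \1_B y)%:E))//.
- rewrite (tonelli_Psi hPsi w (F := fun p => (density p.1 p.2 * \1_B p.2)%:E)).
  + rewrite (_ : (fun y => _) = (fun y => (gamma^-1)%:E * (\1_B y)%:E)).
      rewrite ge0_integralZl//.
      * by rewrite integral_indic// setIT muleA -EFinM divff ?gt_eqF// mul1e.
      * by apply/measurable_EFinP; exact: measurable_indic.
      * by rewrite lee_fin invr_ge0 ltW.
    apply/funext => y; under eq_integral do rewrite /= /density mulrAC EFinM.
    rewrite ge0_integralZl//.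
    * rewrite (ge0_integral_translation (- y) (f := fun x => (chi x)%:E)).
      + by rewrite chi1 mule1 EFinM.
      + exact/measurable_EFinP.
      + by move=> x; rewrite lee_fin.
    * apply/measurable_EFinP; apply: (measurableT_comp mchi); exact: measurable_shift.
    * by move=> x _; rewrite lee_fin.
    * by rewrite lee_fin mulr_ge0// invr_ge0 ltW.
  + apply/measurable_EFinP; apply: measurable_funM.
      by apply: measurable_funM => //; apply: (measurableT_comp mchi); exact: measurable_rV_sub.
    exact: (measurableT_comp (measurable_indic mB) measurable_snd).
  + by move=> p; rewrite lee_fin mulr_ge0.
- have := measurable_kernel window_kernel B mB.
  by move=> /(measurable_fun_pair2 w).
- have F0 (p : (Omega * 'rV[R]_d) * 'rV[R]_d) : 0 <= (density p.1.2 p.2 * \1_B p.2)%:E.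
    by rewrite lee_fin mulr_ge0.
  have mF : measurable_fun setT (fun p : (Omega * 'rV[R]_d) * 'rV[R]_d =>
      (density p.1.2 p.2 * \1_B p.2)%:E).
    apply/measurable_EFinP; apply: measurable_funM; first exact: measurable_funM.
    exact: (measurableT_comp (measurable_indic mB) measurable_snd).
  exact: (measurable_fun_pair2 w (measurable_integral_Psi hPsi mF F0)).
- by apply: filterS bw => x bx _; rewrite window_kernelE// bx.
Qed.

Lemma window_kernel_moment q :
  (forall i : q.-tuple 'I_d, exists c, {ae P, forall w,
     (Psi w).-integrable setT (EFin \o (fun x => (tensor_pow q x i * chi x)%R)) /\
     Rintegral (Psi w) setT (fun x => (tensor_pow q x i * chi x)%R) = c}) ->
  deterministic_moment P q window_kernel.
Proof.
move=> mom_det.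
have [g0|g0] := eqVneq gamma 0%R.
  (* In this case the kernel at the origin is always the Dirac mass at 0. *)
  exists (tensor_pow q 0); apply: aeW => w.
  have e : window_kernel (w, 0%R) =
      (dirac (0%R : 'rV[R]_d) : {measure set 'rV[R]_d -> \bar R}) by rewrite /window_kernel/balanced g0 ltxx.
  suff : has_moment q (window_kernel (w, 0%R)) /\ moment q (window_kernel (w, 0%R)) =
    tensor_pow q 0%R by [].
  have mt (i : q.-tuple 'I_d) : measurable_fun setT (EFin \o (fun x : 'rV[R]_d => tensor_pow q x i)).
    by apply/measurable_EFinP; exact: measurable_tensor_pow.
  rewrite e; split => [i|].
    apply/integrableP; split; first exact: mt.
    rewrite integral_dirac//; first by rewrite diracT mul1e ltry.
    by apply/measurable_EFinP; apply: measurableT_comp => //; exact: measurable_tensor_pow.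
  apply/ffunP => i; rewrite [LHS]ffunE /Rintegral integral_dirac//; last exact: mt.
  by rewrite diracT mul1e.
have {}g0 : (0 < gamma)%R by rewrite lt_neqAle eq_sym g0 intensity_ge0.
have [c hc] := choice mom_det.
exists [ffun i => (gamma^-1 * c i)%R].
have hc' : {ae P, forall w i,
     (Psi w).-integrable setT (EFin \o (fun x => (tensor_pow q x i * chi x)%R)) /\
     Rintegral (Psi w) setT (fun x => (tensor_pow q x i * chi x)%R) = c i}.
  (* The index set of tuples is finite, so finitely many null sets are united. *)
  exact: filter_forall.
apply: filterS2 (balanced_ae 0 g0) hc' => w b0 hw.
have e : window_kernel (w, 0%R) = (mdensity (Psi w) (mdensity_x 0) (density_ge0 0) :
    {measure set 'rV[R]_d -> \bar R}) by rewrite /window_kernel b0.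
suff : has_moment q (window_kernel (w, 0%R)) /\ moment q (window_kernel (w, 0%R)) =
  [ffun i => (gamma^-1 * c i)%R] by [].
rewrite e; have dE i x : (density 0 x * tensor_pow q x i = gamma^-1 * (tensor_pow q x i * chi x))%R.
  by rewrite /density sub0r chi_even -mulrA (mulrC (chi x)).
have ii i := integral_mdensity (mu := Psi w) (mdensity_x 0) (density_ge0 0)
  (f := fun x => tensor_pow q x i) (measurable_tensor_pow i).
have di i : (Psi w).-integrable setT (EFin \o (fun x => (density 0 x * tensor_pow q x i)%R)).
  under eq_fun do rewrite /= dE.
  exact: (integrableZl measurableT _ (hw i).1).
split=> [i|]; first exact: (ii i (di i)).1.
apply/ffunP => i; rewrite !ffunE /Rintegral (ii i (di i)).2.
rewrite -[LHS]/(Rintegral (Psi w) setT (fun x => density 0 x * tensor_pow q x i)%R).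
under eq_Rintegral do rewrite dE.
by rewrite (RintegralZl _ measurableT (hw i).1) (hw i).2.
Qed.

Lemma window_kernel_cost (f : 'rV[R]_d -> R) (D : R) :
  measurable_fun setT f -> (forall x, (0 <= f x)%R) ->
  (forall x, (f x * chi x <= D * cauchy_weight x)%R) ->
  \int[P]_w \int[window_kernel (w, 0%R)]_x (f x)%:E < +oo.
Proof.
move=> mf f0 fD.
have mpsi : measurable_fun setT (fun w => \int[Psi w]_x (density 0 x * f x)%:E).
  apply: measurable_integral_kernel.
  - by move=> U mU; exact: measurable_kernel.
  - by move=> x; rewrite lee_fin mulr_ge0.
  - by apply/measurable_EFinP; exact: measurable_funM.
(* The sum of the costs of the two branches dominates whichever is taken. *)
apply: (@le_lt_trans _ _ (\int[P]_w (\int[Psi w]_x (density 0 x * f x)%:E + (f 0%R)%:E))).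
  apply: ge0_le_integral => //.
  - by move=> w _; apply: integral_ge0 => x _; rewrite lee_fin.
  - apply: measurable_integral_kernel => [U mU|x|].
    + by have /(measurable_fun_pair1 (0%R : 'rV[R]_d)) := measurable_kernel window_kernel U mU.
    + by rewrite lee_fin.
    + exact/measurable_EFinP.
  - by apply: emeasurable_funD.
  - move=> w _; rewrite /window_kernel; case: ifP => _.
      rewrite ge0_integral_mdensity//; first by apply: leeDl; rewrite lee_fin.
      exact/measurable_EFinP.
    rewrite integral_dirac//; last exact/measurable_EFinP.
    rewrite diracT mul1e leeDr//.
    by apply: integral_ge0 => x _; rewrite lee_fin mulr_ge0.
rewrite ge0_integralD//; last 2 first.
- by move=> w _; apply: integral_ge0 => x _; rewrite lee_fin mulr_ge0.
- by move=> w _; rewrite lee_fin.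
have -> : \int[P]_w (f 0%R)%:E = (f 0%R)%:E by rewrite integral_cst//= probability_setT mule1.
rewrite ge0_integral_intensity.
- apply: lte_add_pinfty; last exact: ltry.
  apply: (lte_mul_pinfty (_ : 0 <= gamma%:E) (erefl true)).
    by rewrite lee_fin intensity_ge0.
  apply: (@le_lt_trans _ _ (\int[lam]_x (gamma^-1 * D * cauchy_weight x)%:E)).
    apply: ge0_le_integral => //.
    + by move=> x _; rewrite lee_fin mulr_ge0.
    + by apply/measurable_EFinP; exact: measurable_funM.
    + by apply/measurable_EFinP; apply: measurable_funM => //; exact: measurable_cauchy_weight.
    + move=> x _; rewrite lee_fin /density sub0r chi_even -!mulrA.
      by apply: ler_wpM2l; [rewrite invr_ge0 intensity_ge0|rewrite mulrC].
  rewrite ltey_eq.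
  have /(integrable_fin_num measurableT) := integrableZl measurableT (gamma^-1 * D)%R (integrable_cauchy_weight (R := R) d).
  by under eq_integral do rewrite -EFinM; move=> ->.
- by move=> x; rewrite lee_fin mulr_ge0.
- by apply/measurable_EFinP; exact: measurable_funM.
Qed.

Lemma transport_kernel_of_window :
  (forall q (i : q.-tuple 'I_d), exists c, {ae P, forall w,
     (Psi w).-integrable setT (EFin \o (fun x => (tensor_pow q x i * chi x)%R)) /\
     Rintegral (Psi w) setT (fun x => (tensor_pow q x i * chi x)%R) = c}) ->
  (forall n, exists D, forall x, (enorm x ^+ n * chi x <= D * cauchy_weight x)%R) ->
  exists K : R.-pker (Omega * 'rV[R]_d)%type ~> 'rV[R]_d,
  [/\ invariant_kernel theta K, transports_lebesgue P gamma K Psi,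
      forall q, deterministic_moment P q K &
      forall p : R, (0 <= p)%R -> moment_cost P p (fun w => K (w, 0%R)) < +oo].
Proof.
move=> mom decay; exists window_kernel; split.
- exact: window_kernel_invariant.
- exact: window_kernel_transports.
- by move=> q; apply: window_kernel_moment; exact: mom.
(* A real exponent is reduced to integers by t^p <= 1 + t^n with n the integer part of p plus one;
   each summand uses its own decay constant. *)
move=> p p0; have [D0 hD0] := decay 0%N; have [D hD] := decay (Num.truncn p).+1.
apply: (window_kernel_cost (f := fun x => (enorm x `^ p)%R) (D := (D0 + D)%R)).
- by apply: (measurableT_comp (measurable_powR p)); exact: measurable_enorm.
- by move=> x; exact: powR_ge0.
move=> x; rewrite mulrDl; apply: le_trans (lerD (hD0 x) (hD x)).
rewrite expr0 -mulrDl; apply: ler_wpM2r => //.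
have e0 := enorm_ge0 x; set t := enorm x in e0 *.
have [t1|t1] := leP t 1%R.
  apply: (@le_trans _ _ 1%R); last by rewrite lerDl exprn_ge0.
  have -> : 1%R = (1 `^ p)%R :> R by rewrite powR1.
  by rewrite ge0_ler_powR// nnegrE.
apply: (@le_trans _ _ (t ^+ (Num.truncn p).+1)%R); last by rewrite lerDr.
rewrite -powR_mulrn//; apply: ler_powR; first exact: ltW.
by apply: ltW; exact: truncnS_gt.
Qed.

End window_kernel.

Section transport_kernel.
Context {dO : measure_display} {Omega : measurableType dO} {R : realType} (d : nat).

Lemma transport_kernel_exists (P : probability Omega R)
    (theta : 'rV[R]_d -> Omega -> Omega) (Psi : R.-ker Omega ~> 'rV[R]_d) (gamma : R) :
  measurable_flow theta -> measure_preserving_flow P theta ->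
  random_measure Psi -> invariant_measure theta Psi ->
  locally_square_integrable P Psi -> has_intensity P Psi gamma ->
  infty_uniform P Psi ->
  exists K : R.-pker (Omega * 'rV[R]_d)%type ~> 'rV[R]_d,
  [/\ invariant_kernel theta K, transports_lebesgue P gamma K Psi,
      forall q, deterministic_moment P q K &
      forall p : R, 0 <= p -> (moment_cost P p (fun w => K (w, 0%R)) < +oo)%E].
Proof.
move=> htheta hP hPsi Psi_inv Psi_L2 Psi_gamma [beta hbeta [eps eps0 beta0]].
have [chi [mchi chi0 chi_even chi1 [decay band]]] := window_rV_exists d eps0.
have det q (i : q.-tuple 'I_d) : exists c, {ae P, forall w,
     (Psi w).-integrable setT (EFin \o (fun x => tensor_pow q x i * chi x)) /\
     Rintegral (Psi w) setT (fun x => tensor_pow q x i * chi x) = c}.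
  have [D D0 hD] := decay q.
  apply: (linear_deterministic (D := D) htheta hP hPsi Psi_inv Psi_L2 hbeta beta0).
  - by apply: measurable_funM => //; exact: measurable_tensor_pow.
  - move=> x; rewrite normrM (ger0_norm (chi0 x)); apply: le_trans (hD x).
    by apply: ler_wpM2r => //; exact: tensor_pow_le.
  - exact: band.
apply: (transport_kernel_of_window htheta hP hPsi Psi_inv Psi_gamma mchi chi0 chi_even chi1) => //.
(* The tensor power of order 0 is 1, so chi is the case q = 0. *)
- have [c hc] := det 0%N [tuple]; exists c.
  rewrite (_ : chi = (fun x => tensor_pow 0 x [tuple] * chi x))//.
  by apply/funext => x; rewrite ffunE big_ord0 mul1r.
- by move=> n; have [D _ hD] := decay n; exists D.
Qed.

End transport_kernel.

(** * Averaged kernels *)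

Section mixture_probability.
Local Open Scope ereal_scope.
Context d1 d2 (Y : measurableType d1) (Z : measurableType d2) (R : realType).
Variables (m : probability Y R) (k : Y -> {measure set Z -> \bar R}).
Hypothesis mk : forall U, measurable U -> measurable_fun [set: Y] (k ^~ U).
Hypothesis k1 : forall y, k y setT = 1.

Definition mixture of (forall U, measurable U -> measurable_fun [set: Y] (k ^~ U))
  & (forall y, k y setT = 1) := fun U => \int[m]_y k y U.

Let mixture0 : mixture mk k1 set0 = 0.
Proof. by rewrite /mixture; under eq_integral do rewrite measure0; rewrite integral0. Qed.

Let mixture_ge0 U : 0 <= mixture mk k1 U.
Proof. by apply: integral_ge0. Qed.

Let mixture_sigma_additive : semi_sigma_additive (mixture mk k1).
Proof.
move=> F mF tF mUF; rewrite [X in _ --> X](_ : _ = \int[m]_y \sum_(n <oo) k y (F n)); last first.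
  by apply: eq_integral => y _; apply/esym/cvg_lim => //; exact: measure_semi_sigma_additive.
rewrite integral_nneseries//; last by move=> n; exact: mk.
by apply: is_cvg_nneseries => n _ _; exact: integral_ge0.
Qed.

HB.instance Definition _ := isMeasure.Build _ _ _ (mixture mk k1)
  mixture0 mixture_ge0 mixture_sigma_additive.

Let mixture_setT : mixture mk k1 setT = 1.
Proof.
rewrite /mixture; under eq_integral do rewrite k1.
by rewrite integral_cst//= probability_setT mule1.
Qed.

HB.instance Definition _ := Measure_isProbability.Build _ _ _ (mixture mk k1) mixture_setT.

End mixture_probability.

Section translation_kernel.
Local Open Scope ereal_scope.
Context {dO : measure_display} {Omega : measurableType dO} {R : realType} (d : nat).
Variables (theta : 'rV[R]_d -> Omega -> Omega) (m : probability 'rV[R]_d R).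

Local Notation lam := (lebesgue_rV d).

Let F U (p : 'rV[R]_d * 'rV[R]_d) : \bar R := (\1_U (p.2 + p.1)%R)%:E.

Let mF U : measurable U -> measurable_fun setT (F U).
Proof.
move=> mU; apply/measurable_EFinP.
apply: (@measurableT_comp _ _ _ _ _ _ (\1_U : 'rV[R]_d -> R)); first exact: measurable_indic.
exact: measurable_rV_add.
Qed.

Let measurable_dirac_translate (x : 'rV[R]_d) U : measurable U ->
  measurable_fun setT (fun y : 'rV[R]_d => dirac (y + x)%R U : \bar R).
Proof. by move=> mU; exact: (measurable_fun_pair2 x (mF mU)). Qed.

Let dirac_translate_setT (x y : 'rV[R]_d) : dirac (y + x)%R setT = 1 :> \bar R.
Proof. exact: diracT. Qed.

Definition translation_kernel (p : Omega * 'rV[R]_d) : {measure set 'rV[R]_d -> \bar R} :=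
  mixture m (@measurable_dirac_translate p.2) (dirac_translate_setT p.2).

Let translation_kernelE p U : translation_kernel p U = \int[m]_y F U (p.2, y).
Proof. by []. Qed.

Let measurable_translation_kernel U : measurable U ->
  measurable_fun setT (translation_kernel ^~ U).
Proof.
move=> mU; under eq_fun do rewrite translation_kernelE.
apply: (measurableT_comp (f := fun x : 'rV[R]_d => \int[m]_y F U (x, y))) => //.
by apply: (measurable_fun_fubini_tonelli_F (m2 := m) (F U)); [exact: mF|move=> p; rewrite lee_fin].
Qed.

HB.instance Definition _ := isKernel.Build _ _ _ _ _ translation_kernel
  measurable_translation_kernel.

Let translation_kernel_prob p : translation_kernel p setT = 1.
Proof. exact: probability_setT. Qed.

HB.instance Definition _ := Kernel_isProbability.Build _ _ _ _ _ translation_kernel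
  translation_kernel_prob.

Lemma translation_kernel_invariant : invariant_kernel theta translation_kernel.
Proof.
move=> z w x B mB; rewrite !translation_kernelE /= translateE.
by apply: eq_integral => y _; rewrite /F; congr EFin; rewrite !indicE; congr (nat_of_bool _)%:R%R;
  apply/idP/idP; rewrite !inE /= addrA addrK.
Qed.

Lemma translation_kernel_transports (P : probability Omega R) :
  transports_lebesgue P 1 translation_kernel (fun=> lam).
Proof.
apply: aeW => w B mB; rewrite mul1e /transport.
under eq_integral do rewrite translation_kernelE.
rewrite (fubini_tonelli (m1 := lam) (m2 := m) (F B)) ?mF//.
- rewrite (_ : (fun y => _) = cst (lam B)); last first.
    apply/funext => y; under eq_integral do rewrite /F/= addrC.
    rewrite (ge0_integral_translation y (f := fun x => (\1_B x)%:E)).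
    + by rewrite integral_indic// setIT.
    + by apply/measurable_EFinP; exact: measurable_indic.
    + by move=> x; rewrite lee_fin.
  by rewrite integral_cst//= probability_setT mule1.
- exact: mF.
- by move=> p; rewrite lee_fin.
Qed.

Lemma translation_kernel0 w (U : set 'rV[R]_d) : measurable U ->
  translation_kernel (w, 0%R) U = m U.
Proof.
move=> mU; rewrite translation_kernelE/= /F; under eq_integral do rewrite addr0.
by rewrite integral_indic// setIT.
Qed.

End translation_kernel.

Section cost.
Local Open Scope ereal_scope.
Context {dO : measure_display} {Omega : measurableType dO} {R : realType} (d : nat).
Variables (P : probability Omega R) (theta : 'rV[R]_d -> Omega -> Omega).
Implicit Types K L : R.-pker (Omega * 'rV[R]_d)%type ~> 'rV[R]_d.

Let measurable_kernel0 K U : measurable U -> measurable_fun setT (fun w => K (w, 0%R) U).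
Proof.
by move=> mU; have /(measurable_fun_pair1 (0%R : 'rV[R]_d)) := measurable_kernel K U mU.
Qed.

Let measurable_cost p : measurable_fun setT (fun x : 'rV[R]_d => (enorm x `^ p)%:E).
Proof.
by apply/measurable_EFinP; apply: (measurableT_comp (measurable_powR p)); exact: measurable_enorm.
Qed.

Lemma pair_costE p K L : pair_cost P p K L =
  moment_cost P p (fun w => K (w, 0%R)) + moment_cost P p (fun w => L (w, 0%R)).
Proof.
have mK K' : measurable_fun setT (fun w => \int[K' (w, 0%R)]_x (enorm x `^ p)%:E).
  apply: measurable_integral_kernel => //; first by move=> U; exact: measurable_kernel0.
  by move=> x; rewrite lee_fin powR_ge0.
have K0 K' w : 0 <= \int[K' (w, 0%R)]_x (enorm x `^ p)%:E.
  by apply: integral_ge0 => x _; rewrite lee_fin powR_ge0.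
rewrite /pair_cost /moment_cost -ge0_integralD//.
apply: eq_integral => w _; rewrite ge0_integral_measure_add//.
by move=> x _; rewrite lee_fin powR_ge0.
Qed.

(** Averaging over Omega leaves an almost surely constant moment unchanged, so the mean law has the
    moments of almost every [K_0]; its translates move Lebesgue measure to itself. *)
Lemma mean_kernel_exists K :
  exists L : R.-pker (Omega * 'rV[R]_d)%type ~> 'rV[R]_d,
  [/\ invariant_kernel theta L, transports_lebesgue P 1 L (fun=> lebesgue_rV d),
      deterministic_kernel P L,
      forall p, moment_cost P p (fun w => L (w, 0%R)) = moment_cost P p (fun w => K (w, 0%R)) &
      forall (p : R) q, (0 <= p)%R -> (q%:R <= p)%R ->
        moment_cost P p (fun w => K (w, 0%R)) < +oo ->
        deterministic_moment P q K -> equal_moment P q K L].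
Proof.
have K1 w : K (w, 0%R) setT = 1 by exact: prob_kernel.
pose m : probability _ R := mixture P (@measurable_kernel0 K) K1.
pose L : R.-pker (Omega * 'rV[R]_d)%type ~> 'rV[R]_d := translation_kernel m.
have mE U : measurable U -> m U = \int[P]_w K (w, 0%R) U by [].
have mintE (f : 'rV[R]_d -> \bar R) : (forall x, 0 <= f x) -> measurable_fun setT f ->
    \int[m]_x f x = \int[P]_w \int[K (w, 0%R)]_x f x.
  by move=> f0 mf; rewrite (ge0_integral_mixture (@measurable_kernel0 K) mE).
have Lm w (f : 'rV[R]_d -> \bar R) : \int[L (w, 0%R)]_x f x = \int[m]_x f x.
  by apply: eq_measure_integral => U mU _; exact: translation_kernel0.
exists L; split.
- exact: translation_kernel_invariant.
- exact: translation_kernel_transports.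
- by exists (fun x B => \int[m]_y dirac (y + x)%R B); apply: aeW => w x B mB.
- move=> p; rewrite /moment_cost; under eq_integral do rewrite Lm.
  rewrite -mintE//; last by move=> x; rewrite lee_fin powR_ge0.
  by rewrite integral_cst//= probability_setT mule1.
move=> p q p0 qp Kp [c hc].
(* For q <= p, |x|^q <= 1 + |x|^p: a finite cost of order p makes the moments of order q of the mean
   law exist. *)
have tensor_le (i : q.-tuple 'I_d) (x : 'rV[R]_d) :
    `|tensor_pow q x i|%:E <= (1 + enorm x `^ p)%:E.
  rewrite lee_fin; apply: le_trans (tensor_pow_le i x) _.
  have e0 := enorm_ge0 x; have [x1|x1] := leP (enorm x) 1%R.
    by apply: (@le_trans _ _ 1%R); [exact: exprn_ile1|rewrite lerDl powR_ge0].
  rewrite -powR_mulrn//; apply: (@le_trans _ _ (enorm x `^ p)%R); last by rewrite lerDr.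
  by apply: ler_powR => //; exact: ltW.
have mt (i : q.-tuple 'I_d) : measurable_fun setT (fun x : 'rV[R]_d => (tensor_pow q x i)%:E).
  by apply/measurable_EFinP; exact: measurable_tensor_pow.
have mi i : m.-integrable setT (fun x => (tensor_pow q x i)%:E).
  apply/integrableP; split => //.
  apply: (@le_lt_trans _ _ (\int[m]_x (1 + (enorm x `^ p)%:E))).
    apply: ge0_le_integral => //.
    - exact: measurableT_comp.
    - exact: emeasurable_funD.
    - by move=> x _; rewrite -EFinD; exact: tensor_le.
  rewrite ge0_integralD//; last by move=> x _; rewrite lee_fin powR_ge0.
  rewrite integral_cst//= probability_setT mule1 mintE//.
    by rewrite lte_add_pinfty// ltry.
  by move=> x; rewrite lee_fin powR_ge0.
have mc i : Rintegral m setT (fun x => tensor_pow q x i) = c i.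
  rewrite /Rintegral (integral_mixture (@measurable_kernel0 K) mE (mi i)).2.
  rewrite (ae_eq_integral (cst (c i)%:E))//.
  - by rewrite integral_cst//= probability_setT mule1.
  - under eq_fun do rewrite integralE.
    by apply: emeasurable_funB; apply: measurable_integral_kernel => //;
      [exact: measurable_kernel0|exact: measurable_funepos|
       exact: measurable_kernel0|exact: measurable_funeneg].
  - apply: filterS hc => w [hw /ffunP/(_ i)]; rewrite ffunE => <- _.
    by rewrite /= fineK//; exact: (integrable_fin_num measurableT (hw i)).
apply: filterS hc => w [hw wc]; split => //.
- move=> i; apply/integrableP; split => //.
  by rewrite Lm; have /integrableP[] := mi i.
- apply/ffunP => i; rewrite wc !ffunE /Rintegral Lm.
  by rewrite -[X in (_ - X)%R]/(Rintegral m setT (fun x => tensor_pow q x i)) mc subrr.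
Qed.

End cost.

Lemma ae_exists d (T : measurableType d) (R : realType) (P : probability T R)
  (Q : set T) : {ae P, forall t, Q t} -> exists t, Q t.
Proof.
move=> [A [mA A0 QA]]; apply: contrapT => /forallNP nQ.
have := @probability_setT _ _ _ P.
have -> : [set: T] = A by apply/seteqP; split => // t _; apply: QA; exact: nQ.
by rewrite A0 => /esym/eqP; rewrite onee_eq0.
Qed.

Theorem theorem6p5 (R : realType) (d : nat) (hd : (0 < d)%N)
    (dO : measure_display) (Omega : measurableType dO) (P : probability Omega R)
    (theta : 'rV[R]_d -> Omega -> Omega)
    (htheta : measurable_flow theta)
    (hP : measure_preserving_flow P theta)
    (Psi : R.-ker Omega ~> 'rV[R]_d) (gamma : R)
    (hPsi : random_measure Psi)
    (Psi_inv : invariant_measure theta Psi)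
    (Psi_L2 : locally_square_integrable P Psi)
    (Psi_gamma : has_intensity P Psi gamma)
    (Psi_unif : infty_uniform P Psi) :
  let good (K L : R.-pker (Omega * 'rV[R]_d)%type ~> 'rV[R]_d) :=
    [/\ invariant_kernel theta K /\ invariant_kernel theta L,
        transports_lebesgue P gamma K Psi,
        transports_lebesgue P 1 L (fun=> lebesgue_rV d),
        forall q : nat, (0 < q)%N -> (pair_cost P q%:R K L < +oo)%E &
        forall q : nat, (0 < q)%N -> equal_moment P q K L] in
  [/\ exists K L, good K L,
      exists K L, good K L /\ deterministic_kernel P L,
      forall K L, good K L -> deterministic_kernel P L ->
        forall q : nat, (0 < q)%N -> deterministic_moment P q K &
      forall p : R, 1 <= p ->
        (transport_dist P theta Psi gamma p
           <= 2%:E * transport_dist_tilde P theta Psi gamma p < +oo)%E].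
Proof.
move=> good.
have [K [K_inv K_tr K_mom K_cost]] :=
  transport_kernel_exists htheta hP hPsi Psi_inv Psi_L2 Psi_gamma Psi_unif.
have [L [L_inv L_tr L_det L_cost L_mom]] := mean_kernel_exists P theta K.
have goodKL : good K L.
  split => // q q0; first by rewrite pair_costE L_cost lte_add_pinfty// K_cost.
  exact: (L_mom q%:R _ _ (lexx _) (K_cost _ (ler0n _ q)) (K_mom q)).
split; [by exists K, L|by exists K, L| |].
  move=> {K_inv K_tr K_mom K_cost L_inv L_tr L_det L_cost L_mom goodKL} K' L'.
  move=> [_ _ _ _ mom] [k kE] q q0.
  have ae_mom := mom q q0.
  have [w0 kw0] := ae_exists kE.
  (* The constant is read at one sample point where [L'] agrees with its deterministic version. *)
  exists (moment q (L' (w0, 0))); apply: filterS2 ae_mom kE => w [hK hL KL] kw.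
  split => //; move/eqP: KL; rewrite subr_eq0 => /eqP ->.
  apply/ffunP => i; rewrite !ffunE /Rintegral; congr fine.
  by apply: eq_measure_integral => U mU _; transitivity (k 0 U); [exact: kw|exact/esym/kw0].
move=> p p1; have p0 : 0 <= p by exact: le_trans p1.
apply/andP; split; last first.
  apply: (lte_mul_pinfty (_ : 0 <= 2%:E)%E (erefl true)); first by rewrite lee_fin.
  apply: le_lt_trans (K_cost p p0); apply: ereal_inf_lbound; exists K; split => //.
rewrite -lee_pdivrMl//; apply: le_ereal_inf_tmp => _ [K' [K'_inv K'_tr K'_mom ->]].
rewrite lee_pdivrMl//.
(* A competitor of infinite cost gives a trivial bound. For the others, q <= p / 2 - 1 implies q <=
   p, so finite cost guarantees the moments needed to compare [K'] with its mean kernel. *)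
have [->|K'_fin] := eqVneq (moment_cost P p (fun w => K' (w, 0))) +oo%E.
  by rewrite gt0_muley ?leey// lte_fin.
have [L' [L'_inv L'_tr _ L'_cost L'_mom]] := mean_kernel_exists P theta K'.
apply: ereal_inf_lbound; exists K', L'; split => //.
- move=> q q0 qp; apply: (L'_mom p) => //.
  + by apply: le_trans qp _; lra.
  + by rewrite ltey.
  + exact: K'_mom.
- by rewrite pair_costE L'_cost mule_natl mule2n.
Qed.
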